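(* Let $0<q<\infty$ and $\omega\in\mathcal{I}\cup\mathcal{R}$. Then there exists $f\in\bigcap_{0<p<q}A^p_\omega$ with $f(0)\neq0$ such that its zero sequence $\{z_k\}$, repeated according to multiplicity and ordered by increasing moduli, does not satisfy $$\prod_{k=1}^n\frac{1}{|z_k|}=\mathrm{o}\left(\left(\int_{1-\frac1n}^1\omega(r)\,dr\right)^{-\frac1q}\right),\quad n\to\infty .$$ In particular, there is a $\bigcap_{0<p<q}A^p_\omega$-zero set which is not an $A^q_\omega$-zero set.
   Context: $\mathbb{D}$ is the open unit disc of $\mathbb{C}$ and $dA=\frac{dx\,dy}{\pi}$. A weight is a function $\omega:\mathbb{D}\to(0,\infty)$ integrable over $\mathbb{D}$; it is radial if $\omega(z)=\omega(|z|)$. For a radial weight put $\psi_\omega(r)=\frac{1}{\omega(r)}\int_r^1\omega(s)\,ds$, $0\le r<1$. $\mathcal{R}$ is the class of continuous radial weights for which there is $C\ge1$ with $C^{-1}(1-r)\le\psi_\omega(r)\le C(1-r)$ for all $0\le r<1$. $\mathcal{I}$ is the class of continuous radial weights with $\lim_{r\to1^-}\frac{\psi_\omega(r)}{1-r}=\infty$. $A^p_\omega$ consists of analytic functions $f$ in $\mathbb{D}$ with $\|f\|_{A^p_\omega}^p=\int_{\mathbb{D}}|f|^p\omega\,dA<\infty$. For a space $X$ of analytic functions in $\mathbb{D}$, a sequence $\{z_k\}$ is an $X$-zero set if some $f\in X$ vanishes precisely on the points $z_k$ (counted with multiplicity) and nowhere else. *)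

(* Defs.v *)
From HB Require Import structures.
From mathcomp Require Import all_boot all_order all_algebra.
From mathcomp Require Import complex.
From mathcomp Require Import all_classical all_reals all_analysis.

Set Implicit Arguments.
Unset Strict Implicit.
Unset Printing Implicit Defensive.

Import Order.TTheory GRing.Theory Num.Theory.
Import numFieldNormedType.Exports.

Local Open Scope classical_set_scope.
Local Open Scope card_scope.
Local Open Scope complex_scope.
Local Open Scope ring_scope.

                                                                            
                                                                       
Definition cplx (R : realType) : numClosedFieldType := R[i].

Section BergmanSpaces.
Variable R : realType.
Local Notation C := (cplx R).
Implicit Types (f g : C -> C) (w : C -> R) (z : nat -> C).

                                                               
Definition cabs (a : C) : R := ComplexField.Normc.normc a.

Definition disc : set C := [set a | cabs a < 1].

Definition of_xy (xy : R * R) : C := xy.1 +i* xy.2.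

Local Notation leb2 := (@lebesgue_measure R \x @lebesgue_measure R)%E.

                                                     
Definition disc_integral (h : C -> \bar R) : \bar R :=
  ((pi^-1)%:E * \int[leb2]_(xy in of_xy @^-1` disc) h (of_xy xy))%E.

Definition analytic_at f (a : C) : Prop :=
  exists c : nat -> C,
    \forall x \near a, [series c k * (x - a) ^+ k]_k @ \oo --> f x.

                                                                     
Definition analytic_in_disc f : Prop := forall a, disc a -> analytic_at f a.

                                                               
Definition zero_order f (a : C) (m : nat) : Prop :=
  exists g, [/\ analytic_at g a, g a != 0
    & \forall x \near a, f x = (x - a) ^+ m * g x].

                                                                              
                                                      
Definition zero_sequence f z : Prop :=
  (forall k, disc (z k)) /\
  (forall a, disc a ->
     exists2 m, zero_order f a m & [set k | z k = a] #= `I_m).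

Definition zero_set (X : set (C -> C)) z : Prop :=
  exists2 f, X f & zero_sequence f z.

Definition weight w : Prop :=
  (forall a, disc a -> 0 < w a) /\
  leb2.-integrable (of_xy @^-1` disc) (fun xy => (w (of_xy xy))%:E).

Definition radial w : Prop := forall a, disc a -> w a = w (cabs a)%:C.

Definition continuous_radial_weight w : Prop :=
  [/\ weight w, radial w & {within disc, continuous w}].

Definition tail w (r : R) : R :=
  \int[@lebesgue_measure R]_(s in `[r, 1[) w s%:C.

Definition psi w (r : R) : R := (w r%:C)^-1 * tail w r.

Definition regular_weight w : Prop :=
  continuous_radial_weight w /\
  exists2 K : R, 1 <= K &
    forall r : R, 0 <= r < 1 -> K^-1 * (1 - r) <= psi w r <= K * (1 - r).

Definition rapidly_increasing_weight w : Prop :=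
  continuous_radial_weight w /\ psi w r / (1 - r) @[r --> 1^'-] --> +oo.

Definition bergman (p : R) w : set (C -> C) :=
  [set f | analytic_in_disc f /\
    (disc_integral (fun a => ((cabs (f a)) `^ p * w a)%:E) < +oo)%E].

End BergmanSpaces.

(* Main.v *)
Require Import Defs.
From HB Require Import structures.
From mathcomp Require Import all_boot all_order all_algebra.
From mathcomp Require Import complex.
From mathcomp Require Import all_classical all_reals all_analysis.
From mathcomp Require Import separable measurable_realfun ring lra zify.

Set Implicit Arguments.
Unset Strict Implicit.
Unset Printing Implicit Defensive.

Import Order.TTheory GRing.Theory Num.Theory.
Import numFieldNormedType.Exports.

Local Open Scope classical_set_scope.
Local Open Scope ring_scope.

(** Write [T r] for the tail [tail w r].  Both classes of weights satisfy a lower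
    bound [k * (1 - r) * w r <= T r] near 1, and the whole proof uses the weight
    through this bound only.  It makes [T] doubling (lemma [tail_doubling]):
    [T r <= D * T ((1 + r) / 2)].

    The function is an infinite product of factors [1 + a j * x ^+ N j] with
    amplitudes [a j] that are squares of multiples of [j.+1].  Write [A k] for the
    product of the first [k] amplitudes.  The exponent [N k] is the first [n] at which
    [T (1 - 1 / n)] falls below [A k.+1 `^ (- q)]; by doubling the tail is then
    comparable to this power, and if the amplitudes are large against [D] the exponents
    at least double at each step ([exponents_exist]).  The [N j] zeros of a factor lie
    on a circle, and the product of their moduli is [1 / a j].  Hence the first
    [N 0 + ... + N k <= 2 * N k] zeros give the product [A k.+1], which is as large as a
    multiple of the tail to the power [- 1 / q]: along this subsequence the
    little-o relation fails.  On the other hand the product is at most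
    [F ^+ k.+1 * A k.+1] in modulus where [|x| <= 1 - 1 / N k] ([product_growth]).
    Integrating the power [p] of this bound over the successive rings leads to a series
    with general term comparable to [F ^+ (k * p) * a k.+1 `^ p * A k.+1 `^ (p - q)],
    which converges for [p < q] because the amplitudes tend to infinity
    ([growth_summable], [bergman_of_growth]).

    For the second claim it remains to show that the zeros of any [g] in the space with
    exponent [q] and [g 0 != 0] do satisfy the little-o relation
    ([bergman_zeros_small]).  Divide [g] by the Blaschke factors, for the disc of radius
    [r = 1 - 1 / n], of those of its first [n] zeros that lie in this disc.  The quotient
    [H] satisfies [|H| <= |g|] where [r <= |x|], the logarithm of [|H|] is harmonic off the
    zeros of [H], and [|H|] at 0 is [|g 0|] times the product of the ratios [r / |z k|].
    The power [q] of [|H|] is subharmonic, so its value at 0 times the mass of the ring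
    [r <= |x| < 1], which is comparable to [T r], is at most the integral of
    [|g| `^ q * w] over that ring, which tends to 0.

    Subharmonicity is handled through means over the four points [b + i ^+ k * z]: an
    inequality for them up to an error of third order in [z] suffices for a maximum
    principle in the radius ([radial_maximum_principle]).  This replaces integrals over
    circles, Cauchy's formula and Jensen's formula; analyticity enters through
    power series only. *)

(** * Moduli and limits of complex numbers *)

Section Modulus.
Variable R : realType.
Local Notation C := (cplx R).
Implicit Types (a b x y : C) (u : nat -> C).

Lemma normE x : `|x| = (cabs x)%:C%C.
Proof. by []. Qed.

Lemma cabsM x y : cabs (x * y) = cabs x * cabs y.
Proof. exact: ComplexField.Normc.normcM. Qed.

Lemma cabs_ge0 x : 0 <= cabs x.
Proof. by case: x => p q; rewrite /cabs /= sqrtr_ge0. Qed.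

Lemma cabs0 : cabs (0 : C) = 0.
Proof. exact: ComplexField.Normc.normc0. Qed.

Lemma cabs1 : cabs (1 : C) = 1.
Proof. exact: ComplexField.Normc.normc1. Qed.

Lemma cabs_eq0 x : (cabs x == 0) = (x == 0).
Proof.
apply/eqP/eqP => [|->]; last exact: cabs0.
exact: ComplexField.Normc.eq0_normc.
Qed.

Lemma cabs_gt0 x : (0 < cabs x) = (x != 0).
Proof. by rewrite lt_def cabs_ge0 andbT cabs_eq0. Qed.

Lemma cabsD x y : cabs (x + y) <= cabs x + cabs y.
Proof. by have := ler_normD x y; rewrite !normE -rmorphD /= lecR. Qed.

Lemma cabsN x : cabs (- x) = cabs x.
Proof. exact: (normcN (x : Rcomplex R)). Qed.

Lemma cabsB x y : cabs (x - y) <= cabs x + cabs y.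
Proof. by rewrite -(cabsN y) cabsD. Qed.

Lemma cabs_distC x y : cabs (x - y) = cabs (y - x).
Proof. by rewrite -cabsN opprB. Qed.

Lemma cabs_triB x y : cabs x - cabs y <= cabs (x - y).
Proof. by rewrite lerBlDr -{1}(subrK y x) cabsD. Qed.

Lemma cabsV x : cabs x^-1 = (cabs x)^-1.
Proof. exact: ComplexField.Normc.normcV. Qed.

Lemma cabsX x n : cabs (x ^+ n) = cabs x ^+ n.
Proof.
by elim: n => [|n ih]; rewrite ?expr0 ?cabs1// !exprS cabsM ih.
Qed.

Lemma cabsR (r : R) : cabs r%:C%C = `|r|.
Proof. by rewrite /cabs /= expr0n addr0 sqrtr_sqr. Qed.

Lemma cabsMn x n : cabs (x *+ n) = cabs x *+ n.
Proof. exact: (normcMn (x : Rcomplex R)). Qed.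

Lemma cabs_prod I (s : seq I) (P : pred I) (F : I -> C) :
  cabs (\prod_(i <- s | P i) F i) = \prod_(i <- s | P i) cabs (F i).
Proof. exact: (big_morph _ cabsM cabs1). Qed.

Lemma cabs_sum I (s : seq I) (P : pred I) (F : I -> C) :
  cabs (\sum_(i <- s | P i) F i) <= \sum_(i <- s | P i) cabs (F i).
Proof.
elim/big_rec2 : _ => [|i y1 y2 _ h]; first by rewrite cabs0.
by apply: le_trans (cabsD _ _) _; rewrite lerD2l.
Qed.

Lemma sqr_cabs x : cabs x ^+ 2 = complex.Re x ^+ 2 + complex.Im x ^+ 2.
Proof. by case: x => p q; rewrite /cabs /= sqr_sqrtr// addr_ge0// sqr_ge0. Qed.

Lemma Re_le_cabs x : `|complex.Re x| <= cabs x.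
Proof.
rewrite -(@ler_pXn2r _ 2)// ?nnegrE ?cabs_ge0// sqr_cabs.
by rewrite real_normK ?num_real// lerDl sqr_ge0.
Qed.

Lemma Im_le_cabs x : `|complex.Im x| <= cabs x.
Proof.
rewrite -(@ler_pXn2r _ 2)// ?nnegrE ?cabs_ge0// sqr_cabs.
by rewrite real_normK ?num_real// lerDr sqr_ge0.
Qed.

Lemma cabs_le_ReIm x : cabs x <= `|complex.Re x| + `|complex.Im x|.
Proof.
rewrite -(@ler_pXn2r _ 2)// ?nnegrE ?cabs_ge0 ?addr_ge0// sqr_cabs.
rewrite sqrrD !real_normK ?num_real//.
by rewrite -addrA lerD2l lerDr mulrn_wge0// mulr_ge0.
Qed.

Lemma cplx_gt0 (e : C) : 0 < e -> exists2 r : R, 0 < r & e = r%:C%C.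
Proof.
case: e => p q; rewrite ltcE /= => /andP[/eqP -> p0]; exists p => //.
Qed.

Lemma nbhs_cplx a (P : set C) :
  nbhs a P <-> exists2 d : R, 0 < d & forall x, cabs (x - a) < d -> P x.
Proof.
split.
- move=> /nbhs_ballP[e /= /cplx_gt0[d d0 ->] sP]; exists d => // x xa; apply: sP.
  by rewrite -ball_normE /= normE ltcR cabs_distC.
- move=> [d d0 sP]; apply/nbhs_ballP; exists d%:C%C => /=.
    by rewrite ltcR.
  by move=> x; rewrite -ball_normE /= normE ltcR cabs_distC; exact: sP.
Qed.

Lemma cvg_cplx u a : u @ \oo --> a <->
  forall e : R, 0 < e -> exists N, forall n, (N <= n)%N -> cabs (u n - a) < e.
Proof.
split=> [ua e e0|h P /nbhs_cplx[d d0 sP]].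
- have : nbhs a [set x | cabs (x - a) < e] by apply/nbhs_cplx; exists e.
  by move=> /ua[N _ hN]; exists N => n Nn; exact: hN.
- by have [N hN] := h _ d0; exists N => // n /= Nn; exact/sP/hN.
Qed.

Lemma cvg_real (u : nat -> R) (a : R) : u @ \oo --> a <->
  forall e : R, 0 < e -> exists N, forall n, (N <= n)%N -> `|u n - a| < e.
Proof.
split=> [/cvgrPdist_lt h e /h[N _ hN]|h].
- by exists N => n /hN; rewrite distrC.
- apply/cvgrPdist_lt => e /h[N hN]; exists N => // n /hN.
  by rewrite distrC.
Qed.

Lemma cvg_ReIm u a : (fun n => complex.Re (u n)) @ \oo --> complex.Re a ->
  (fun n => complex.Im (u n)) @ \oo --> complex.Im a -> u @ \oo --> a.
Proof.
move=> /cvg_real hr /cvg_real hi; apply/cvg_cplx => e e0.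
have e20 : 0 < e / 2 by rewrite divr_gt0.
have [[N hN] [M hM]] := (hr _ e20, hi _ e20).
exists (maxn N M) => n; rewrite geq_max => /andP[/hN h1 /hM h2].
apply: le_lt_trans (cabs_le_ReIm _) _.
rewrite !raddfB [e](splitr e); exact: ltrD.
Qed.

Lemma cvg_cabs_le u a M : u @ \oo --> a ->
  (exists N, forall n, (N <= n)%N -> cabs (u n) <= M) -> cabs a <= M.
Proof.
move=> /cvg_cplx ua [N hN]; apply/ler_addgt0Pr => e /ua[N' hN'].
have h1 := hN' _ (leq_maxr N N'); have h2 := hN _ (leq_maxl N N').
have := cabs_triB a (u (maxn N N')); rewrite cabs_distC; lra.
Qed.

Lemma cplx_cvg_unique u a b : u @ \oo --> a -> u @ \oo --> b -> a = b.
Proof.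
move=> ua ub; apply/eqP; rewrite -subr_eq0 -cabs_eq0 eq_le cabs_ge0 andbT.
apply/ler_addgt0Pr => e e0.
have e20 : 0 < e / 2 by rewrite divr_gt0.
move/cvg_cplx : ua => /(_ _ e20)[N hN]; move/cvg_cplx : ub => /(_ _ e20)[M hM].
have h1 := hN _ (leq_maxl N M); have h2 := hM _ (leq_maxr N M).
have := cabsD (a - u (maxn N M)) (u (maxn N M) - b); rewrite subrKA.
rewrite (cabs_distC a); lra.
Qed.

(** Absolute convergence in the plane comes from that on the line, applied to
    the real and imaginary parts. *)
Lemma abs_series_cvg u M :
  (forall N, \sum_(k < N) cabs (u k) <= M) ->
  exists2 a, (fun N => \sum_(k < N) u k) @ \oo --> a & cabs a <= M.
Proof.
move=> hu.
have key (v : nat -> R) : (forall k, `|v k| <= cabs (u k)) ->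
    cvgn (fun N => \sum_(k < N) v k).
  move=> hv.
  rewrite (_ : (fun N => _) = series v); last first.
    by apply/funext => N; rewrite /series /= big_mkord.
  apply: normed_cvg.
  have -> : [normed series v] = (fun N => \sum_(k < N) `|v k|).
    by apply/funext => N; rewrite /normed_series_of /series /= big_mkord.
  apply: nondecreasing_is_cvgn.
    by apply/nondecreasing_seqP => n; rewrite big_ord_recr/= lerDl.
  exists M => _ [n _ <-]; apply: le_trans (hu n); exact: ler_sum.
have hr := key _ (fun k => Re_le_cabs (u k)).
have hi := key _ (fun k => Im_le_cabs (u k)).
pose a : C := (limn (fun N => \sum_(k < N) complex.Re (u k)) +i*
        limn (fun N => \sum_(k < N) complex.Im (u k)))%C.
have ua : (fun N => \sum_(k < N) u k) @ \oo --> a.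
  apply: cvg_ReIm => /=.
    by under eq_fun do rewrite raddf_sum; exact: hr.
  by under eq_fun do rewrite raddf_sum; exact: hi.
exists a => //; apply: (cvg_cabs_le ua); exists 0%N => n _.
exact: le_trans (cabs_sum _ _ _) (hu n).
Qed.

Lemma cvg_addC u (v : nat -> C) a b : u @ \oo --> a -> v @ \oo --> b ->
  (fun n => u n + v n) @ \oo --> a + b.
Proof.
move=> /cvg_cplx ha /cvg_cplx hb; apply/cvg_cplx => e e0.
have e20 : 0 < e / 2 by rewrite divr_gt0.
have [[N hN] [M hM]] := (ha _ e20, hb _ e20).
exists (maxn N M) => n; rewrite geq_max => /andP[/hN h1 /hM h2].
by rewrite opprD addrACA (le_lt_trans (cabsD _ _))// [e]splitr ltrD.
Qed.

Lemma cvg_mulC u (c : C) a : u @ \oo --> a -> (fun n => c * u n) @ \oo --> c * a.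
Proof.
move=> /cvg_cplx ha; apply/cvg_cplx => e e0.
have c1 : 0 < cabs c + 1 by rewrite ltr_wpDl ?cabs_ge0.
have [N hN] := ha _ (divr_gt0 e0 c1).
exists N => n /hN; rewrite -mulrBr cabsM ltr_pdivlMr//; apply: le_lt_trans.
by rewrite mulrDr mulr1 mulrC lerDl cabs_ge0.
Qed.

Lemma cvg_oppC u a : u @ \oo --> a -> (fun n => - u n) @ \oo --> - a.
Proof.
by move=> ha; have := @cvg_mulC u (-1) a ha; rewrite mulN1r; under eq_fun do rewrite mulN1r.
Qed.

Lemma cvg_cstC a : (fun=> a) @ \oo --> a.
Proof. exact: cvg_cst. Qed.

Lemma cvg_sumC n (U : nat -> nat -> C) (A : nat -> C) :
  (forall j, (j < n)%N -> U j @ \oo --> A j) ->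
  (fun N => \sum_(j < n) U j N) @ \oo --> \sum_(j < n) A j.
Proof.
elim: n => [|n ih] h.
  by under eq_fun do rewrite big_ord0; rewrite big_ord0; exact: cvg_cstC.
under eq_fun do rewrite big_ord_recr; rewrite big_ord_recr /=.
by apply: cvg_addC; [apply: ih => j jn; apply: h; exact: ltnW | exact: h].
Qed.

End Modulus.

(** * Power series *)

Section PowerSeries.
Variable R : realType.
Local Notation C := (cplx R).
Implicit Types (a b x y : C) (c d : nat -> C) (f : C -> C).

Definition psum c x N : C := \sum_(k < N) c k * x ^+ k.

(** The bound on the coefficients, which Cauchy's estimates would give from the
    convergence, is part of the notion: it makes all error terms explicit. *)
Definition expands f a c (s M : R) : Prop :=
  [/\ 0 < s, forall k, cabs (c k) * s ^+ k <= M
    & forall x, cabs x < s -> psum c x @ \oo --> f (a + x)].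

Lemma geom_tail (v : nat -> R) (M t : R) J N : 0 <= t < 1 ->
  (forall k, 0 <= v k <= M * t ^+ k) -> (forall k, (k < J)%N -> v k = 0) ->
  \sum_(k < N) v k <= M * t ^+ J / (1 - t).
Proof.
move=> /andP[t0 t1] hv v0.
have M0 : 0 <= M by have /andP[/le_trans h1 /h1] := hv 0%N; rewrite expr0 mulr1.
have t10 : 0 < 1 - t by lra.
have geo n : \sum_(k < n) t ^+ k <= (1 - t)^-1.
  rewrite -[leRHS]mul1r ler_pdivlMr// mulrC -opprB mulNr -subrX1 opprB.
  by rewrite lerBlDr lerDl exprn_ge0.
apply: (@le_trans _ _ (\sum_(k < J + N) v k)).
  rewrite addnC big_split_ord /= lerDl sumr_ge0// => k _.
  by have /andP[] := hv (N + k)%N.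
rewrite big_split_ord /= big1 ?add0r => [|k _]; last exact: v0.
apply: (@le_trans _ _ (\sum_(k < N) (M * t ^+ J) * t ^+ k)).
  apply: ler_sum => k _; rewrite -mulrA -exprD.
  by have /andP[] := hv (J + k)%N.
by rewrite -mulr_sumr ler_wpM2l// mulr_ge0// exprn_ge0.
Qed.

Lemma sum_ord_split (V : nmodType) (g : nat -> V) J m : (J <= m)%N ->
  \sum_(j < m) g j = \sum_(j < J) g j + \sum_(j < m - J) g (J + j)%N.
Proof.
move=> Jm; transitivity (\sum_(j < J + (m - J)) g j); first by rewrite subnKC.
exact: big_split_ord.
Qed.

Lemma big_ord_trunc (g : nat -> C) m n : (forall j, (m <= j)%N -> g j = 0) ->
  \sum_(j < m + n) g j = \sum_(j < m) g j.
Proof. by move=> g0; rewrite big_split_ord /= [X in _ + X]big1 ?addr0// => k _; rewrite g0// leq_addr. Qed.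

Lemma exprD_trunc a x k J : (k < J)%N ->
  \sum_(j < J) (a ^+ (k - j) * x ^+ j) *+ 'C(k, j) = (a + x) ^+ k.
Proof.
move=> kJ; rewrite exprDn -(subnKC kJ).
rewrite (@big_ord_trunc (fun j => (a ^+ (k - j) * x ^+ j) *+ 'C(k, j)))//.
by move=> j kj; rewrite bin_small ?mulr0n.
Qed.

Lemma exprD_tail_le a x k J :
  cabs ((a + x) ^+ k - \sum_(j < J) (a ^+ (k - j) * x ^+ j) *+ 'C(k, j))
  <= (cabs a + cabs x) ^+ k.
Proof.
pose g j : C := (a ^+ (k - j) * x ^+ j) *+ 'C(k, j).
have [kJ|Jk] := ltnP k J.
  by rewrite exprD_trunc// subrr cabs0 exprn_ge0// addr_ge0 ?cabs_ge0.
rewrite (_ : _ - _ = \sum_(j < k.+1 - J) g (J + j)%N); last first.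
  by rewrite exprDn (sum_ord_split g (leqW Jk)) addrC addKr.
have -> : (cabs a + cabs x) ^+ k = \sum_(j < k.+1) cabs (g j).
  rewrite exprDn; apply: eq_bigr => j _.
  by rewrite /g cabsMn cabsM !cabsX.
rewrite (sum_ord_split (fun j => cabs (g j)) (leqW Jk)) -[leLHS]add0r.
rewrite lerD//; first by rewrite sumr_ge0// => *; exact: cabs_ge0.
exact: cabs_sum.
Qed.

(** Expanding every power of a + x by the binomial theorem gives a doubly
    indexed sum; truncating it in the exponent of x costs at most the tail of
    a geometric series, so no exchange of infinite sums is needed. *)
Lemma reexpand f c (r M s : R) a : expands f 0 c r M -> 0 < s ->
  cabs a + s < r ->
  exists d, expands f a d s (M / (1 - (cabs a + s) / r)).
Proof.
move=> [r0 cM cf] s0 asr.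
set t := (cabs a + s) / r.
have a0 := cabs_ge0 a.
have as0 : 0 <= cabs a + s by rewrite addr_ge0// ltW.
have t0 : 0 <= t by rewrite divr_ge0// ltW.
have t1 : t < 1 by rewrite ltr_pdivrMr// mul1r.
have t01 : 0 <= t < 1 by rewrite t0.
have t10 : 0 < 1 - t by lra.
have ct k : cabs (c k) * (cabs a + s) ^+ k <= M * t ^+ k.
  rewrite expr_div_n mulrA ler_pdivlMr ?exprn_gt0// -mulrA [X in _ * X]mulrC mulrA.
  by rewrite ler_wpM2r// exprn_ge0.
pose u j k : C := c k * a ^+ (k - j) *+ 'C(k, j).
have hu j : exists2 e, (fun N => \sum_(k < N) u j k) @ \oo --> e &
    cabs e <= M / (1 - t) / s ^+ j.
  apply: abs_series_cvg => N; rewrite ler_pdivlMr ?exprn_gt0//.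
  rewrite mulr_suml.
  have := @geom_tail (fun k => cabs (u j k) * s ^+ j) M t 0 N t01.
  rewrite expr0 mulr1; apply => // k; apply/andP; split.
    by rewrite mulr_ge0 ?cabs_ge0// exprn_ge0// ltW.
  apply: le_trans (ct k); rewrite /u cabsMn cabsM cabsX -mulrnAr -mulrA.
  rewrite ler_wpM2l ?cabs_ge0// mulrnAl.
  have [kj|jk] := ltnP k j.
    by rewrite bin_small// mulr0n exprn_ge0.
  rewrite exprDn (bigD1 (Ordinal (jk : j < k.+1)%N))//= lerDl sumr_ge0// => i _.
  by rewrite mulrn_wge0// mulr_ge0 ?exprn_ge0// ltW.
have /choice[d hd] : forall j, exists e, (fun N => \sum_(k < N) u j k) @ \oo --> e /\
    cabs e <= M / (1 - t) / s ^+ j by move=> j; have [e h1 h2] := hu j; exists e.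
exists d; split=> // [k|x xs].
  by have [_] := hd k; rewrite ler_pdivlMr ?exprn_gt0.
have M0 : 0 <= M by have := cM 0%N; rewrite expr0 mulr1; apply: le_trans; exact: cabs_ge0.
have err J : cabs (f (a + x) - psum d x J) <= M * t ^+ J / (1 - t).
  have axr : cabs (a + x) < r by apply: le_lt_trans (cabsD _ _) _; lra.
  have lim1 := cf _ axr; rewrite add0r in lim1.
  have lim2 : (fun N => \sum_(j < J) x ^+ j * \sum_(k < N) u j k) @ \oo --> psum d x J.
    have h := @cvg_sumC _ J (fun j N => x ^+ j * \sum_(k < N) u j k)
      (fun j => x ^+ j * d j).
    rewrite /psum (eq_bigr (fun j : 'I_J => x ^+ j * d j)); last first.
      by move=> j _; rewrite mulrC.
    by apply: h => j _; apply: cvg_mulC; have [] := hd j.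
  have L := cvg_addC lim1 (cvg_oppC lim2).
  apply: (cvg_cabs_le L); exists 0%N => N _.
  pose D k := (a + x) ^+ k - \sum_(j < J) (a ^+ (k - j) * x ^+ j) *+ 'C(k, j).
  rewrite (_ : _ + _ = \sum_(k < N) c k * D k); last first.
    under [X in _ - X]eq_bigr do rewrite mulr_sumr.
    rewrite exchange_big /= /psum -sumrB; apply: eq_bigr => k _.
    rewrite /D mulrBr mulr_sumr; congr (_ - _); apply: eq_bigr => j _.
    by rewrite /u !mulrnAr; congr (_ *+ _); ring.
  apply: le_trans (cabs_sum _ _ _) _.
  apply: (@geom_tail (fun k => cabs (c k * D k))) => // k; last first.
    by move=> kJ; rewrite /D exprD_trunc// subrr mulr0 cabs0.
  rewrite cabs_ge0 /= cabsM; apply: le_trans (ct k).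
  rewrite ler_wpM2l ?cabs_ge0//; apply: le_trans (exprD_tail_le _ _ _ _) _.
  by rewrite lerXn2r// ?nnegrE ?addr_ge0 ?cabs_ge0// ?lerD2l ltW.
apply/cvg_cplx => e e0.
have : geometric (M / (1 - t)) t @ \oo --> (0 : R).
  by apply: cvg_geometric; rewrite ger0_norm.
move=> /cvg_real/(_ _ e0)[N hN]; exists N => n /hN.
rewrite subr0 cabs_distC; apply: le_lt_trans.
by apply: le_trans (err n) _; rewrite mulrAC ler_norm.
Qed.

Lemma expands_taylor f a c (s M : R) J x : expands f a c s M ->
  cabs x <= s / 2 ->
  cabs (f (a + x) - psum c x J) <= 2 * M * (cabs x / s) ^+ J.
Proof.
move=> [s0 cM cf] xs.
have x0 := cabs_ge0 x.
have xs' : cabs x < s by lra.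
have t2 : cabs x / s <= 2^-1 by rewrite ler_pdivrMr// mulrC.
have t0 : 0 <= cabs x / s by rewrite divr_ge0// ltW.
have M0 : 0 <= M by have := cM 0%N; rewrite expr0 mulr1; apply: le_trans; exact: cabs_ge0.
have L := cvg_addC (cf _ xs') (@cvg_cstC _ (- psum c x J)).
apply: (cvg_cabs_le L).
exists J => N JN.
have -> : psum c x N - psum c x J = \sum_(k < N) (if (k < J)%N then 0 else c k * x ^+ k).
  rewrite /psum (sum_ord_split (fun k => c k * x ^+ k) JN).
  rewrite (sum_ord_split (fun k => if (k < J)%N then 0 else c k * x ^+ k) JN).
  rewrite [X in _ = X + _]big1 ?add0r => [|k _]; last by rewrite ltn_ord.
  rewrite addrC addKr; apply: eq_bigr => k _.
  by rewrite ltnNge leq_addr.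
apply: le_trans (cabs_sum _ _ _) _.
apply: (@le_trans _ _ (M * (cabs x / s) ^+ J / (1 - cabs x / s))).
  apply: (@geom_tail (fun k => cabs (if (k < J)%N then 0 else c k * x ^+ k))).
  - by rewrite t0; lra.
  - move=> k; rewrite cabs_ge0 /=; case: ifP => _.
      by rewrite cabs0 mulr_ge0// exprn_ge0.
    rewrite cabsM cabsX expr_div_n [X in _ <= _ * X]mulrC mulrA.
    rewrite ler_wpM2r ?exprn_ge0// ler_pdivlMr ?exprn_gt0//.
  - by move=> k ->; rewrite cabs0.
rewrite ler_pdivrMr; last lra.
have P0 : 0 <= M * (cabs x / s) ^+ J by rewrite mulr_ge0// exprn_ge0.
move: P0 t2; move: (cabs x / s) => t; rewrite -mulrA; move: (M * _) => P; nra.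
Qed.

Lemma analytic_atP f a : analytic_at f a <-> exists c s M, expands f a c s M.
Proof.
have seriesE c x : (series (fun k => c k * x ^+ k)) = psum c x.
  by apply/funext => N; rewrite /series /= big_mkord.
split=> [[c /nbhs_cplx[d d0 cf]]|[c [s [M [s0 cM cf]]]]]; last first.
  exists c; apply/nbhs_cplx; exists s => // x xa.
  by have := cf _ xa; rewrite subrKC -seriesE.
pose s := d / 2.
have s0 : 0 < s by rewrite divr_gt0.
have sd : s < d by rewrite /s; lra.
have ds y : cabs y < d -> psum c y @ \oo --> f (a + y).
  by move=> yd; have := cf (a + y); rewrite addrC addKr seriesE; exact.
have : psum c s%:C%C @ \oo --> f (a + s%:C%C) by apply: ds; rewrite cabsR gtr0_norm.
move=> /cvg_cplx/(_ _ ltr01)[N hN].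
exists c, s, (2 + \sum_(k < N) cabs (c k) * s ^+ k); split=> //; last first.
  by move=> x xs; apply: ds; exact: lt_trans sd.
have tk k : cabs (c k) * s ^+ k = cabs (c k * s%:C%C ^+ k).
  by rewrite cabsM cabsX cabsR (gtr0_norm s0).
have g0 k : 0 <= cabs (c k) * s ^+ k by rewrite tk cabs_ge0.
move=> k; have [kN|Nk] := ltnP k N.
  rewrite (bigD1 (Ordinal kN))//=.
  have : 0 <= \sum_(i < N | i != Ordinal kN) cabs (c i) * s ^+ i by rewrite sumr_ge0.
  by have := g0 k; lra.
have h1 := hN _ Nk; have h2 := hN _ (leqW Nk).
rewrite tk.
have -> : c k * s%:C%C ^+ k =
    (psum c s%:C%C k.+1 - f (a + s%:C%C)) - (psum c s%:C%C k - f (a + s%:C%C)).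
  by rewrite /psum big_ord_recr /=; ring.
have := cabsB (psum c s%:C%C k.+1 - f (a + s%:C%C)) (psum c s%:C%C k - f (a + s%:C%C)).
have : 0 <= \sum_(i < N) cabs (c i) * s ^+ i by rewrite sumr_ge0.
lra.
Qed.

(** Near a point where f is analytic, f is analytic with one and the same
    radius and bound. *)
Lemma expands_near f a c (s M : R) : expands f a c s M ->
  forall b, cabs (b - a) < s / 4 -> exists d, expands f b d (s / 2) (4 * M).
Proof.
move=> [s0 cM cf] b ba.
have e0 : expands (fun x => f (a + x)) 0 c s M.
  by split; [exact: s0|exact: cM|move=> x xs; rewrite add0r; exact: cf].
have s20 : 0 < s / 2 by rewrite divr_gt0.
have bas : cabs (b - a) + s / 2 < s by lra.
have [d [_ dM df]] := reexpand e0 s20 bas.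
have M0 : 0 <= M by have := cM 0%N; rewrite expr0 mulr1; apply: le_trans; exact: cabs_ge0.
exists d; split; [exact: s20| |]; last first.
  by move=> x xs; have := df _ xs; rewrite addrA subrKC.
move=> k; apply: le_trans (dM k) _.
rewrite mulrC ler_wpM2r// -[leRHS]invrK lef_pV2 ?posrE ?invr_gt0//; last first.
  by rewrite subr_gt0 ltr_pdivrMr// mul1r.
have : (cabs (b - a) + s / 2) / s <= 3 / 4 by rewrite ler_pdivrMr//; lra.
lra.
Qed.

End PowerSeries.

(** * Affine substitutions and rotations in integrals *)

Section LineSubstitution.
Variable R : realType.
Local Notation leb := (@lebesgue_measure R).
Local Open Scope ereal_scope.

Definition affine (c b : R) (x : measurableTypeR R) : measurableTypeR R := (c * x + b)%R.

Lemma measurable_affine c b : measurable_fun setT (affine c b).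
Proof. by apply: measurable_funD => //; exact: mulrl_measurable. Qed.

Lemma lebesgue_affine (c b : R) (A : set (measurableTypeR R)) : (0 < c)%R -> measurable A ->
  leb A = c%:E * leb (affine c b @^-1` A).
Proof.
move=> c0 mA.
pose cc := NngNum (ltW c0).
have := @lebesgue_measure_unique R (mscale cc (pushforward leb (affine c b))).
move=> /(_ (measurable_affine c b) _ A mA); apply => _ [[x y] _ <-] /=.
rewrite /mscale /pushforward /=.
have E : affine c b @^-1` `]x, y]%classic = `]((x - b) / c)%R, ((y - b) / c)%R]%classic.
  apply/seteqP; split => t; rewrite /affine /= !in_itv /=.
    by rewrite ltr_pdivrMr// ler_pdivlMr// ltrBlDr lerBrDr mulrC.
  by rewrite ltr_pdivrMr// ler_pdivlMr// ltrBlDr lerBrDr mulrC.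
rewrite [pushforward _ _ _](_ : _ = leb (affine c b @^-1` `]x, y]%classic))// E.
rewrite !lebesgue_measure_itv /= !lte_fin ltr_pM2r ?invr_gt0// ltrD2r.
case: ifPn => _; last by rewrite mule0.
by rewrite -!EFinD -EFinM; congr (_%:E); field; lra.
Qed.

Lemma ge0_integral_affine (c b : R) (F : R -> \bar R) : (0 < c)%R ->
  measurable_fun setT F -> (forall x, 0 <= F x) ->
  c%:E * \int[leb]_x F (c * x + b)%R = \int[leb]_x F x.
Proof.
move=> c0 mF F0.
pose cc := NngNum (ltW c0).
pose nu := measure_function_pushforward__canonical__measure_function_Measure
  leb (measurable_affine c b).
transitivity (\int[mscale cc nu]_x F x).
  rewrite ge0_integral_mscale//; congr (_ * _).
  by rewrite (ge0_integral_pushforward (measurable_affine c b)).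
by apply: eq_measure_integral => A mA _; exact/esym/lebesgue_affine.
Qed.

End LineSubstitution.

Section PlaneRotation.
Variable R : realType.
Local Notation C := (cplx R).
Local Notation leb := (@lebesgue_measure R).
Local Notation leb2 := (@lebesgue_measure R \x @lebesgue_measure R)%E.
Implicit Types F : R * R -> \bar R.
Local Open Scope ereal_scope.

Lemma measurable_shear1 (a : R) :
  measurable_fun setT (fun p : R * R => (p.1 + a * p.2, p.2)%R).
Proof.
apply/measurable_fun_pair => //.
by apply: measurable_funD => //; exact: measurable_funM.
Qed.

Lemma measurable_shear2 (a : R) :
  measurable_fun setT (fun p : R * R => (p.1, p.2 + a * p.1)%R).
Proof.
apply/measurable_fun_pair => //.
by apply: measurable_funD => //; exact: measurable_funM.
Qed.

Lemma ge0_integral_shear1 F (a : R) : measurable_fun setT F ->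
  (forall p, 0 <= F p) ->
  \int[leb2]_p F (p.1 + a * p.2, p.2)%R = \int[leb2]_p F p.
Proof.
move=> mF F0.
have mF' := measurableT_comp mF (measurable_shear1 a).
have F0' p : 0 <= (F \o (fun p : R * R => (p.1 + a * p.2, p.2)%R)) p by exact: F0.
apply: etrans (fubini_tonelli2 (m1 := leb) (m2 := leb) _ mF' F0') _.
apply/esym; apply: etrans (fubini_tonelli2 (m1 := leb) (m2 := leb) _ mF F0) _; apply/esym.
apply: eq_integral => y _; rewrite /fubini_G /=.
rewrite -(@ge0_integral_affine _ 1 (a * y) (fun x => F (x, y)))//.
  by rewrite mul1e; apply: eq_integral => x _; rewrite mul1r.
exact: (measurableT_comp mF (measurable_pair2 y)).
Qed.

Lemma ge0_integral_shear2 F (a : R) : measurable_fun setT F ->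
  (forall p, 0 <= F p) ->
  \int[leb2]_p F (p.1, p.2 + a * p.1)%R = \int[leb2]_p F p.
Proof.
move=> mF F0.
have mF' := measurableT_comp mF (measurable_shear2 a).
have F0' p : 0 <= (F \o (fun p : R * R => (p.1, p.2 + a * p.1)%R)) p by exact: F0.
apply: etrans (fubini_tonelli1 (m1 := leb) (m2 := leb) _ mF' F0') _.
apply/esym; apply: etrans (fubini_tonelli1 (m1 := leb) (m2 := leb) _ mF F0) _; apply/esym.
apply: eq_integral => x _; rewrite /fubini_F /=.
rewrite -(@ge0_integral_affine _ 1 (a * x) (fun y => F (x, y)))//.
  by rewrite mul1e; apply: eq_integral => y _; rewrite mul1r.
exact: (measurableT_comp mF (measurable_pair1 x)).
Qed.

(** A rotation other than the half turn is a product of three shears, and a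
    shear preserves area by Tonelli's theorem. *)
Lemma ge0_integral_rotation_neq F (c s : R) : (c ^+ 2 + s ^+ 2 = 1)%R ->
  (c != -1)%R -> measurable_fun setT F -> (forall p, 0 <= F p) ->
  \int[leb2]_p F (c * p.1 - s * p.2, s * p.1 + c * p.2)%R = \int[leb2]_p F p.
Proof.
move=> cs c1 mF F0.
have c10 : (1 + c != 0)%R by rewrite addrC -subr_eq0 opprK in c1 *.
pose t := (- (s / (1 + c)))%R.
pose S1 (p : R * R) := (p.1 + t * p.2, p.2)%R.
pose S2 (p : R * R) := (p.1, p.2 + s * p.1)%R.
have ht : (t * (1 + c) = - s)%R by rewrite /t; field.
have hs : (s * t = c - 1)%R.
  by apply: (mulIf c10); rewrite -mulrA ht; move: cs; rewrite !expr2 => cs; lra.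
transitivity (\int[leb2]_p (F \o S1 \o S2) (S1 p)).
  apply: eq_integral => -[x y] _; rewrite /S2 /S1 /=; congr (F (_, _)).
  - transitivity ((1 + s * t) * x + (t * (1 + c)) * y + t * (s * t - (c - 1)) * y)%R.
      by rewrite ht hs; ring.
    by ring.
  - transitivity (s * x + (1 + s * t) * y)%R; last by ring.
    by rewrite hs; ring.
have m1 := measurableT_comp mF (measurable_shear1 t).
have m2 := measurableT_comp m1 (measurable_shear2 s).
have F1 p : 0 <= (F \o S1) p by exact: F0.
have F2 p : 0 <= (F \o S1 \o S2) p by exact: F0.
rewrite (ge0_integral_shear1 (F := F \o S1 \o S2))//.
rewrite (ge0_integral_shear2 (F := F \o S1))//.
by rewrite (ge0_integral_shear1 (F := F)).
Qed.

Lemma ge0_integral_rotation F (c s : R) : (c ^+ 2 + s ^+ 2 = 1)%R ->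
  measurable_fun setT F -> (forall p, 0 <= F p) ->
  \int[leb2]_p F (c * p.1 - s * p.2, s * p.1 + c * p.2)%R = \int[leb2]_p F p.
Proof.
move=> cs mF F0.
have [c1|] := eqVneq c (-1)%R; last by move=> c1; exact: ge0_integral_rotation_neq.
have s0 : s = 0%R.
  by apply/eqP; rewrite -sqrf_eq0; move: cs; rewrite c1 sqrrN expr1n => cs; apply/eqP; lra.
(* The half turn is a quarter turn made twice. *)
have q01 : ((0 : R) ^+ 2 + 1 ^+ 2 = 1)%R by rewrite expr0n expr1n add0r.
have q1 : (0 != -1 :> R)%R by rewrite eq_sym oppr_eq0 oner_neq0.
pose Q (p : R * R) := (0 * p.1 - 1 * p.2, 1 * p.1 + 0 * p.2)%R.
have mQ : measurable_fun setT Q.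
  apply/measurable_fun_pair.
    by apply: measurable_funB; exact: measurable_funM.
  by apply: measurable_funD; exact: measurable_funM.
transitivity (\int[leb2]_p (F \o Q) (Q p)).
  apply: eq_integral => -[x y] _; rewrite /Q /= c1 s0; congr (F (_, _)); ring.
have F1 p : 0 <= (F \o Q) p by exact: F0.
rewrite (ge0_integral_rotation_neq (F := F \o Q) q01 q1)//.
  by rewrite (ge0_integral_rotation_neq (F := F) q01 q1).
exact: measurableT_comp mF mQ.
Qed.

End PlaneRotation.

(** * Polar coordinates *)

Section Polar.
Variable R : realType.
Local Notation C := (cplx R).
Local Notation leb := (@lebesgue_measure R).
Local Notation leb2 := (@lebesgue_measure R \x @lebesgue_measure R)%E.
Implicit Types phi : R -> \bar R.
Local Open Scope ereal_scope.

(** The density of a radial integral with respect to the radius. *)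
Definition cutoff phi (s : R) : \bar R := if (0 < s)%R then phi s * s%:E else 0.

(** The density of the angle in terms of the slope [t = y / x]. *)
Definition angular (t : R) : R := (1 + t ^+ 2)^-1.

Lemma angular_gt0 t : (0 < angular t)%R.
Proof. by rewrite /angular invr_gt0 ltr_wpDr// sqr_ge0. Qed.

Lemma measurable_angular : measurable_fun setT angular.
Proof.
apply: continuous_measurable_fun => t.
apply: cvgV; first by rewrite lt0r_neq0// ltr_wpDr// sqr_ge0.
by apply: cvgD; [exact: cvg_cst|exact: exprn_continuous].
Qed.

Lemma measurable_sqrt : measurable_fun setT (@Num.sqrt R).
Proof. by apply: continuous_measurable_fun; exact: sqrt_continuous. Qed.

Lemma measurable_gt0_if d (T : measurableType d) (f : T -> R) (g : T -> \bar R) :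
  measurable_fun setT f -> measurable_fun setT g ->
  measurable_fun setT (fun x => if (0 < f x)%R then g x else 0).
Proof.
move=> mf mg; apply: measurable_fun_ifT => //.
exact: measurable_fun_ltr.
Qed.

Lemma measurable_cutoff phi : measurable_fun setT phi -> measurable_fun setT (cutoff phi).
Proof.
move=> mp; apply: measurable_gt0_if => //.
by apply: emeasurable_funM => //; exact/measurable_EFinP.
Qed.

Lemma cutoff_ge0 phi s : (forall s, 0 <= phi s) -> 0 <= cutoff phi s.
Proof.
move=> p0; rewrite /cutoff; case: ifPn => // s0.
by rewrite mule_ge0// lee_fin ltW.
Qed.

Lemma measurable_hypot : measurable_fun setT
  (fun p : R * R => Num.sqrt (p.1 ^+ 2 + p.2 ^+ 2)).
Proof.
apply: (measurableT_comp measurable_sqrt).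
by apply: measurable_funD; exact: measurable_funX.
Qed.

(** The substitution y = x t and then x = s / sqrt (1 + t^2) turns an integral
    over the half plane x > 0 into a product, so polar coordinates need only
    dilations of the line and Tonelli's theorem. *)
Lemma ge0_integral_radial phi : measurable_fun setT phi -> (forall s, 0 <= phi s) ->
  \int[leb2]_p phi (Num.sqrt (p.1 ^+ 2 + p.2 ^+ 2)) =
  2%:E * (\int[leb]_t (angular t)%:E * \int[leb]_s cutoff phi s).
Proof.
move=> mphi phi0.
pose F (p : R * R) := phi (Num.sqrt (p.1 ^+ 2 + p.2 ^+ 2)).
have mF : measurable_fun setT F by exact: measurableT_comp mphi measurable_hypot.
have F0 p : 0 <= F p by exact: phi0.
apply: etrans (fubini_tonelli1 (m1 := leb) (m2 := leb) F mF F0) _.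
set G := fubini_F leb F.
have mG : measurable_fun setT G by exact: measurable_fun_fubini_tonelli_F.
have G0 x : 0 <= G x by apply: integral_ge0.
have -> : \int[leb]_x G x = 2%:E * \int[leb]_(x in `]0%R, +oo[) G x.
  have -> : [set: R] = `]-oo, 0%R]%classic `|` `]0%R, +oo[%classic.
    apply/seteqP; split => // x _; rewrite /= !in_itv/= andbT.
    by case: (leP x 0%R) => h; [left|right].
  rewrite ge0_integral_setU//=; last 2 first.
    exact: measurable_funTS.
    apply/disj_setPS => x [] /=; rewrite !in_itv/= andbT => x0 x1.
    by have := lt_le_trans x1 x0; rewrite ltxx.
  have -> : \int[leb]_(x in `]-oo, 0%R]) G x = \int[leb]_(x in `]-oo, 0%R]) G (- x)%R.
    apply: eq_integral => x _; rewrite /G /fubini_F /=.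
    by apply: eq_integral => y _; rewrite /F /= sqrrN.
  rewrite -ge0_integration_by_substitution0// -integral_itv_obnd_cbnd; last exact: measurable_funTS.
  by rewrite -[in LHS](mul1e (\int[_]_(_ in _) _)) -ge0_muleDl// -EFinD.
congr (_ * _).
pose H (p : R * R) := if (0 < p.1)%R then F (p.1, p.1 * p.2)%R * p.1%:E else 0.
have mH : measurable_fun setT H.
  apply: measurable_gt0_if => //; apply: emeasurable_funM; last exact/measurable_EFinP.
  apply: (measurableT_comp mF); apply/measurable_fun_pair => //.
  exact: measurable_funM.
have H0 p : 0 <= H p.
  by rewrite /H; case: ifPn => // p0; rewrite mule_ge0// lee_fin ltW.
transitivity (\int[leb]_x \int[leb]_t H (x, t)).
  rewrite integral_mkcond; apply: eq_integral => x _.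
  rewrite patchE; case: ifPn => [|].
    rewrite inE /= in_itv /= andbT => x0.
    rewrite /G /fubini_F -(@ge0_integral_affine _ x 0 (fun y => F (x, y)))//; last first.
      exact: (measurableT_comp mF (measurable_pair1 x)).
    rewrite -ge0_integralZl//; last 2 first.
      apply: (measurableT_comp mF); apply/measurable_fun_pair => //.
      by apply: measurable_funD => //; exact: measurable_funM.
      by rewrite lee_fin ltW.
    by apply: eq_integral => t _; rewrite /H /= x0 addr0 muleC.
  rewrite notin_setE /= in_itv /= andbT => /negP/negbTE x0.
  by rewrite integral0_eq// => t _; rewrite /H /= x0.
apply: etrans (fubini_tonelli (m1 := leb) (m2 := leb) H mH H0) _.
have mP := measurable_cutoff mphi.
have P0 s : 0 <= cutoff phi s by exact: cutoff_ge0.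
rewrite -ge0_integralZr//; last 3 first.
- by apply/measurable_EFinP; exact: measurable_angular.
- by move=> t _; rewrite lee_fin ltW// angular_gt0.
- by apply: integral_ge0.
apply: eq_integral => t _.
set c := Num.sqrt (1 + t ^+ 2).
have t1 : (0 < 1 + t ^+ 2)%R by rewrite ltr_wpDr// sqr_ge0.
have c0 : (0 < c)%R by rewrite sqrtr_gt0.
have ic0 : (0 <= c^-1)%R by rewrite invr_ge0 ltW.
transitivity (\int[leb]_x ((c^-1)%:E * cutoff phi (c * x + 0)%R)).
  apply: eq_integral => x _; rewrite /H /cutoff /= addr0 pmulr_rgt0//.
  case: ifPn => x0; last by rewrite mule0.
  rewrite /F /= muleCA -EFinM mulKf ?lt0r_neq0//; congr (phi _ * _).
  rewrite exprMn -{1}[(x ^+ 2)%R]mulr1 -mulrDr sqrtrM ?sqr_ge0//.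
  by rewrite sqrtr_sqr gtr0_norm// mulrC.
rewrite ge0_integralZl//; last first.
  apply: (measurableT_comp mP); apply: measurable_funD => //.
have := @ge0_integral_affine _ c 0 _ c0 mP P0 => <-.
rewrite muleA -EFinM /angular.
have <- : (c ^+ 2 = 1 + t ^+ 2)%R by rewrite sqr_sqrtr// ltW.
by congr (_%:E * _); field; rewrite lt0r_neq0.
Qed.

Lemma ge0_le_integralT d (T : measurableType d) (mu : {measure set T -> \bar R})
  (f g : T -> \bar R) : measurable_fun setT f -> measurable_fun setT g ->
  (forall x, 0 <= f x) -> (forall x, f x <= g x) ->
  \int[mu]_x f x <= \int[mu]_x g x.
Proof. by move=> mf mg f0 fg; apply: ge0_le_integral. Qed.

(** The total angle is finite because the unit disc lies in a square. *)
Lemma polar_coordinates : exists2 k : R, (0 < k)%R &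
  forall phi, measurable_fun setT phi -> (forall s, 0 <= phi s) ->
  \int[leb2]_p phi (Num.sqrt (p.1 ^+ 2 + p.2 ^+ 2)) =
  k%:E * \int[leb]_s cutoff phi s.
Proof.
set K := \int[leb]_t (angular t)%:E.
have K0 : 2^-1%:E <= K.
  apply: (@le_trans _ _ (\int[leb]_t (2^-1%:E * (\1_`[0%R, 1%R] t)%:E))).
    rewrite ge0_integralZl//; last by apply/measurable_EFinP; exact: measurable_indic.
    rewrite integral_indic//= setIT lebesgue_measure_itv /= lte_fin ltr01.
    by rewrite -EFinD subr0 mule1.
  apply: ge0_le_integralT.
  - by apply/measurable_EFinP; apply: measurable_funM => //; exact: measurable_indic.
  - by apply/measurable_EFinP; exact: measurable_angular.
  - by move=> t; rewrite -EFinM lee_fin mulr_ge0.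
  - move=> t; rewrite -EFinM lee_fin indicE.
    case: (boolP (t \in _)) => [|_]; last by rewrite mulr0 ltW// angular_gt0.
    rewrite inE /= in_itv /= => /andP[t0 t1].
    rewrite mulr1 lef_pV2 ?posrE ?ltr_wpDr ?sqr_ge0//.
    by rewrite -[2%R]/(1 + 1)%R lerD2l exprn_ile1.
pose phi (s : R) : \bar R := (\1_`]0%R, 1%R[ s)%:E.
have mphi : measurable_fun setT phi by apply/measurable_EFinP; exact: measurable_indic.
have phi0 s : 0 <= phi s by rewrite lee_fin.
have I0 : 8^-1%:E <= \int[leb]_s cutoff phi s.
  apply: (@le_trans _ _ (\int[leb]_t (2^-1%:E * (\1_`[2^-1%R, (3/4)%R] t)%:E))).
    rewrite ge0_integralZl//; last by apply/measurable_EFinP; exact: measurable_indic.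
    rewrite integral_indic//= setIT lebesgue_measure_itv /= lte_fin.
    rewrite ifT; last lra.
    by rewrite -EFinD -EFinM lee_fin; lra.
  apply: ge0_le_integralT.
  - by apply/measurable_EFinP; apply: measurable_funM => //; exact: measurable_indic.
  - exact: measurable_cutoff.
  - by move=> t; rewrite -EFinM lee_fin mulr_ge0.
  - move=> t; rewrite -EFinM indicE.
    case: (boolP (t \in _)) => [|_]; last by rewrite mulr0 cutoff_ge0.
    rewrite inE /= in_itv /= => /andP[t0 t1].
    have t00 : (0 < t)%R by lra.
    rewrite /cutoff t00 /phi indicE mem_set /= ?in_itv /= ?t00 /=; last lra.
    by rewrite -EFinM lee_fin; lra.
have L4 : \int[leb2]_p phi (Num.sqrt (p.1 ^+ 2 + p.2 ^+ 2)) <= 4%:E.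
  pose Q : set R := `[(-1)%R, 1%R]%classic.
  have mQ : measurable (Q `*` Q) by apply: measurableX; exact: measurable_itv.
  apply: (@le_trans _ _ (\int[leb2]_p (\1_(Q `*` Q) p)%:E)).
    apply: ge0_le_integralT => //.
    - exact: measurableT_comp mphi measurable_hypot.
    - by apply/measurable_EFinP; exact: measurable_indic.
    - move=> [x y]; rewrite /phi /= lee_fin !indicE.
      case: (boolP (Num.sqrt _ \in _)) => [|_]; last by rewrite ler0n.
      rewrite inE /= in_itv /= => /andP[_ h].
      have h2 : (x ^+ 2 + y ^+ 2 < 1)%R.
        by rewrite -ltr_sqrt ?sqrtr1// ltr01.
      have hx : (x ^+ 2 <= 1)%R by have := sqr_ge0 y; lra.
      have hy : (y ^+ 2 <= 1)%R by have := sqr_ge0 x; lra.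
      rewrite mem_set ?ler0n//; split => /=; rewrite /Q /= in_itv /=.
        by rewrite -ler_norml -(@expr_le1 _ 2)// real_normK ?num_real.
      by rewrite -ler_norml -(@expr_le1 _ 2)// real_normK ?num_real.
  rewrite integral_indic//=.
  have E : leb2 (Q `*` Q) = leb Q * leb Q.
    by apply: product_measure1E; exact: measurable_itv.
  rewrite setIT E.
  rewrite /Q lebesgue_measure_itv /= lte_fin ifT; last lra.
  by rewrite -EFinD -EFinM lee_fin; lra.
have Kfin : K \is a fin_num.
  rewrite ge0_fin_numE; last exact: le_trans K0.
  rewrite ltey; apply/eqP => Ky.
  move: L4; rewrite ge0_integral_radial// -/K Ky gt0_mulye; last first.
    by apply: lt_le_trans I0; rewrite lte_fin.
  by rewrite gt0_muley ?lte_fin.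
exists (2 * fine K)%R.
  by rewrite mulr_gt0// -lte_fin fineK//; apply: lt_le_trans K0; rewrite lte_fin.
by move=> f mf f0; rewrite ge0_integral_radial// -/K EFinM fineK// muleA.
Qed.

End Polar.

(** * Measurability in the plane *)

Section PlaneMeasurability.
Variable R : realType.
Local Notation C := (cplx R).
Implicit Types (U : set C) (f : C -> R).

(** Open sets and continuity are expressed by real radii and [cabs]: the norm of the
    complex plane takes complex values, which no integral or real inequality can use. *)
Definition open_plane U := forall a, U a ->
  exists2 d : R, 0 < d & forall x, cabs (x - a) < d -> U x.

Definition cont_plane U f := forall a, U a -> forall e : R, 0 < e ->
  exists2 d : R, 0 < d & forall x, cabs (x - a) < d -> `|f x - f a| < e.

Lemma measurable_open_plane U : open_plane U ->
  measurable (@of_xy R @^-1` U : set (R * R)).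
Proof.
move=> oU.
pose B (i : rat * rat * rat) : set (R * R) :=
  ball (ratr i.1.1 : R) (ratr i.2) `*` ball (ratr i.1.2 : R) (ratr i.2).
pose F i := if `[< B i `<=` @of_xy R @^-1` U >] then B i else set0.
have -> : @of_xy R @^-1` U = \bigcup_i F i.
  apply/seteqP; split => [[x y] /= /oU[d d0 hd]|p [i _]]; last first.
    by rewrite /F; case: asboolP => // h /h.
  have [e] : exists e : rat, ratr e \in `]0, (d / 4)[.
    by apply: rat_in_itvoo; rewrite divr_gt0.
  rewrite in_itv /= => /andP[e0 e4].
  have [p] : exists p : rat, ratr p \in `](x - ratr e), (x + ratr e)[.
    by apply: rat_in_itvoo; lra.
  rewrite in_itv /= => /andP[p1 p2].
  have [r] : exists r : rat, ratr r \in `](y - ratr e), (y + ratr e)[.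
    by apply: rat_in_itvoo; lra.
  rewrite in_itv /= => /andP[r1 r2].
  have hB : B (p, r, e) `<=` @of_xy R @^-1` U.
    move=> [u v] []; rewrite /= !ball_itv /= !in_itv /= => /andP[u1 u2] /andP[v1 v2].
    apply: hd; apply: le_lt_trans (cabs_le_ReIm _) _.
    have -> : d = d / 2 + d / 2 by lra.
    by rewrite /of_xy /=; apply: ltrD; rewrite ltr_norml; lra.
  exists (p, r, e) => //; rewrite /F asboolT//; split; rewrite /= ball_itv /= in_itv /=; lra.
apply: countable_bigcupT_measurable; first exact: countableP.
move=> i; rewrite /F; case: asboolP => // _.
by apply: measurableX; exact: measurable_ball.
Qed.

Lemma measurable_cont_plane U f : open_plane U -> cont_plane U f ->
  measurable_fun (@of_xy R @^-1` U : set (R * R)) (fun p => f (of_xy p)).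
Proof.
move=> oU cf _.
apply: (measurability _ (RGenOInfty.measurableE R)); last exact: measurable_open_plane.
move=> /= _ [_ [a ->] <-]; rewrite preimage_itvoy.
have -> : of_xy (R:=R) @^-1` U `&` [set x | a < f (of_xy x)] =
   of_xy (R:=R) @^-1` (U `&` [set x | a < f x]) by [].
apply: measurable_open_plane => x [/= Ux ax].
have [d d0 hd] := oU _ Ux.
have [e e0 he] := cf _ Ux (f x - a) ltac:(lra).
exists (Num.min d e); first by rewrite lt_min d0.
move=> y; rewrite lt_min => /andP[/hd ? /he /=].
by split=> //=; move: (ler_norm (- (f y - f x))); rewrite normrN; lra.
Qed.

Lemma open_disc : open_plane (@disc R).
Proof.
move=> a /= a1; exists (1 - cabs a); first by rewrite subr_gt0.
by move=> x /= xa; have := cabsD (x - a) a; rewrite subrK /disc /=; lra.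
Qed.

Lemma measurable_disc :
  measurable (@of_xy R @^-1` (@disc R) : set (measurableTypeR R * measurableTypeR R)).
Proof. by apply: measurable_open_plane; exact: open_disc. Qed.

Lemma cabs_of_xy (p : R * R) : cabs (of_xy p) = Num.sqrt (p.1 ^+ 2 + p.2 ^+ 2).
Proof. by []. Qed.

Lemma measurable_cabs : measurable_fun setT (fun p : R * R => cabs (of_xy p)).
Proof. exact: measurable_hypot. Qed.

Definition annulus (r s : R) : set (measurableTypeR R * measurableTypeR R) :=
  [set p : R * R | r <= cabs (of_xy p) < s].

Lemma measurable_annulus r s : measurable (annulus r s).
Proof.
have -> : annulus r s = (fun p : R * R => cabs (of_xy p)) @^-1` `[r, s[%classic.
  by apply/seteqP; split => p; rewrite /annulus /= in_itv.
by rewrite -[X in measurable X]setTI; exact: measurable_cabs.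
Qed.

End PlaneMeasurability.

Section ShrinkingSets.
Local Open Scope ereal_scope.
Context d (T : measurableType d) (R : realType).
Variables (mu : {measure set T -> \bar R}).

Lemma integral_shrink (D : set T) (E : nat -> set T) (f : T -> \bar R) :
  measurable D -> mu.-integrable D f -> (forall x, D x -> 0 <= f x < +oo) ->
  (forall n, measurable (E n)) -> (forall n, E n `<=` D) ->
  (forall x, D x -> exists N, forall n, (N <= n)%N -> ~ E n x) ->
  (fun n => \int[mu]_(x in E n) f x) @ \oo --> 0.
Proof.
move=> mD fi f0 mE ED Eout.
have mf := measurable_int _ fi.
have -> : (fun n => \int[mu]_(x in E n) f x) =
    (fun n => \int[mu]_(x in D) (f \_ (E n)) x).
  apply/funext => n; rewrite -integral_mkcondr.
  by congr (integral _ _ _); rewrite setIC; apply/esym/setIidl.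
have [ |//| |//| | ] := @dominated_convergence _ _ _ mu D mD (fun n => f \_ (E n)) (cst 0) f.
- move=> n; apply/(measurable_restrict f (mE n) mD).
  exact: measurable_funS mf.
- apply: aeW => x Dx; apply: cvg_near_cst; have [N hN] := Eout _ Dx.
  by exists N => // n /hN Enx; rewrite patchE memNset.
- apply: aeW => x n Dx; have /andP[h _] := f0 _ Dx.
  rewrite patchE; case: ifPn => _; first by rewrite gee0_abs.
  by rewrite abse0.
by move=> _ _; rewrite integral0_eq//; exact.
Qed.

End ShrinkingSets.

(** * Tails of radial weights *)

Section WeightTail.
Variable R : realType.
Local Notation C := (cplx R).
Local Notation leb := (@lebesgue_measure R).
Local Notation leb2 := (@lebesgue_measure R \x @lebesgue_measure R)%E.
Variable w : C -> R.
Hypothesis hw : continuous_radial_weight w.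

Lemma weight_gt0 a : disc a -> 0 < w a.
Proof. by case: hw => -[+ _] _ _; exact. Qed.

Lemma weight_cont : cont_plane (@disc R) w.
Proof.
case: hw => _ _ cw a Da e e0.
have od : open (@disc R).
  rewrite openE => x /= /open_disc[d d0 hd]; apply/nbhs_cplx; exists d => //.
move: cw; rewrite (continuous_open_subspace w od) => /(_ a).
rewrite inE => /(_ Da) /cvgrPdist_lt /(_ _ e0) /nbhs_cplx[d d0 hd].
by exists d => // x /hd; rewrite distrC.
Qed.

Lemma disc_real (s : R) : disc (s%:C%C : C) <-> -1 < s < 1.
Proof. by rewrite /disc /mkset cabsR ltr_norml. Qed.

Lemma measurable_profile : measurable_fun (`]-1, 1[%classic : set R) (fun s : R => w s%:C%C).
Proof.
apply: open_continuous_measurable_fun; first exact: interval_open.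
move=> s; rewrite inE /= in_itv /= => /disc_real Ds.
apply/cvgrPdist_lt => e e0; have [d d0 hd] := weight_cont Ds e0.
exists d => // t /= st; rewrite distrC; apply: hd.
have -> : t%:C%C - s%:C%C = (t - s)%:C%C :> C by rewrite raddfB.
by rewrite cabsR distrC.
Qed.

Lemma measurable_profileS (D : set R) : measurable D -> D `<=` `]-1, 1[%classic ->
  measurable_fun D (fun s : R => w s%:C%C).
Proof. by move=> mD sD; exact: measurable_funS measurable_profile. Qed.

Lemma sub_itv01 r t : 0 <= r -> t <= 1 -> `[r, t[%classic `<=` (`]-1, 1[%classic : set R).
Proof. by move=> r0 t1 s; rewrite /= !in_itv /=; lra. Qed.

Lemma measurable_weight_annulus r t : t <= 1 ->
  measurable_fun (annulus r t) (fun p : R * R => w (of_xy p)).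
Proof.
move=> t1; apply: measurable_funS (measurable_cont_plane (@open_disc R) weight_cont).
- exact: measurable_disc.
- by move=> p /= /andP[_ /lt_le_trans]; apply.
Qed.

Local Open Scope ereal_scope.

Definition mass (r t : R) : \bar R :=
  \int[leb2]_(p in annulus r t) (w (of_xy p))%:E.

Definition tail_int (r t : R) : \bar R := \int[leb]_(s in `[r, t[) (w s%:C%C)%:E.

Lemma annulus_mass : exists2 k : R, (0 < k)%R &
  forall r t, (0 <= r)%R -> (t <= 1)%R ->
    mass r t = k%:E * \int[leb]_(s in `[r, t[) (w s%:C%C * s)%:E.
Proof.
have [k k0 polar] := polar_coordinates R; exists k => // r t r0 t1.
pose phi := (fun s : R => (w s%:C%C)%:E) \_ (`[r, t[%classic).
have mphi : measurable_fun setT phi.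
  apply/(measurable_restrictT _ (measurable_itv _))/measurable_EFinP.
  by apply: measurable_profileS => //; exact: sub_itv01.
have wpos s : s \in `[r, t[ -> (0 < w s%:C%C)%R.
  by move=> /(sub_itv01 r0 t1); rewrite /= in_itv /= => /disc_real/weight_gt0.
have phi0 s : 0 <= phi s.
  rewrite /phi patchE; case: ifPn => //; rewrite inE => /wpos /ltW.
  by rewrite lee_fin.
rewrite /mass integral_mkcond.
transitivity (\int[leb2]_p phi (Num.sqrt (p.1 ^+ 2 + p.2 ^+ 2))).
  apply: eq_integral => p _; rewrite /phi !patchE -cabs_of_xy.
  have -> : (p \in annulus r t) = (cabs (of_xy p) \in (`[r, t[%classic : set R)).
    by apply/idP/idP; rewrite !inE /annulus /= in_itv.
  case: ifPn => //; rewrite inE /= in_itv /= => /andP[_ pt].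
  by have [_ rw _] := hw; rewrite rw//; exact: lt_le_trans t1.
rewrite polar//; congr (_ * _); rewrite [RHS]integral_mkcond.
apply: eq_integral => s _; rewrite /cutoff /phi !patchE.
case: (ltP 0%R s) => s0; first by case: ifPn => _ //; exact: mul0e.
case: ifPn => //; rewrite inE /= in_itv /= => /andP[rs _].
have -> : s = 0%R by apply/eqP; rewrite eq_le s0 (le_trans r0 rs).
by rewrite mulr0.
Qed.

(** The area element carries the factor [s], which lies between [r] and 1. *)
Lemma mass_bounds : exists2 k : R, (0 < k)%R &
  forall r t, (0 <= r)%R -> (t <= 1)%R ->
    (k * r)%:E * tail_int r t <= mass r t <= k%:E * tail_int r t.
Proof.
have [k k0 hk] := annulus_mass; exists k => // r t r0 t1; rewrite hk//.
have wpos s : s \in `[r, t[ -> (0 < w s%:C%C)%R.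
  by move=> /(sub_itv01 r0 t1); rewrite /= in_itv /= => /disc_real/weight_gt0.
have mw := measurable_profileS (measurable_itv `[r, t[) (sub_itv01 r0 t1).
have mws : measurable_fun `[r, t[ (fun s : R => w s%:C%C * s)%R.
  by apply: measurable_funM.
rewrite EFinM -muleA !lee_pmul2l ?lte_fin//; apply/andP; split.
  rewrite -ge0_integralZl//; last 2 first.
  - exact/measurable_EFinP.
  - by move=> s /wpos/ltW; rewrite lee_fin.
  - apply: ge0_le_integral => //.
    + by move=> s /wpos/ltW ws; rewrite -EFinM lee_fin mulr_ge0.
    + by apply/measurable_EFinP; apply: measurable_funM.
    + exact/measurable_EFinP.
    + move=> s /= sr; have := wpos _ sr; move: sr; rewrite in_itv /= => /andP[rs _] ws.
      by rewrite -EFinM lee_fin mulrC ler_wpM2l// ltW.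
apply: ge0_le_integral => //.
- move=> s /= sr; have := wpos _ sr; move: sr; rewrite in_itv /= => /andP[rs _] ws.
  by rewrite lee_fin mulr_ge0 ?(ltW ws)// (le_trans r0 rs).
- exact/measurable_EFinP.
- exact/measurable_EFinP.
- move=> s /= sr; have := wpos _ sr; move: sr; rewrite in_itv /= => /andP[rs st] ws.
  by rewrite lee_fin ger_pMr//; apply: ltW; exact: lt_le_trans t1.
Qed.

Lemma mass_fin r t : (t <= 1)%R -> mass r t < +oo.
Proof.
move=> t1; have [[_ /integrableP[mw wi]] _ _] := hw.
apply: le_lt_trans wi.
under [leRHS]eq_integral => p /[!inE] /weight_gt0/ltW wp do rewrite gee0_abs ?lee_fin//.
apply: ge0_subset_integral => //.
- exact: measurable_annulus.
- exact: measurable_disc.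
- by move=> p /weight_gt0/ltW; rewrite lee_fin.
- by move=> p /= /andP[_ /lt_le_trans]; apply.
Qed.

(** Away from the origin the area element is comparable to the product of the radius
    and the angle, so the integral along a radius is finite as the planar one is. *)
Lemma profile_integrable r t : (0 < r)%R -> (t <= 1)%R ->
  leb.-integrable `[r, t[ (fun s : R => (w s%:C%C)%:E).
Proof.
move=> r0 t1; have [k k0 hk] := mass_bounds.
have mw := measurable_profileS (measurable_itv `[r, t[) (sub_itv01 (ltW r0) t1).
apply/integrableP; split; first exact/measurable_EFinP.
have -> : \int[leb]_(x in `[r, t[) `|(w x%:C%C)%:E| = tail_int r t.
  apply: eq_integral => s; rewrite inE => /(sub_itv01 (ltW r0) t1).
  move=> h; rewrite gee0_abs// lee_fin ltW// weight_gt0//.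
  by apply/disc_real; move: h; rewrite /= in_itv.
have /andP[h _] := hk _ _ (ltW r0) t1.
have kr : (0 < k * r)%R by rewrite mulr_gt0.
rewrite -(@lte_pmul2l _ (k * r)%:E)//.
by rewrite gt0_muley ?lte_fin//; apply: le_lt_trans h (mass_fin _ t1).
Qed.

Local Close Scope ereal_scope.

Lemma tail_intE r t : 0 < r -> t <= 1 -> (fine (tail_int r t))%:E = tail_int r t.
Proof.
move=> r0 t1; rewrite fineK//.
exact: (integrable_fin_num _ (profile_integrable r0 t1)).
Qed.

Lemma profile_gt0 r t (s : R) : 0 <= r -> t <= 1 -> s \in `[r, t[ -> 0 < w s%:C%C.
Proof.
by move=> r0 t1 /(sub_itv01 r0 t1); rewrite /= in_itv /= => /disc_real/weight_gt0.
Qed.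

Lemma tail_int_ge0 r t : 0 <= r -> t <= 1 -> (0 <= tail_int r t)%E.
Proof.
move=> r0 t1; apply: integral_ge0 => s /(profile_gt0 r0 t1)/ltW.
by rewrite lee_fin.
Qed.

Lemma tail_ge0 r : 0 < r -> 0 <= tail w r.
Proof. by move=> r0; apply: fine_ge0; exact/tail_int_ge0/lexx/ltW. Qed.

Lemma tail_split r t : 0 < r -> r <= t -> t < 1 ->
  tail w r = fine (tail_int r t) + tail w t.
Proof.
move=> r0 rt t1.
apply: EFin_inj; rewrite EFinD (tail_intE r0 (ltW t1)).
rewrite /tail !(tail_intE _ (lexx 1)) ?(lt_le_trans r0)// /tail_int.
rewrite -ge0_integral_setU//=.
- congr (integral _ _ _); apply/seteqP; split => s; rewrite /= !in_itv /=.
    by case: (ltP s t) => st; [left|right]; lra.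
  by case; lra.
- apply/measurable_EFinP; apply: measurable_profileS; first exact: measurableU.
  by move=> s [] /=; rewrite !in_itv /=; lra.
- by move=> s [] /=; rewrite !in_itv /= => h; rewrite lee_fin ltW// weight_gt0//;
    apply/disc_real; lra.
- by apply/disj_setPS => s [] /=; rewrite !in_itv /=; lra.
Qed.

Lemma tail_mono r t : 0 < r -> r <= t -> t < 1 -> tail w t <= tail w r.
Proof.
move=> r0 rt t1; rewrite (tail_split r0 rt t1) lerDr.
exact/fine_ge0/tail_int_ge0/ltW/t1/ltW.
Qed.

Lemma tail_cvg0 (e : R) : 0 < e -> exists2 r, 1 / 2 <= r < 1 &
  forall t, r <= t -> t < 1 -> tail w t < e.
Proof.
move=> e0.
have h2 : (0 : R) < 1 / 2 by lra.
pose rn (n : nat) : R := 1 - (n.+2%:R)^-1.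
have rn1 n : rn n < 1 by rewrite /rn ltrBlDr ltrDl invr_gt0.
have rn2 n : 1 / 2 <= rn n.
  have : n.+2%:R^-1 <= 2^-1 :> R by rewrite lef_pV2 ?posrE// ler_nat.
  by rewrite /rn; move: (n.+2%:R^-1 : R) => u; lra.
have : (fun n => tail_int (rn n) 1) @ \oo --> 0%E.
  apply: (@integral_shrink _ _ _ leb (`[1 / 2, 1[%classic : set R)
    (fun n => `[rn n, 1[%classic) (fun s => (w s%:C%C)%:E)) => //.
  - exact: profile_integrable.
  - by move=> s /(profile_gt0 (ltW h2) (lexx 1)) ws; rewrite lee_fin ltW// ltry.
  - by move=> n s; rewrite /= !in_itv /= => /andP[h ->]; rewrite (le_trans _ h).
  - move=> s; rewrite /= in_itv /= => /andP[_ s1].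
    have [N hN] : exists N : nat, (1 - s)^-1 < N%:R.
      by exists (Num.bound (1 - s)^-1); rewrite (le_lt_trans _ (archi_boundP _))// invr_ge0; lra.
    exists N => n Nn; rewrite /= in_itv /= => /andP[+ _]; apply/negP; rewrite -ltNge.
    rewrite /rn ltrBrDr -ltrBrDl -[ltRHS]invrK ltf_pV2 ?posrE ?invr_gt0//; last by lra.
    by apply: lt_le_trans hN _; rewrite ler_nat; lia.
move=> /fine_cvgP[_ /cvg_real/(_ _ e0)[N /(_ N (leqnn N))]].
rewrite subr0 => h; exists (rn N); first by rewrite rn2 rn1.
move=> t rt t1; apply: le_lt_trans (le_lt_trans (ler_norm _) h).
exact: tail_mono (lt_le_trans h2 (rn2 N)) rt t1.
Qed.

(** The form in which both classes of weights enter: [psi w r] is at least a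
    multiple of [1 - r] near 1. *)
Definition tail_dominates (k r1 : R) := forall s, r1 <= s < 1 ->
  k * (1 - s) * w s%:C%C <= tail w s.

Lemma tail_gt0 k r1 r : 0 < k -> 0 < r1 -> tail_dominates k r1 -> r1 <= r < 1 ->
  0 < tail w r.
Proof.
move=> k0 r10 H /andP[rr r1']; apply: lt_le_trans (H r _); last by rewrite rr.
rewrite !mulr_gt0 ?subr_gt0// weight_gt0//; apply/disc_real.
by rewrite r1' andbT; lra.
Qed.

(** The tail bounds the weight at each point of [[r, t]] by [tail w r / (k * (1 - t))]. *)
Lemma tail_step k r1 r t : 0 < k -> 0 < r1 -> tail_dominates k r1 ->
  r1 <= r -> r <= t -> t < 1 ->
  tail w r - tail w t <= tail w r * ((t - r) / (k * (1 - t))).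
Proof.
move=> k0 r10 H r1r rt t1.
have r0 : 0 < r by exact: lt_le_trans r1r.
rewrite {1}(tail_split r0 rt t1) addrK.
rewrite -lee_fin (tail_intE r0 (ltW t1)).
have kt : 0 < k * (1 - t) by rewrite mulr_gt0// subr_gt0.
apply: (@le_trans _ _ (\int[leb]_(s in `[r, t[) (tail w r / (k * (1 - t)))%:E)%E).
  apply: ge0_le_integral => //.
  - by move=> s /(profile_gt0 (ltW r0) (ltW t1))/ltW; rewrite lee_fin.
  - apply/measurable_EFinP; apply: measurable_profileS => //.
    exact: sub_itv01 (ltW r0) (ltW t1).
  - move=> s sr; have ws := profile_gt0 (ltW r0) (ltW t1) sr.
    move: sr; rewrite /= in_itv /= => /andP[rs st].
    rewrite lee_fin ler_pdivlMr// mulrC.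
    have s1 : r1 <= s < 1 by rewrite (le_trans r1r rs) (lt_trans st).
    apply: le_trans (tail_mono r0 rs (lt_trans st t1)).
    apply: le_trans (H _ s1).
    by rewrite ler_wpM2r ?(ltW ws)// ler_wpM2l ?(ltW k0)//; lra.
rewrite integral_cst//= lebesgue_measure_itv /= lte_fin.
case: ifPn => rt'; last first.
  by rewrite mule0 lee_fin mulr_ge0 ?tail_ge0// divr_ge0 ?subr_ge0// ltW.
by rewrite -EFinD -EFinM lee_fin mulrAC -mulrA.
Qed.

(** A bounded number of steps, each of which multiplies 1 - r by a fixed factor
    less than one and at most halves the tail, brings r past (1 + r) / 2. *)
Lemma tail_doubling k r1 : 0 < k -> 0 < r1 -> tail_dominates k r1 ->
  exists2 D : R, 1 <= D &
    forall r, r1 <= r < 1 -> tail w r <= D * tail w ((1 + r) / 2).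
Proof.
move=> k0 r10 H.
pose b := 1 + k / 2.
have b1 : 1 < b by rewrite /b; lra.
have b0 : 0 < b by lra.
have step m r : r1 <= r < 1 ->
    tail w r <= 2 ^+ m * tail w (1 - (1 - r) / b ^+ m).
  elim: m r => [|m ih] r /andP[r1r rl].
    by rewrite !expr0 divr1 subKr mul1r.
  pose t := 1 - (1 - r) / b.
  have d0 : 0 < (1 - r) / b by rewrite divr_gt0// subr_gt0.
  have db : (1 - r) / b < 1 - r by rewrite ltr_pdivrMr// ltr_pMr// subr_gt0.
  have rt : r <= t by rewrite /t; lra.
  have t1 : t < 1 by rewrite /t; lra.
  have := tail_step k0 r10 H r1r rt t1.
  have -> : (t - r) / (k * (1 - t)) = 1 / 2.
    by rewrite /t /b; field; rewrite !lt0r_neq0//; rewrite /b in b0; lra.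
  move=> h; have := ih t; rewrite (le_trans r1r rt) t1 => /(_ isT).
  have -> : 1 - (1 - t) / b ^+ m = 1 - (1 - r) / b ^+ m.+1.
    by rewrite /t subKr exprS invfM mulrA.
  rewrite [2 ^+ m.+1]exprS -(mulrA 2); move: (2 ^+ m * _) => X; lra.
have [m hm] : exists m, 2 <= b ^+ m.
  have [m hm] : exists m : nat, 2 / (b - 1) < m%:R.
    exists (Num.bound (2 / (b - 1))); apply: archi_boundP.
    by rewrite divr_ge0//; lra.
  exists m; rewrite ltr_pdivrMr in hm; last lra.
  have := @ltW _ _ _ _ hm.
  have bern : 1 + m%:R * (b - 1) <= b ^+ m.
    elim: (m) => [|j ih]; first by rewrite mul0r addr0.
    have h0 : 0 <= j%:R * (b - 1) * (b - 1) by rewrite !mulr_ge0//; lra.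
    rewrite exprS; apply: le_trans (_ : b * (1 + j%:R * (b - 1)) <= _); last first.
      by rewrite ler_pM2l.
    rewrite -natr1; move: h0; nra.
  lra.
exists (2 ^+ m); first by rewrite exprn_ege1// ler1n.
move=> r /andP[r1r rl]; apply: le_trans (step m r _) _; first by rewrite r1r.
rewrite ler_pM2l ?exprn_gt0//; apply: tail_mono.
- by lra.
- have : (1 - r) / b ^+ m <= (1 - r) / 2.
    by rewrite ler_pM2l ?subr_gt0// lef_pV2 ?posrE//; exact: exprn_gt0.
  by move: (_ / b ^+ m) => u; lra.
- by rewrite ltrBlDr ltrDl divr_gt0 ?subr_gt0// exprn_gt0.
Qed.

End WeightTail.

(** For [rapidly_increasing_weight] the quotient [psi w r / (1 - r)] is eventually at
    least 1; for [regular_weight] the lower bound is part of the definition. *)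
Lemma tail_dominatesP (R : realType) (w : cplx R -> R) :
  rapidly_increasing_weight w \/ regular_weight w ->
  continuous_radial_weight w /\
  exists k r1, [/\ 0 < k, 0 < r1 < 1 & tail_dominates w k r1].
Proof.
case=> [[hw hlim]|[hw [K K1 hK]]]; split => //.
- have /cvgryPge/(_ 1)[d /= d0 hd] := hlim.
  exists 1, (Num.max (1 / 2) (1 - d / 2)); split => //.
    by rewrite lt_max gt_max; apply/andP; split; [apply/orP; left; lra|lra].
  move=> s; rewrite ge_max => /andP[/andP[s2 sd] s1].
  have ws : 0 < w s%:C%C by apply: (weight_gt0 hw); apply/disc_real; lra.
  have /hd : ball (1 : R) d s by rewrite /ball /= gtr0_norm ?subr_gt0//; lra.
  move=> /(_ s1); rewrite /psi ler_pdivlMr ?subr_gt0// mul1r.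
  by rewrite mulrC ler_pdivlMr// mul1r.
- exists K^-1, (1 / 2); split; [by rewrite invr_gt0; lra|lra|].
  move=> s /andP[s2 s1].
  have ws : 0 < w s%:C%C by apply: (weight_gt0 hw); apply/disc_real; lra.
  have /hK/andP[+ _] : 0 <= s < 1 by rewrite s1 andbT; lra.
  by rewrite /psi [X in _ <= X]mulrC ler_pdivlMr.
Qed.

(** * Four-point means of the logarithm of a modulus *)

Section FourPointMean.
Variable R : realType.
Local Notation C := (cplx R).
Implicit Types (a b x z : C) (L : C -> R).

Definition iC : C := (0 +i* 1)%C.

Lemma iC2 : iC ^+ 2 = -1.
Proof. by rewrite /iC expr2; apply/eqP; rewrite eq_complex /= !mulr0 !mul0r mulr1 sub0r add0r oppr0 !eqxx. Qed.

Lemma cabs_iC : cabs iC = 1.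
Proof. by rewrite /cabs /= expr0n expr1n add0r sqrtr1. Qed.

Definition avg4 L b z : R :=
  (L (b + z) + L (b - z) + L (b + iC * z) + L (b - iC * z)) / 4.

(** Harmonicity to third order at the scale of four points: the mean over
    [b + i ^+ k * z] replaces the mean over a circle. *)
Definition mean4 L a : Prop := exists d K : R, [/\ 0 < d, 0 <= K &
  forall b z, cabs (b - a) < d -> cabs z < d ->
    `|avg4 L b z - L b| <= K * cabs z ^+ 3].

Lemma mean4D L1 L2 a : mean4 L1 a -> mean4 L2 a -> mean4 (fun x => L1 x + L2 x) a.
Proof.
move=> [d1 [K1 [d10 K10 h1]]] [d2 [K2 [d20 K20 h2]]].
exists (Num.min d1 d2), (K1 + K2); split; [by rewrite lt_min d10|exact: addr_ge0|].
move=> b z; rewrite !lt_min => /andP[b1 b2] /andP[z1 z2].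
rewrite (_ : _ - _ = (avg4 L1 b z - L1 b) + (avg4 L2 b z - L2 b)); last first.
  by rewrite /avg4; field.
by rewrite mulrDl (le_trans (ler_normD _ _))// lerD// ?h1 ?h2.
Qed.

Lemma mean4N L a : mean4 L a -> mean4 (fun x => - L x) a.
Proof.
move=> [d [K [d0 K0 h]]]; exists d, K; split => // b z bd zd.
rewrite (_ : _ - _ = - (avg4 L b z - L b)); first by rewrite normrN h.
by rewrite /avg4; field.
Qed.

Lemma mean4_cst (c : R) a : mean4 (fun=> c) a.
Proof.
exists 1, 0; split => // b z _ _.
by rewrite mul0r /avg4 (_ : _ - _ = 0) ?normr0//; field.
Qed.

Lemma mean4_near L1 L2 a : (exists2 d : R, 0 < d & forall x, cabs (x - a) < d -> L1 x = L2 x) ->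
  mean4 L1 a -> mean4 L2 a.
Proof.
move=> [e e0 he] [d [K [d0 K0 h]]].
exists (Num.min d (e / 2)), K; split => //; first by rewrite lt_min d0 divr_gt0.
move=> b z; rewrite !lt_min => /andP[b1 b2] /andP[z1 z2].
have E y : cabs y <= cabs z -> L2 (b + y) = L1 (b + y).
  move=> yz; rewrite he// addrAC; apply: le_lt_trans (cabsD _ _) _; lra.
have E0 : L2 b = L1 b by rewrite he//; lra.
rewrite (_ : avg4 L2 b z = avg4 L1 b z) ?E0; first exact: h.
by rewrite /avg4 !E ?cabsN ?cabsM ?cabs_iC ?mul1r.
Qed.

Lemma ln_cubic (x : R) : `|x| <= 1 / 2 -> `|ln (1 + x) - (x - x ^+ 2 / 2)| <= 2 * `|x| ^+ 3.
Proof.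
move=> x2; have x2' : - (1 / 2) <= x <= 1 / 2 by rewrite -ler_norml.
pose G (t : R) := ln t - ((t - 1) - (t - 1) ^+ 2 / 2).
have dG (t : R) : 0 < t -> is_derive t (1 : R) G (t^-1 - (1 - (t - 1))).
  move=> t0; rewrite /G.
  have dl := is_derive1_ln t0.
  apply: is_derive_eq.
  by rewrite /GRing.scale /=; field; rewrite lt0r_neq0.
have G1 : G 1 = 0 by rewrite /G ln1 subrr expr0n /= mul0r subrr oppr0 addr0.
have main (s t : R) : 1 / 2 <= s -> s <= t -> t <= 3 / 2 -> exists2 c, s <= c <= t &
    G t - G s = (c^-1 - (1 - (c - 1))) * (t - s).
  move=> s2 st t2.
  have dst c : c \in `]s, t[ -> is_derive c (1 : R) G (c^-1 - (1 - (c - 1))).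
    by rewrite in_itv /= => hc; apply: dG; lra.
  have cst : {within `[s, t], continuous G}.
    apply: derivable_within_continuous => c; rewrite in_itv /= => hc.
    have h : 0 < c by lra.
    by have [] := dG c h.
  by have [c + e] := MVT_segment st dst cst; rewrite in_itv /= => h1; exists c.
have bnd (c : R) : 1 / 2 <= c -> `|c^-1 - (1 - (c - 1))| <= 2 * (c - 1) ^+ 2.
  move=> c2; have c0 : 0 < c by lra.
  have -> : c^-1 - (1 - (c - 1)) = (c - 1) ^+ 2 / c by field; rewrite lt0r_neq0.
  rewrite ger0_norm; last by rewrite divr_ge0 ?sqr_ge0// ltW.
  by rewrite ler_pdivrMr//; have := sqr_ge0 (c - 1); move: (_ ^+ 2) => X; nra.
have x1 : 1 + x - 1 = x by ring.
have Gx : G (1 + x) = ln (1 + x) - (x - x ^+ 2 / 2) by rewrite /G x1.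
have xx : x ^+ 2 = `|x| ^+ 2 by rewrite real_normK ?num_real.
rewrite -Gx exprSr mulrA; have [x0|x0] := leP 0 x.
  have [|||c /andP[c1 c2] e] := main 1 (1 + x); [lra..|].
  rewrite G1 subr0 x1 in e; rewrite e normrM ler_wpM2r//.
  have c3 : 1 / 2 <= c by lra.
  apply: le_trans (bnd _ c3) _; rewrite ler_wpM2l// -xx; nra.
have [|||c /andP[c1 c2] e] := main (1 + x) 1; [lra..|].
have e2 : 1 - (1 + x) = - x by ring.
rewrite G1 sub0r e2 mulrN in e; move/oppr_inj : e => ->.
rewrite normrM ler_wpM2r//.
have c3 : 1 / 2 <= c by lra.
apply: le_trans (bnd _ c3) _; rewrite ler_wpM2l// -xx; nra.
Qed.

Lemma ln_cabs1D (x : C) : cabs x <= 1 / 8 ->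
  `|ln (cabs (1 + x)) - complex.Re (x - x ^+ 2 / 2)| <= 29 * cabs x ^+ 3.
Proof.
move=> x8; have x0 := cabs_ge0 x.
have Rp := Re_le_cabs x; have Iq := Im_le_cabs x; have xx := sqr_cabs x.
set r := cabs x in x8 x0 Rp Iq xx *.
have E1 : cabs (1 + x) ^+ 2 = 1 + (2 * complex.Re x + r ^+ 2).
  by rewrite sqr_cabs xx; case: (x) => p q /=; ring.
have E2 : complex.Re (x - x ^+ 2 / 2) =
    complex.Re x - (complex.Re x ^+ 2 - complex.Im x ^+ 2) / 2.
  have -> : x ^+ 2 / 2 = x ^+ 2 * (2^-1)%:C%C by rewrite fmorphV rmorph_nat.
  by case: (x) => p q /=; rewrite expr2 /=; ring.
rewrite E2.
move: Rp Iq xx E1; move: (complex.Re x) (complex.Im x) => p q Rp Iq xx E1.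
set y := 2 * p + r ^+ 2 in E1.
have r2 : r ^+ 2 <= r / 8 by rewrite expr2; nra.
have r20 : 0 <= r ^+ 2 by exact: sqr_ge0.
have yr : `|y| <= 3 * r.
  apply: le_trans (ler_normD _ _) _; rewrite normrM (ger0_norm r20) ger0_norm//.
  by move: Rp r2; move: (r ^+ 2) `|p| => X Y; lra.
have y2 : `|y| <= 1 / 2 by lra.
have y1 : 0 < 1 + y by move: y2; rewrite ler_norml; lra.
have x1 : 0 < cabs (1 + x).
  rewrite lt_def cabs_ge0 andbT; apply/eqP => h.
  by move: E1 y1; rewrite h expr0n /= => <-; rewrite ltxx.
have ln2 : ln (cabs (1 + x)) = ln (1 + y) / 2.
  by rewrite -E1 lnXn// mulr2n; field.
have := ln_cubic y2; rewrite ln2.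
have y3 : `|y| ^+ 3 <= 27 * r ^+ 3.
  have -> : 27 * r ^+ 3 = (3 * r) ^+ 3 by ring.
  by rewrite lerXn2r// nnegrE//; lra.
have T : (y - y ^+ 2 / 2) / 2 - (p - (p ^+ 2 - q ^+ 2) / 2) = - (p * r ^+ 2 + r ^+ 4 / 4).
  have -> : r ^+ 4 = (r ^+ 2) ^+ 2 by rewrite -exprM.
  by rewrite /y xx; field.
have T2 : `|- (p * r ^+ 2 + r ^+ 4 / 4)| <= 2 * r ^+ 3.
  rewrite normrN; apply: le_trans (ler_normD _ _) _.
  have r40 : 0 <= r ^+ 4 / 4 by rewrite divr_ge0// exprn_ge0.
  rewrite normrM (ger0_norm r20) (ger0_norm r40).
  have -> : r ^+ 4 = r * r ^+ 3 by rewrite -exprS.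
  have r30 : 0 <= r ^+ 3 by rewrite exprn_ge0.
  have : `|p| * r ^+ 2 <= r ^+ 3 by rewrite [leRHS]exprS ler_wpM2r.
  have : r * r ^+ 3 <= r ^+ 3 by rewrite ler_piMl//; lra.
  by move: (r * r ^+ 3) (r ^+ 3) (`|p| * _) r30 => A B D; lra.
move: T T2 y3.
move: (y - y ^+ 2 / 2) (p - (p ^+ 2 - q ^+ 2) / 2) (p * r ^+ 2 + r ^+ 4 / 4).
move: (r ^+ 3) (`|y| ^+ 3) (ln (1 + y)) => X Y A B D E.
by rewrite !ler_norml; lra.
Qed.

(** Summing over the fourth roots of unity kills the linear and quadratic terms
    of a Taylor expansion. *)
Lemma mean4_quadratic L a (d K : R) : 0 < d -> 0 <= K ->
  (forall b, cabs (b - a) < d -> exists p1 p2 : C, forall z, cabs z < d ->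
     `|L (b + z) - L b - complex.Re (p1 * z + p2 * z ^+ 2)| <= K * cabs z ^+ 3) ->
  mean4 L a.
Proof.
move=> d0 K0 h; exists d, K; split => // b z /h[p1 [p2 hb]] zd.
have iz : cabs (iC * z) = cabs z by rewrite cabsM cabs_iC mul1r.
have := hb z zd; have := hb (- z); have := hb (iC * z); have := hb (- (iC * z)).
rewrite !cabsN iz => /(_ zd) h1 /(_ zd) h2 /(_ zd) h3 h4.
have S : complex.Re (p1 * z + p2 * z ^+ 2) + complex.Re (p1 * - z + p2 * (- z) ^+ 2) +
   complex.Re (p1 * (iC * z) + p2 * (iC * z) ^+ 2) +
   complex.Re (p1 * - (iC * z) + p2 * (- (iC * z)) ^+ 2) = 0.
  rewrite -!raddfD /= !sqrrN exprMn iC2.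
  rewrite [X in complex.Re X](_ : _ = 0)//; ring.
rewrite /avg4; move: h1 h2 h3 h4 S.
move: (complex.Re _) (complex.Re _) (complex.Re _) (complex.Re _) => A B D E.
move: (K * _) (L (b + z)) (L _) (L _) (L _) (L b) => X l1 l2 l3 l4 l.
by rewrite !ler_norml; lra.
Qed.

Lemma expands0 (f : C -> C) a c (s M : R) : expands f a c s M -> c 0%N = f a.
Proof.
move=> e; have [s0 _ _] := e.
have := @expands_taylor _ _ _ _ _ _ 1 0 e; rewrite cabs0 => /(_ ltac:(lra)).
rewrite mul0r expr1 mulr0 addr0 /psum big_ord1 expr0 mulr1 => h.
by apply/esym/eqP; rewrite -subr_eq0 -cabs_eq0 eq_le h cabs_ge0.
Qed.

Lemma expands_lip (f : C -> C) a c (s M : R) x : expands f a c s M -> cabs x <= s / 2 ->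
  cabs (f (a + x) - f a) <= 2 * M / s * cabs x.
Proof.
move=> e xs; have := expands_taylor 1 e xs.
rewrite /psum big_ord1 expr0 mulr1 (expands0 e) expr1 => /le_trans; apply.
by rewrite mulrA mulrAC.
Qed.

(** Expansion of [ln |f|] to second order from that of [f].  The numerical
    constants only have to be independent of the base point. *)
Lemma ln_quadratic (B : R) (c1 c2 e z : C) : 1 <= B ->
  cabs c1 <= B -> cabs c2 <= B -> cabs e <= B * cabs z ^+ 3 -> cabs z <= 1 ->
  24 * B * cabs z <= 1 ->
  `|ln (cabs (1 + (c1 * z + c2 * z ^+ 2 + e))) -
    complex.Re (c1 * z + (c2 - c1 ^+ 2 / 2) * z ^+ 2)| <=
    800 * B ^+ 3 * cabs z ^+ 3.
Proof.
move=> B1 hc1 hc2 he z1 Bz; set x := c1 * z + c2 * z ^+ 2 + e.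
have r0 := cabs_ge0 z; set r := cabs z in he z1 Bz r0 *.
have B0 : 0 <= B by lra.
have r2 : r ^+ 2 <= r by rewrite expr2; nra.
have r20 : 0 <= r ^+ 2 by rewrite exprn_ge0.
have r30 : 0 <= r ^+ 3 by rewrite exprn_ge0.
have r3 : r ^+ 3 <= r by rewrite exprS; nra.
have ex1 : cabs (c1 * z) <= B * r by rewrite cabsM ler_pM// cabs_ge0.
have ex2 : cabs (c2 * z ^+ 2) <= B * r ^+ 2 by rewrite cabsM cabsX ler_pM ?cabs_ge0.
have xr : cabs x <= 3 * B * r.
  apply: le_trans (cabsD _ _) _; apply: le_trans (lerD (cabsD _ _) (lexx _)) _.
  have : B * r ^+ 2 <= B * r by rewrite ler_wpM2l.
  have : B * r ^+ 3 <= B * r by rewrite ler_wpM2l.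
  lra.
have x8 : cabs x <= 1 / 8 by lra.
have h1 := ln_cabs1D x8.
have x3 : cabs x ^+ 3 <= 27 * (B ^+ 3 * r ^+ 3).
  have -> : 27 * (B ^+ 3 * r ^+ 3) = (3 * B * r) ^+ 3 by ring.
  by rewrite lerXn2r// nnegrE ?cabs_ge0// !mulr_ge0.
pose Q := e - (c1 * z * (c2 * z ^+ 2) + (c2 * z ^+ 2) ^+ 2 / 2) - e * (c1 * z + c2 * z ^+ 2) - e ^+ 2 / 2.
have Q1 : x - x ^+ 2 / 2 = (c1 * z + (c2 - c1 ^+ 2 / 2) * z ^+ 2) + Q.
  by rewrite /Q /x; field.
have c2n : cabs (2^-1 : C) = 2^-1.
  by rewrite cabsV -(@rmorph_nat _ _ (real_complex R)) cabsR ger0_norm.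
have BB : B * r ^+ 3 <= B ^+ 3 * r ^+ 3.
  by rewrite ler_wpM2r// -{1}(expr1 B) ler_weXn2l.
have BB2 : B ^+ 2 * r ^+ 3 <= B ^+ 3 * r ^+ 3 by rewrite ler_wpM2r// ler_weXn2l.
have Q2 : cabs Q <= 6 * (B ^+ 3 * r ^+ 3).
  have t1 : cabs (c1 * z * (c2 * z ^+ 2)) <= B ^+ 2 * r ^+ 3.
    rewrite cabsM; apply: le_trans (ler_pM (cabs_ge0 _) (cabs_ge0 _) ex1 ex2) _.
    by rewrite le_eqVlt; apply/orP; left; apply/eqP; ring.
  have t2 : cabs ((c2 * z ^+ 2) ^+ 2 / 2) <= B ^+ 2 * r ^+ 3.
    rewrite cabsM cabsX c2n; apply: (@le_trans _ _ ((B * r ^+ 2) ^+ 2)).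
      have := lerXn2r 2 (cabs_ge0 (c2 * z ^+ 2) : _ \in Num.nneg)
         (mulr_ge0 B0 r20 : _ \in Num.nneg) ex2.
      by have := sqr_ge0 (cabs (c2 * z ^+ 2)); lra.
    rewrite exprMn ler_wpM2l ?exprn_ge0// -exprM /=.
    by rewrite (exprS r 3) ler_piMl.
  have t3 : cabs (e * (c1 * z + c2 * z ^+ 2)) <= B ^+ 2 * r ^+ 3 * 2.
    rewrite cabsM; apply: (@le_trans _ _ (B * r ^+ 3 * (2 * B))); last first.
      by rewrite le_eqVlt; apply/orP; left; apply/eqP; ring.
    apply: ler_pM; rewrite ?cabs_ge0//; apply: le_trans (cabsD _ _) _.
    have : B * r <= B by rewrite ler_piMr.
    have : B * r ^+ 2 <= B by rewrite ler_piMr// (le_trans r2).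
    lra.
  have t4 : cabs (e ^+ 2 / 2) <= B ^+ 2 * r ^+ 3.
    rewrite cabsM cabsX c2n; apply: (@le_trans _ _ ((B * r ^+ 3) ^+ 2)).
      have := lerXn2r 2 (cabs_ge0 e : _ \in Num.nneg)
         (mulr_ge0 B0 r30 : _ \in Num.nneg) he.
      by have := sqr_ge0 (cabs e); lra.
    rewrite exprMn ler_wpM2l ?exprn_ge0// (expr2 (r ^+ 3)) ler_piMl//.
    exact: le_trans r3 z1.
  rewrite /Q; apply: le_trans (cabsB _ _) _.
  apply: le_trans (lerD (cabsB _ _) (lexx _)) _.
  apply: le_trans (lerD (lerD (cabsB _ _) (lexx _)) (lexx _)) _.
  have := cabsD (c1 * z * (c2 * z ^+ 2)) ((c2 * z ^+ 2) ^+ 2 / 2).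
  lra.
have h2 : `|complex.Re Q| <= 6 * (B ^+ 3 * r ^+ 3) by exact: le_trans (Re_le_cabs _) Q2.
move: h1; rewrite Q1 raddfD /=.
have -> : 800 * B ^+ 3 * r ^+ 3 = 800 * (B ^+ 3 * r ^+ 3) by rewrite mulrA.
have Y0 : 0 <= B ^+ 3 * r ^+ 3 by rewrite mulr_ge0// exprn_ge0.
move: h2 x3 Y0; move: (cabs x ^+ 3) (B ^+ 3 * r ^+ 3) => X Y.
move: (ln _) (complex.Re _) (complex.Re _) => l p q.
by rewrite !ler_norml; lra.
Qed.

(** The logarithm of the modulus of a function without zeros is harmonic; the
    four-point mean sees this up to the third order, uniformly near each point. *)
Lemma mean4_ln_cabs (f : C -> C) a : analytic_at f a -> f a != 0 ->
  mean4 (fun x => ln (cabs (f x))) a.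
Proof.
move=> /analytic_atP[c [s [M e]]]; rewrite -cabs_gt0 => fa.
have [s0 cM _] := e.
have M0 : 0 <= M by have := cM 0%N; rewrite expr0 mulr1; apply: le_trans; exact: cabs_ge0.
pose m := cabs (f a) / 2.
have m0 : 0 < m by rewrite divr_gt0.
pose d1 := m * s / (2 * M + 1).
have d10 : 0 < d1 by rewrite divr_gt0 ?mulr_gt0//; lra.
have low b : cabs (b - a) < d1 -> cabs (b - a) < s / 4 -> m <= cabs (f b).
  move=> bd bs; have bs2 : cabs (b - a) <= s / 2 by lra.
  have := expands_lip e bs2; rewrite subrKC => h.
  have : 2 * M / s * cabs (b - a) <= m.
    rewrite mulrAC ler_pdivrMr//; move: bd; rewrite /d1 ltr_pdivlMr; last lra.
    by have := cabs_ge0 (b - a); nra.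
  have := cabs_triB (f a) (f b); rewrite cabs_distC (_ : cabs (f a) = m + m); last first.
    by rewrite /m; lra.
  lra.
pose s1 := s / 2; have s10 : 0 < s1 by rewrite divr_gt0.
pose M1 := 4 * M; have M10 : 0 <= M1 by rewrite mulr_ge0.
pose A1 := M1 / s1 / m; pose A2 := M1 / s1 ^+ 2 / m; pose A3 := 2 * M1 / s1 ^+ 3 / m.
have A10 : 0 <= A1 by rewrite !divr_ge0// ltW.
have A20 : 0 <= A2 by rewrite !divr_ge0 ?exprn_ge0// ltW.
have A30 : 0 <= A3 by rewrite !divr_ge0 ?exprn_ge0 ?mulr_ge0// ltW.
have [B [B1 BA1 BA2 BA3]] : exists B, [/\ 1 <= B, A1 <= B, A2 <= B & A3 <= B].
  exists (1 + A1 + A2 + A3); move: A10 A20 A30; move: A1 A2 A3 => u v t *.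
  by split; lra.
have B0 : 0 < 24 * B by lra.
have d0 : 0 < Num.min (Num.min (s / 8) (d1 / 2)) (Num.min 1 (24 * B)^-1).
  by rewrite !lt_min invr_gt0 B0 ltr01 /= andbT; apply/andP; split; apply: divr_gt0.
have K0 : 0 <= 800 * B ^+ 3.
  by apply: mulr_ge0; [exact: ler0n | apply: exprn_ge0; lra].
apply: (mean4_quadratic d0 K0).
move=> b; rewrite !lt_min => /andP[/andP[bs' bd'] _].
have bs : cabs (b - a) < s / 4 by lra.
have bd : cabs (b - a) < d1 by lra.
have fb := low _ bd bs.
have fb0 : 0 < cabs (f b) by exact: lt_le_trans fb.
have fbn : f b != 0 by rewrite -cabs_gt0.
have [D eD] := expands_near e bs.
have [_ DM _] := eD.
have coef j : cabs (D j / f b) <= M1 / s1 ^+ j / m.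
  rewrite cabsM cabsV ler_pM ?cabs_ge0 ?invr_ge0 ?cabs_ge0//.
    by rewrite ler_pdivlMr ?exprn_gt0.
  by rewrite lef_pV2.
exists (D 1%N / f b), (D 2%N / f b - (D 1%N / f b) ^+ 2 / 2) => z.
rewrite !lt_min => /andP[/andP[zs zd] /andP[z1 zB]].
pose E := (f (b + z) - psum D z 3) / f b.
have E0 : f (b + z) = f b * (1 + (D 1%N / f b * z + D 2%N / f b * z ^+ 2 + E)).
  rewrite /E /psum !big_ord_recr big_ord0 /= (expands0 eD); field.
  by [].
have -> : ln (cabs (f (b + z))) - ln (cabs (f b)) =
    ln (cabs (1 + (D 1%N / f b * z + D 2%N / f b * z ^+ 2 + E))).
  have : 0 < cabs (f (b + z)).
    have tri := cabsD (b - a) z; rewrite addrAC in tri.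
    by apply: lt_le_trans m0 (low _ _ _); lra.
  by rewrite E0 cabsM pmulr_rgt0// => pos; rewrite lnM ?posrE// addrC addKr.
apply: ln_quadratic => //.
- by apply: le_trans (coef 1%N) _; rewrite expr1.
- exact: le_trans (coef 2%N) _.
- rewrite cabsM cabsV ler_pdivrMr//.
  have zs1 : cabs z <= s1 / 2 by rewrite /s1; lra.
  apply: le_trans (expands_taylor 3 eD zs1) _.
  rewrite expr_div_n -/M1 -/s1.
  apply: (@le_trans _ _ (A3 * cabs z ^+ 3 * m)).
    rewrite le_eqVlt; apply/orP; left; apply/eqP; rewrite /A3; field.
    by rewrite !lt0r_neq0.
  have : A3 * cabs z ^+ 3 <= B * cabs z ^+ 3.
    by rewrite ler_wpM2r ?exprn_ge0 ?cabs_ge0.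
  move=> h; apply: ler_pM => //; first by rewrite mulr_ge0// exprn_ge0// cabs_ge0.
  exact: ltW.
- exact: ltW.
- by rewrite mulrC -ler_pdivlMr// mul1r ltW.
Qed.

End FourPointMean.

(** * Compactness and a radial maximum principle *)

Section PlaneCompactness.
Variable R : realType.
Local Notation C := (cplx R).

(** Compactness of the closed disc of radius [t]: a property that holds locally
    uniformly holds with one common radius.  The disc is covered as a subset of a square,
    by compactness of a segment in each coordinate. *)
Lemma plane_uniform (t : R) (P : C -> R -> Prop) :
  (forall b (d d' : R), 0 < d' -> d' <= d -> P b d -> P b d') ->
  (forall a, cabs a <= t -> exists2 d : R, 0 < d & forall b, cabs (b - a) < d -> P b d) ->
  exists2 d : R, 0 < d & forall b, cabs b <= t -> P b d.
Proof.
move=> Pmono Ploc.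
pose Q (d x y : R) := cabs (x +i* y : C)%C <= t -> P (x +i* y)%C d.
have Qloc (x y : R) : exists2 e : R, 0 < e & forall d x' y' : R, 0 < d -> d < e ->
    `|x - x'| < e -> `|y - y'| < e -> Q d x' y'.
  have near (e : R) (x' y' : R) : `|x - x'| < e / 2 -> `|y - y'| < e / 2 ->
      cabs ((x' +i* y')%C - (x +i* y)%C : C) < e.
    move=> hx hy; apply: le_lt_trans (cabs_le_ReIm _) _ => /=.
    by rewrite [ltRHS]splitr distrC (distrC y') ltrD.
  have [at_|ta] := leP (cabs (x +i* y : C)%C) t.
    have [e e0 he] := Ploc _ at_.
    exists (e / 2); first by rewrite divr_gt0.
    move=> d x' y' d0 de hx hy _; apply: (Pmono _ e) => //; first lra.
    exact/he/near.
  exists ((cabs (x +i* y : C)%C - t) / 2); first by rewrite divr_gt0// subr_gt0.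
  move=> d x' y' _ _ hx hy h; exfalso.
  have := near _ _ _ hx hy; have := cabs_triB (x +i* y : C)%C (x' +i* y')%C.
  by rewrite cabs_distC; lra.
have cov (x y : R) : \forall y' \near y & xd \near (nbhs x, (0 : R)^'+),
    0 < xd.2 /\ Q xd.2 xd.1 y'.
  have [e e0 he] := Qloc x y.
  exists (ball y e, [set xd | ball x e xd.1 /\ 0 < xd.2 < e]) => /=.
    split; first exact: nbhsx_ballx.
    exists (ball x e, [set d | 0 < d < e]) => /=.
      split; first exact: nbhsx_ballx.
      exists e => //= d /=; rewrite sub0r normrN => de d0.
      by rewrite d0 (le_lt_trans (ler_norm _) de).
    by move=> [x' d] [].
  by move=> [y' [x' d]] /= [by_ [bx /andP[d0 de]]]; split => //; exact: he.
pose S := `[- t, t]%classic : set R.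
have cS : compact S by exact: segment_compact.
have step1 (x : R) : \forall xd \near (nbhs x, (0 : R)^'+), forall y, S y -> 0 < xd.2 /\ Q xd.2 xd.1 y.
  move/compact_near_coveringP : cS => /(_ _ (filter_prod (nbhs x) (0 : R)^'+)
    (fun xd y => 0 < xd.2 /\ Q xd.2 xd.1 y)).
  by apply => y _; exact: cov.
have : \forall d \near (0 : R)^'+, forall x, S x -> forall y, S y -> 0 < d /\ Q d x y.
  move/compact_near_coveringP : cS => /(_ _ (0 : R)^'+ (fun d x => forall y, S y -> 0 < d /\ Q d x y)).
  by apply => x _; exact: step1.
move=> [e /= e0 he]; exists (e / 2); first by rewrite divr_gt0.
move=> b bt; have e20 : 0 < e / 2 by rewrite divr_gt0.
have be : ball_ [eta Num.Def.normr] 0 e (e / 2).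
  by rewrite /ball_ /= sub0r normrN gtr0_norm//; lra.
have h1 := he _ be e20 (complex.Re b).
have := Re_le_cabs b; have := Im_le_cabs b; rewrite !ler_norml => hi hr.
have Sr : S (complex.Re b) by rewrite /S /= in_itv /=; lra.
have Si : S (complex.Im b) by rewrite /S /= in_itv /=; lra.
have [_] := h1 Sr _ Si; rewrite /Q; case: (b) bt => x y /= bt; exact.
Qed.

End PlaneCompactness.

Section RadialMaximumPrinciple.
Variable R : realType.

(** Adding a small multiple of the square makes an interior maximum impossible:
    the mean of the square over the four points exceeds its value at the centre
    by [p ^+ 2], which beats the error term of order [p ^+ 3]. *)
Lemma radial_maximum_principle (u : R -> R) (K d : R) : 0 < d -> 0 <= K ->
  (forall x : R, 0 <= x <= 1 -> forall e : R, 0 < e ->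
    exists2 c : R, 0 < c & forall y : R, 0 <= y <= 1 -> `|y - x| < c -> `|u y - u x| < e) ->
  (forall x p : R, 0 <= x -> 0 < p < d -> x + p <= 1 ->
    u x - K * p ^+ 3 <=
    (u (x + p) + u `|x - p| + 2 * u (Num.sqrt (x ^+ 2 + p ^+ 2))) / 4) ->
  u 0 <= u 1.
Proof.
move=> d0 K0 cu su; rewrite leNgt; apply/negP => u10.
pose e := (u 0 - u 1) / 2.
have e0 : 0 < e by rewrite divr_gt0// subr_gt0.
pose cl (x : R) := Num.max 0 (Num.min x 1).
have cl01 x : 0 <= cl x <= 1.
  by rewrite /cl le_max lexx /= ge_max ler01 ge_min lexx orbT.
have clE (x : R) : 0 <= x <= 1 -> cl x = x.
  by move=> /andP[x0 x1]; rewrite /cl min_l// max_r.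
have cl_lip x y : `|cl x - cl y| <= `|x - y|.
  have m01 : Num.max 0 1 = 1 :> R by rewrite max_r.
  have := ler_norm (x - y); have := ler_norm (- (x - y)); rewrite normrN.
  rewrite /cl; case: (leP x 1) => ?; case: (leP y 1) => ?; rewrite ?m01.
  - by case: (leP 0 x) => ?; case: (leP 0 y) => ?; rewrite ler_norml; lra.
  - by case: (leP 0 x) => ?; rewrite ler_norml; lra.
  - by case: (leP 0 y) => ?; rewrite ler_norml; lra.
  - by rewrite ler_norml; lra.
pose v x := u (cl x) + e * cl x ^+ 2.
have cv : {within `[0, 1], continuous v}.
  apply: continuous_subspaceT => x; apply: cvgD.
    apply/cvgrPdist_lt => e1 e10; have [c c0 hc] := cu _ (cl01 x) _ e10.
    exists c => // y /= xy; rewrite distrC; apply: hc; first exact: cl01.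
    by apply: le_lt_trans (cl_lip _ _) _; rewrite distrC.
  apply: cvgMl_tmp; apply: (@cvg_comp _ _ _ cl (fun x => x ^+ 2) _ (nbhs (cl x))).
    apply/cvgrPdist_lt => e1 e10; exists e1 => // y /= xy.
    exact: le_lt_trans (cl_lip _ _) xy.
  exact: exprn_continuous.
have [c + cmax] := EVT_max ler01 cv.
rewrite in_itv /= => c01.
have vE (x : R) : 0 <= x <= 1 -> v x = u x + e * x ^+ 2 by move=> x01; rewrite /v clE.
have maxc (x : R) : 0 <= x <= 1 -> u x + e * x ^+ 2 <= u c + e * c ^+ 2.
  by move=> x01; rewrite -!vE//; apply: cmax; rewrite in_itv.
have c1 : c < 1.
  move: c01 => /andP[c0]; rewrite le_eqVlt => /orP[/eqP c1|//].
  have := maxc 0; rewrite lexx ler01 => /(_ isT).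
  by rewrite c1 expr0n expr1n /= /e; lra.
have /andP[c0 _] := c01.
pose p := Num.min (d / 2) (Num.min ((1 - c) / 2) (e / (K + 1) / 2)).
have eK : 0 < e / (K + 1) / 2 by rewrite !divr_gt0//; lra.
have p0 : 0 < p by rewrite !lt_min eK andbT !divr_gt0// subr_gt0.
have pd : p < d by rewrite gt_min; apply/orP; left; lra.
have cp : c + p <= 1.
  have : p <= (1 - c) / 2 by rewrite !ge_min lexx orbT.
  lra.
have pK : K * p < e.
  have : p <= e / (K + 1) / 2 by rewrite !ge_min lexx !orbT.
  rewrite -mulrA -invfM ler_pdivlMr; last by rewrite mulr_gt0//; lra.
  nra.
have := su c p c0; rewrite p0 pd => /(_ isT cp).
set q := Num.sqrt _.
have q2 : q ^+ 2 = c ^+ 2 + p ^+ 2 by rewrite sqr_sqrtr// addr_ge0// sqr_ge0.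
have q0 : 0 <= q by rewrite sqrtr_ge0.
have h1 := maxc (c + p) ltac:(lra).
have h2 := maxc `|c - p| ltac:(rewrite normr_ge0 /= ler_norml; lra).
have h3 : u q + e * q ^+ 2 <= u c + e * c ^+ 2.
  apply: maxc; rewrite q0 /= -(@expr_le1 _ 2)// q2.
  have : (c + p) ^+ 2 <= 1 by rewrite expr_le1//; lra.
  have := mulr_ge0 c0 (ltW p0).
  by rewrite sqrrD mulr2n; move: (c * p) (c ^+ 2) (p ^+ 2) => *; lra.
rewrite real_normK ?num_real// in h2.
have pp : 0 < p ^+ 2 by rewrite exprn_gt0.
have p3 : K * p ^+ 3 < e * p ^+ 2.
  have -> : K * p ^+ 3 = (K * p) * p ^+ 2 by ring.
  by rewrite ltr_pM2r.
move: h1 h2 h3 p3; rewrite q2 !sqrrD sqrrN mulrN !mulr2n.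
rewrite !mulrDr !mulrN.
move: (K * _) (u q) (u `|_|) (u (c + p)) (u c) (e * p ^+ 2) (e * c ^+ 2) (e * (c * p)).
by move=> *; lra.
Qed.

End RadialMaximumPrinciple.

(** * Submean inequalities over annuli *)

Section WeightedMeanInequality.
Variable R : realType.
Local Notation C := (cplx R).
Local Notation leb2 := (@lebesgue_measure R \x @lebesgue_measure R)%E.
Variable w : C -> R.
Hypothesis hw : continuous_radial_weight w.

Definition almost_submean (F : C -> R) a : Prop := exists d K : R, [/\ 0 < d, 0 <= K &
  forall b z, cabs (b - a) < d -> cabs z < d ->
    F b - K * cabs z ^+ 3 <= avg4 F b z].

Variables (F : C -> R) (r t : R).
Hypothesis t1 : t < 1.
Hypothesis cF : cont_plane (@disc R) F.
Hypothesis F0 : forall a, disc a -> 0 <= F a.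
Hypothesis sF : forall a, disc a -> almost_submean F a.

Let D := annulus r t.
Let mD : measurable D. Proof. exact: measurable_annulus. Qed.
Let f (x : C) (p : R * R) : R := F (x * of_xy p) * w (of_xy p).
Let U (x : C) : R := \int[leb2]_(p in D) f x p.

Let disc_mul (x : C) p : cabs x <= 1 -> D p -> cabs (x * of_xy p) < t.
Proof.
move=> x1 /andP[_ pt]; rewrite cabsM; apply: le_lt_trans pt.
by rewrite ler_piMl// cabs_ge0.
Qed.

Let disc_t (a : C) : cabs a <= t -> disc a.
Proof. by move=> at_; exact: le_lt_trans at_ t1. Qed.

Let D_disc p : D p -> disc (of_xy p).
Proof. by move=> /andP[_ /ltW/disc_t]. Qed.

Lemma bounded_cont_plane : exists2 M : R, 0 <= M & forall a, cabs a <= t -> F a <= M.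
Proof.
have [|a at_|d d0 hd] := @plane_uniform R t (fun b d => F b <= d^-1).
- move=> b d d' d'0 dd' h; apply: le_trans h _.
  by rewrite lef_pV2 ?posrE//; exact: lt_le_trans dd'.
- have [d d0 hd] := cF (disc_t at_) ltr01.
  have Fa := F0 (disc_t at_).
  have F2 : 0 < F a + 1 by lra.
  exists (Num.min d (F a + 1)^-1); first by rewrite lt_min d0 invr_gt0.
  move=> b; rewrite lt_min => /andP[/hd h _].
  apply: (@le_trans _ _ (F a + 1)).
    by have := ler_norm (F b - F a); lra.
  rewrite -[leLHS]invrK lef_pV2 ?posrE ?invr_gt0// ?lt_min ?d0 ?invr_gt0//.
  by rewrite ge_min lexx orbT.
- by exists d^-1 => //; rewrite invr_ge0 ltW.
Qed.

Let measurable_f x : cabs x <= 1 -> measurable_fun D (f x).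
Proof.
move=> x1; apply: measurable_funM; last by exact: measurable_weight_annulus hw _ _ (ltW t1).
apply: measurable_funS (_ : measurable_fun (@of_xy R @^-1` (@disc R) : set (measurableTypeR R * measurableTypeR R)) _).
- exact: measurable_disc.
- by move=> p /D_disc.
apply: (@measurable_cont_plane _ (@disc R) (fun y => F (x * y))); first exact: open_disc.
move=> a Da e e0; have Dxa : disc (x * a).
  by rewrite /disc /= cabsM; apply: le_lt_trans Da; rewrite ler_piMl// cabs_ge0.
have [d d0 hd] := cF Dxa e0; exists d => // y ya; apply: hd.
by rewrite -mulrBr cabsM; apply: le_lt_trans ya; rewrite ler_piMl// cabs_ge0.
Qed.

Let w_int : leb2.-integrable D (fun p => (w (of_xy p))%:E).
Proof.
have [[_ wi] _ _] := hw; apply: integrableS wi => //; first exact: measurable_disc.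
Qed.

Let f_int x : cabs x <= 1 -> leb2.-integrable D (EFin \o f x).
Proof.
move=> x1; have [M M0 hM] := bounded_cont_plane.
apply: (le_integrable mD _ _ (integrableZl mD M w_int)).
- by apply/measurable_EFinP; exact: measurable_f.
- move=> p Dp; have wp : 0 < w (of_xy p) by exact/(weight_gt0 hw)/D_disc.
  have xp := disc_mul x1 Dp.
  rewrite /= lee_fin /f normrM (gtr0_norm wp) normrM (gtr0_norm wp) ler_wpM2r ?(ltW wp)//.
  by rewrite (ger0_norm M0) ger0_norm; [apply: hM|apply: F0; apply: disc_t]; exact: ltW.
Qed.

(** Rotating the plane changes neither area nor a radial weight, so U is radial. *)
Let U_radial x : cabs x <= 1 -> U x = U (cabs x)%:C%C.
Proof.
move=> x1; have [->|xn] := eqVneq x 0; first by rewrite cabs0.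
have cx : 0 < cabs x by rewrite cabs_gt0.
have [[c s] E cs] : exists2 cs : R * R, x = (cabs x)%:C%C * of_xy cs :> C & cs.1 ^+ 2 + cs.2 ^+ 2 = 1.
  exists (complex.Re x / cabs x, complex.Im x / cabs x).
    case: (x) cx => p q cx; rewrite /of_xy /=; apply/eqP; rewrite eq_complex /=.
    by apply/andP; split; apply/eqP; rewrite mul0r ?subr0 ?addr0; field; rewrite lt0r_neq0.
  by rewrite /= !exprMn -mulrDl -sqr_cabs -exprMn divff ?expr1n// lt0r_neq0.
rewrite /U /Rintegral; congr fine.
have cx1 : cabs ((cabs x)%:C%C : C) <= 1 by rewrite cabsR ger0_norm ?cabs_ge0.
pose G := (EFin \o f (cabs x)%:C%C) \_ D.
have mG : measurable_fun setT G.
  by apply/(measurable_restrictT _ mD)/measurable_EFinP; exact: measurable_f.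
have G0 p : (0 <= G p)%E.
  rewrite /G patchE; case: ifPn => //; rewrite inE => Dp.
  rewrite lee_fin mulr_ge0//; last exact/ltW/(weight_gt0 hw)/D_disc.
  by apply: F0; apply: disc_t; exact/ltW/disc_mul.
rewrite [RHS]integral_mkcond -/G -(ge0_integral_rotation cs mG G0).
rewrite integral_mkcond; apply: eq_integral => p _ /=.
pose q : R * R := (c * p.1 - s * p.2, s * p.1 + c * p.2).
have rot : of_xy q = of_xy (c, s) * of_xy p.
  by rewrite /of_xy; apply/eqP; rewrite eq_complex /= eqxx /= addrC.
have cab : cabs (of_xy q) = cabs (of_xy p).
  by rewrite rot cabsM {1}cabs_of_xy cs sqrtr1 mul1r.
rewrite -/q /G !patchE.
have -> : (q \in D) = (p \in D).
  by apply/idP/idP; rewrite !inE /D /annulus /mkset cab.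
case: ifPn => //; rewrite inE => Dp; congr (_%:E); rewrite /f.
rewrite {1}E -mulrA -rot; congr (_ * _).
have [_ rw _] := hw; rewrite rw; last exact: D_disc.
rewrite [RHS]rw ?cab//; rewrite /disc /mkset cab; exact: D_disc.
Qed.

Let W : R := \int[leb2]_(p in D) w (of_xy p).

Let W0 : 0 <= W.
Proof. by apply: Rintegral_ge0 => p /D_disc/(weight_gt0 hw)/ltW. Qed.

Let U_cont x e : cabs x <= 1 -> 0 < e -> exists2 d : R, 0 < d &
  forall y, cabs y <= 1 -> cabs (y - x) < d -> `|U y - U x| < e.
Proof.
move=> x1 e0; pose e1 := e / (W + 1) / 2.
have e10 : 0 < e1 by rewrite !divr_gt0//; have := W0; lra.
have [|a at_|d d0 hd] := @plane_uniform R t (fun b d => forall z, cabs z < d -> `|F (b + z) - F b| <= e1).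
- by move=> b d d' d'0 dd' h z zd; apply: h; exact: lt_le_trans dd'.
- have e20 : 0 < e1 / 2 by rewrite divr_gt0.
  have [d d0 hd] := cF (disc_t at_) e20.
  exists (d / 2); first by rewrite divr_gt0.
  move=> b ba z zd.
  have h1 : `|F b - F a| < e1 / 2 by apply: hd; lra.
  have h2 : `|F (b + z) - F a| < e1 / 2.
    by apply: hd; rewrite addrAC; apply: le_lt_trans (cabsD _ _) _; lra.
  rewrite (_ : _ - _ = (F (b + z) - F a) - (F b - F a)); last by ring.
  apply: le_trans (ler_normB _ _) _; lra.
exists d => // y y1 yx.
rewrite /U -RintegralB//; [|exact: f_int..].
apply: le_lt_trans (le_normr_Rintegral _ _) _ => //.
  exact: (integrableB mD (f_int y1) (f_int x1)).
apply: (@le_lt_trans _ _ (e1 * W)).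
  rewrite /W -RintegralZl//.
  apply: le_Rintegral => //.
  - exact/integrable_norm/(integrableB mD (f_int y1) (f_int x1)).
  - exact: (integrableZl mD e1 w_int).
  - move=> p Dp; have wp : 0 < w (of_xy p) by exact/(weight_gt0 hw)/D_disc.
    rewrite /f -mulrBl normrM (gtr0_norm wp) ler_wpM2r ?(ltW wp)//.
    have -> : y * of_xy p = x * of_xy p + (y - x) * of_xy p by ring.
    apply: hd; first exact/ltW/disc_mul.
    rewrite cabsM; apply: le_lt_trans yx; rewrite ler_piMr ?cabs_ge0//.
    exact/ltW/D_disc.
have W1 : W + 1 != 0 by rewrite lt0r_neq0//; have := W0; lra.
have : e1 * W + e1 = e / 2 by rewrite /e1; field.
by move: (e1 * W) => X; lra.
Qed.

Let U_submean : exists d K : R, [/\ 0 < d, 0 <= K & forall s p : R,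
  0 <= s -> 0 < p < d -> s + p <= 1 ->
  U s%:C%C - K * p ^+ 3 <= (U (s%:C%C + p%:C%C) + U (s%:C%C - p%:C%C) +
    U (s%:C%C + iC R * p%:C%C) + U (s%:C%C - iC R * p%:C%C)) / 4].
Proof.
have [|a at_|d d0 hd] := @plane_uniform R t
  (fun b d => forall z, cabs z < d -> F b - d^-1 * cabs z ^+ 3 <= avg4 F b z).
- move=> b d d' d'0 dd' h z zd; apply: le_trans (h _ (lt_le_trans zd dd')).
  rewrite lerD2l lerN2 ler_wpM2r ?exprn_ge0 ?cabs_ge0//.
  by rewrite lef_pV2 ?posrE//; exact: lt_le_trans dd'.
- have [d [K [d0 K0 hd]]] := sF (disc_t at_).
  have K1 : 0 < K + 1 by lra.
  exists (Num.min d (K + 1)^-1); first by rewrite lt_min d0 invr_gt0.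
  move=> b; rewrite lt_min => /andP[bd _] z; rewrite lt_min => /andP[zd _].
  apply: le_trans (hd b z bd zd); rewrite lerD2l lerN2.
  rewrite ler_wpM2r ?exprn_ge0 ?cabs_ge0//; apply: (@le_trans _ _ (K + 1)); first lra.
  rewrite -[leLHS]invrK lef_pV2 ?posrE ?invr_gt0// ?lt_min ?d0 ?invr_gt0//.
  by rewrite ge_min lexx orbT.
exists d, (d^-1 * W); split => //; first by rewrite mulr_ge0// invr_ge0 ltW.
move=> s p s0 /andP[p0 pd] sp.
have cs : cabs (s%:C%C : C) = s by rewrite cabsR ger0_norm.
have cp : cabs (p%:C%C : C) = p by rewrite cabsR gtr0_norm.
have ip : cabs (iC R * p%:C%C) = p by rewrite cabsM cabs_iC mul1r cp.
have x0 : cabs (s%:C%C : C) <= 1 by rewrite cs; lra.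
have x1 : cabs (s%:C%C + p%:C%C : C) <= 1 by apply: le_trans (cabsD _ _) _; rewrite cs cp.
have x2 : cabs (s%:C%C - p%:C%C : C) <= 1 by apply: le_trans (cabsB _ _) _; rewrite cs cp.
have x3 : cabs (s%:C%C + iC R * p%:C%C) <= 1 by apply: le_trans (cabsD _ _) _; rewrite cs ip.
have x4 : cabs (s%:C%C - iC R * p%:C%C) <= 1 by apply: le_trans (cabsB _ _) _; rewrite cs ip.
move: x0 x1 x2 x3 x4 (ip).
have E1 z : s%:C%C * z + p%:C%C * z = (s%:C%C + p%:C%C) * z :> C by ring.
have E2 z : s%:C%C * z - p%:C%C * z = (s%:C%C - p%:C%C) * z :> C by ring.
have E3 z : s%:C%C * z + iC R * (p%:C%C * z) = (s%:C%C + iC R * p%:C%C) * z by ring.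
have E4 z : s%:C%C * z - iC R * (p%:C%C * z) = (s%:C%C - iC R * p%:C%C) * z by ring.
move: E1 E2 E3 E4.
move: (s%:C%C + p%:C%C : C) (s%:C%C - p%:C%C : C) (s%:C%C + iC R * p%:C%C) (s%:C%C - iC R * p%:C%C).
move=> y1 y2 y3 y4 E1 E2 E3 E4 x0 x1 x2 x3 x4 _.
have I1 := f_int x1; have I2 := f_int x2; have I3 := f_int x3; have I4 := f_int x4.
have I12 := integrableD mD I1 I2; have I123 := integrableD mD I12 I3.
have I1234 := integrableD mD I123 I4.
have -> : U y1 + U y2 + U y3 + U y4 = \int[leb2]_(z in D) (f y1 z + f y2 z + f y3 z + f y4 z).
  by rewrite /U -(RintegralD mD I1 I2) -(RintegralD mD I12 I3) -(RintegralD mD I123 I4).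
have IW := integrableZl mD (d^-1 * p ^+ 3) w_int.
have -> : U s%:C%C - d^-1 * W * p ^+ 3 =
    \int[leb2]_(z in D) (f s%:C%C z - (d^-1 * p ^+ 3) * w (of_xy z)).
  rewrite (RintegralB mD (f_int x0) IW) RintegralZl//; congr (_ - _).
  by rewrite mulrAC.
rewrite ler_pdivlMr// mulrC -RintegralZl//; last exact: (integrableB mD (f_int x0) IW).
apply: le_Rintegral => //.
  exact: (integrableZl mD 4 (integrableB mD (f_int x0) IW)).
move=> z Dz; have wz : 0 < w (of_xy z) by exact/(weight_gt0 hw)/D_disc.
have z1 : cabs (of_xy z) < 1 by exact: D_disc.
have pz : cabs (p%:C%C * of_xy z) <= p by rewrite cabsM cp ler_piMr// ltW.
have := hd (s%:C%C * of_xy z) (ltW (disc_mul x0 Dz)) _ (le_lt_trans pz pd).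
rewrite /avg4 E1 E2 E3 E4 ler_pdivlMr// => h.
rewrite /f -!mulrDl -mulrBl mulrA ler_wpM2r ?(ltW wz)//.
rewrite mulrC; apply: le_trans h; rewrite ler_wpM2r// lerD2l lerN2.
rewrite ler_wpM2l ?invr_ge0 ?(ltW d0)//.
by rewrite lerXn2r// nnegrE ?cabs_ge0// ltW.
Qed.

(** The mean of an almost submean function over an annulus, with respect to a
    radial weight, dominates its value at the centre: dilate the annulus down to
    the origin and apply the maximum principle to the resulting radial means. *)
Lemma submean_annulus : F 0 * W <= \int[leb2]_(p in D) (F (of_xy p) * w (of_xy p)).
Proof.
have [d [K [d0 K0 hsub]]] := U_submean.
have -> : F 0 * W = U (0 : R)%:C%C.
  rewrite /U /W -RintegralZl//; apply: eq_Rintegral => p _.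
  by rewrite /f mul0r.
have -> : \int[leb2]_(p in D) (F (of_xy p) * w (of_xy p)) = U (1 : R)%:C%C.
  by apply: eq_Rintegral => p _; rewrite /f mul1r.
apply: (@radial_maximum_principle R (fun s => U s%:C%C) K d d0 K0).
- move=> x /andP[x0 x1] e e0.
  have cx : cabs (x%:C%C : C) <= 1 by rewrite cabsR ger0_norm.
  have [c c0 hc] := U_cont cx e0; exists c => // y /andP[y0 y1] yx.
  apply: hc; first by rewrite cabsR ger0_norm.
  have -> : y%:C%C - x%:C%C = (y - x)%:C%C :> C by rewrite raddfB.
  by rewrite cabsR.
- move=> x p x0 pd xp; have := hsub x p x0 pd xp; have /andP[p0 _] := pd.
  have e1 : x%:C%C + p%:C%C = (x + p)%:C%C :> C by rewrite raddfD.
  have e2 : x%:C%C - p%:C%C = (x - p)%:C%C :> C by rewrite raddfB.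
  have h2 : cabs ((x - p)%:C%C : C) = `|x - p| by rewrite cabsR.
  have h3 : cabs (x%:C%C + iC R * p%:C%C) = Num.sqrt (x ^+ 2 + p ^+ 2).
    by rewrite /cabs /= !(mul0r, mul1r, mulr0, subr0, addr0, add0r, subrr).
  have h4 : cabs (x%:C%C - iC R * p%:C%C) = Num.sqrt (x ^+ 2 + p ^+ 2).
    by rewrite /cabs /= !(mul0r, mul1r, mulr0, subr0, addr0, add0r, subrr, sqrrN, oppr0).
  have q1 : Num.sqrt (x ^+ 2 + p ^+ 2) <= 1.
    rewrite -[leRHS]sqrtr1 ler_wsqrtr//.
    have : (x + p) ^+ 2 <= 1 by rewrite expr_le1//; lra.
    have := mulr_ge0 x0 (ltW p0).
    by rewrite sqrrD mulr2n; move: (x * p) (x ^+ 2) (p ^+ 2) => *; lra.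
  rewrite e1 e2 [U (x - p)%:C%C]U_radial ?h2; last by rewrite ler_norml; lra.
  rewrite [U (_ + iC R * _)]U_radial ?h3// [U (_ - iC R * _)]U_radial ?h4//.
  move: (U _) (U _) (U _) (U _) => *; lra.
Qed.

End WeightedMeanInequality.

(** * Log-harmonic functions *)

Section LogHarmonicModulus.
Variable R : realType.
Local Notation C := (cplx R).
Implicit Types (h : C -> R) (a x : C).

(** Nonnegative functions that are continuous at a and whose logarithm is
    harmonic near a unless they vanish there; the moduli of analytic functions
    are the basic examples. *)
Definition log_harmonic h a : Prop :=
  [/\ h x @[x --> a] --> h a, forall x, 0 <= h x &
      0 < h a -> mean4 (fun x => ln (h x)) a].

Lemma cvg_plane h a (l : R) : h x @[x --> a] --> l <->
  forall e : R, 0 < e -> exists2 d : R, 0 < d &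
    forall x, cabs (x - a) < d -> `|h x - l| < e.
Proof.
split=> [hl e e0|H P /nbhs_ballP[e /= e0 he]].
  have /hl/nbhs_cplx[d d0 hd] : nbhs l (ball l e) by exact: nbhsx_ballx.
  by exists d => // x /hd; rewrite /ball /= distrC.
apply/nbhs_cplx; have [d d0 hd] := H e e0; exists d => // x /hd hx.
by apply: he; rewrite /ball /= distrC.
Qed.

Lemma cvg_near_gt h a : h x @[x --> a] --> h a -> forall r : R, r < h a ->
  exists2 d : R, 0 < d & forall x, cabs (x - a) < d -> r < h x.
Proof. by move=> ch r rh; apply/nbhs_cplx; exact: (cvgr_gt _ ch). Qed.

Lemma cvg_near_lt h a : h x @[x --> a] --> h a -> forall r : R, h a < r ->
  exists2 d : R, 0 < d & forall x, cabs (x - a) < d -> h x < r.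
Proof. by move=> ch r rh; apply/nbhs_cplx; exact: (cvgr_lt _ ch). Qed.

Lemma log_harmonicM h1 h2 a : log_harmonic h1 a -> log_harmonic h2 a ->
  log_harmonic (fun x => h1 x * h2 x) a.
Proof.
move=> [c1 p1 m1] [c2 p2 m2]; split; first exact: (cvgM c1 c2).
  by move=> x; rewrite mulr_ge0.
move=> h0; have h10 : 0 < h1 a.
  by rewrite lt_def p1 andbT; apply: contraTneq h0 => ->; rewrite mul0r ltxx.
have h20 : 0 < h2 a by move: h0; rewrite pmulr_rgt0.
apply: mean4_near (mean4D (m1 h10) (m2 h20)).
have [d d0 hd] := cvg_near_gt c1 h10; have [e e0 he] := cvg_near_gt c2 h20.
exists (Num.min d e); first by rewrite lt_min d0.
by move=> x; rewrite lt_min => /andP[/hd ? /he ?]; rewrite lnM.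
Qed.

Lemma log_harmonicV h a : log_harmonic h a -> 0 < h a ->
  log_harmonic (fun x => (h x)^-1) a.
Proof.
move=> [c p m] h0; split; first exact: (cvgV (lt0r_neq0 h0) c).
  by move=> x; rewrite invr_ge0.
move=> _; apply: mean4_near (mean4N (m h0)).
have [d d0 hd] := cvg_near_gt c h0; exists d => // x /hd ?; by rewrite lnV.
Qed.

Lemma log_harmonic_cst (r : R) a : 0 <= r -> log_harmonic (fun=> r) a.
Proof.
move=> r0; split; [|by []|by move=> _; exact: mean4_cst].
by have h := @cvg_cst _ r _ (nbhs a) _; apply: h.
Qed.

Lemma log_harmonic_near h1 h2 a : (forall x, 0 <= h2 x) ->
  (exists2 d : R, 0 < d & forall x, cabs (x - a) < d -> h1 x = h2 x) ->
  log_harmonic h1 a -> log_harmonic h2 a.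
Proof.
move=> h20 [d d0 hd] [c p m].
have E : h1 a = h2 a by apply: hd; rewrite subrr cabs0.
have N : {near a, h1 =1 h2} by apply/nbhs_cplx; exists d.
split => //.
  by rewrite -E; exact: cvg_trans (near_eq_cvg N) c.
rewrite -E => h10; apply: mean4_near (m h10).
by exists d => // x /hd ->.
Qed.

Lemma log_harmonic_prod (I : Type) (s : seq I) (P : pred I) (F : I -> C -> R) a :
  (forall i, P i -> log_harmonic (F i) a) ->
  log_harmonic (fun x => \prod_(i <- s | P i) F i x) a.
Proof.
move=> hF; elim: s => [|i s ih].
  rewrite (_ : (fun x => _) = fun=> 1); first exact: log_harmonic_cst.
  by apply/funext => x; rewrite big_nil.
rewrite (_ : (fun x => _) = fun x => (if P i then F i x else 1) * \prod_(i <- s | P i) F i x); last first.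
  by apply/funext => x; rewrite big_cons; case: ifP => // _; rewrite mul1r.
apply: log_harmonicM => //.
by have := hF i; case: (P i) => [|_]; [exact|exact: log_harmonic_cst].
Qed.

Lemma analytic_cvg (f : C -> C) a : analytic_at f a ->
  cabs (f x) @[x --> a] --> cabs (f a).
Proof.
move=> /analytic_atP[c [s [M e]]]; have [s0 cM _] := e.
have M0 : 0 <= M by have := cM 0%N; rewrite expr0 mulr1; apply: le_trans; exact: cabs_ge0.
apply/cvg_plane => eps eps0.
have K0 : 0 < 2 * M / s + 1 by rewrite ltr_wpDl// divr_ge0 ?mulr_ge0// ltW.
exists (Num.min (s / 2) (eps / (2 * M / s + 1))).
  by rewrite lt_min !divr_gt0.
move=> x; rewrite lt_min => /andP[/ltW x1 x2].
have := expands_lip e x1; rewrite subrKC => h.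
have h2 : cabs (f x - f a) < eps.
  apply: le_lt_trans h _; rewrite ltr_pdivlMr// in x2; apply: le_lt_trans x2.
  by rewrite mulrC ler_wpM2l ?cabs_ge0// lerDl.
apply: le_lt_trans h2; rewrite ler_norml.
have := cabs_triB (f x) (f a); have := cabs_triB (f a) (f x).
by rewrite [cabs (f a - f x)]cabs_distC; lra.
Qed.

Lemma log_harmonic_analytic (f : C -> C) a : analytic_at f a ->
  log_harmonic (fun x => cabs (f x)) a.
Proof.
move=> fa; split; [exact: analytic_cvg|by move=> x; exact: cabs_ge0|].
by rewrite cabs_gt0 => f0; exact: mean4_ln_cabs.
Qed.

Lemma analytic_at_linear (u v : C) a : analytic_at (fun x => u * x + v) a.
Proof.
pose c (k : nat) : C := if k is 0%N then u * a + v else if k is 1%N then u else 0.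
apply/analytic_atP; exists c, 1, (cabs (u * a + v) + cabs u); split => //.
  move=> k; rewrite expr1n mulr1; case: k => [|[|k]]; rewrite /c.
  - by rewrite lerDl cabs_ge0.
  - by rewrite lerDr cabs_ge0.
  - by rewrite cabs0 addr_ge0 ?cabs_ge0.
move=> x _; apply/cvg_cplx => e e0; exists 2%N => -[|[|n]] // _.
have E : psum c x n.+2 = u * (a + x) + v.
  rewrite /psum 2!big_ord_recl /= expr0 big1; last by move=> i _; rewrite mul0r.
  by rewrite /bump /= expr1; ring.
by rewrite E subrr cabs0.
Qed.

Lemma le_powR (q x y : R) : 0 <= q -> 0 <= x -> x <= y -> x `^ q <= y `^ q.
Proof.
by move=> q0 x0 xy; apply: ge0_ler_powR => //; rewrite nnegrE// (le_trans x0).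
Qed.

(** A power of a log-harmonic function is subharmonic. Flattening it from below
    at a positive level disposes of the zeros, near which the error term in
    the four-point mean cannot be controlled. *)
Lemma submean_powR h a (q eta : R) : 0 < q -> 0 < eta -> log_harmonic h a ->
  almost_submean (fun x => (Num.max (h x) eta) `^ q) a.
Proof.
move=> q0 eta0 [ch hp hm].
have low x : eta `^ q <= (Num.max (h x) eta) `^ q.
  by apply: le_powR; [exact: ltW|exact: ltW|rewrite le_max lexx orbT].
have avg_low b z (A : R) : (forall x, A <= (Num.max (h x) eta) `^ q) ->
    A <= avg4 (fun x => (Num.max (h x) eta) `^ q) b z.
  move=> hA; rewrite /avg4 ler_pdivlMr//.
  by have := hA (b + z); have := hA (b - z); have := hA (b + iC R * z); have := hA (b - iC R * z); lra.
have flat b z K : 0 <= K -> h b <= eta ->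
    (Num.max (h b) eta) `^ q - K * cabs z ^+ 3 <= avg4 (fun x => (Num.max (h x) eta) `^ q) b z.
  move=> K0 hb; rewrite max_r//; apply: le_trans (avg_low b z _ low).
  by rewrite gerBl mulr_ge0// exprn_ge0// cabs_ge0.
have [ha|ha] := leP eta (h a); last first.
  have [d d0 hd] := cvg_near_lt ch ha.
  by exists d, 0; split => // b z bd _; apply: flat => //; exact/ltW/hd.
have ha0 : 0 < h a by exact: lt_le_trans ha.
have [d [K [d0 K0 hd]]] := hm ha0.
have [e e0 he] := cvg_near_gt ch ha0.
have ha1 : h a < h a + 1 by rewrite ltrDl.
have [e' e'0 he'] := cvg_near_lt ch ha1.
pose B := (h a + 1) `^ q.
have B0 : 0 <= B by exact: powR_ge0.
exists (Num.min d (Num.min (e / 2) e')), (B * q * K); split.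
- by rewrite !lt_min d0 divr_gt0.
- by rewrite !mulr_ge0// ltW.
move=> b z; rewrite !lt_min => /andP[bd /andP[be be']] /andP[zd /andP[ze _]].
have /orP[hb|hb] := le_total (h b) eta.
  by apply: flat => //; rewrite !mulr_ge0// ltW.
have hb0 : 0 < h b by exact: lt_le_trans hb.
rewrite (max_l hb).
have pos y : cabs y <= cabs z -> 0 < h (b + y).
  by move=> yz; apply: he; rewrite addrAC; apply: le_lt_trans (cabsD _ _) _; lra.
have step y : cabs y <= cabs z ->
    h b `^ q * (1 + q * (ln (h (b + y)) - ln (h b))) <= (Num.max (h (b + y)) eta) `^ q.
  move=> /pos hy; apply: (@le_trans _ _ (h (b + y) `^ q)); last first.
    by apply: le_powR; [exact: ltW|exact: ltW|rewrite le_max lexx].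
  have -> : h (b + y) `^ q = h b `^ q * expR (q * (ln (h (b + y)) - ln (h b))).
    rewrite /powR !gt_eqF// -expRD; congr expR; ring.
  by rewrite ler_wpM2l ?powR_ge0// expR_ge1Dx.
have iz : cabs (iC R * z) = cabs z by rewrite cabsM cabs_iC mul1r.
have s1 := step z (lexx _).
have s2 := step (- z); rewrite cabsN in s2; have {}s2 := s2 (lexx _).
have s3 := step (iC R * z); rewrite iz in s3; have {}s3 := s3 (lexx _).
have s4 := step (- (iC R * z)); rewrite cabsN iz in s4; have {}s4 := s4 (lexx _).
apply: (@le_trans _ _ (h b `^ q * (1 + q * (avg4 (fun x => ln (h x)) b z - ln (h b))))); last first.
  rewrite /avg4 [leRHS]mulrC -ler_pdivrMl ?invr_gt0// invrK.
  apply: le_trans (lerD (lerD (lerD s1 s2) s3) s4).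
  by rewrite le_eqVlt; apply/orP; left; apply/eqP; field.
have hBb : h b `^ q <= B.
  by apply: le_powR; [exact: ltW|exact: ltW|exact/ltW/he'].
have := hd b z bd zd; rewrite ler_norml => /andP[lo _].
have z3 : 0 <= cabs z ^+ 3 by rewrite exprn_ge0// cabs_ge0.
have Kz : 0 <= q * (K * cabs z ^+ 3).
  by apply: mulr_ge0; [exact: ltW|exact: mulr_ge0].
rewrite mulrDr mulr1 lerD2l -mulrN.
apply: (@le_trans _ _ (h b `^ q * (q * - (K * cabs z ^+ 3)))).
  rewrite mulrN [leRHS](_ : _ = - (h b `^ q * (q * (K * cabs z ^+ 3)))); last by ring.
  rewrite lerN2 [leRHS](_ : _ = B * (q * (K * cabs z ^+ 3))); last by ring.
  by rewrite ler_wpM2r.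
by rewrite ler_wpM2l ?powR_ge0// ler_wpM2l// ltW.
Qed.

Lemma cont_powR h a (q eta : R) : 0 < eta -> h x @[x --> a] --> h a ->
  (Num.max (h x) eta) `^ q @[x --> a] --> (Num.max (h a) eta) `^ q.
Proof.
move=> eta0 ch.
have m0 : 0 < Num.max (h a) eta by rewrite lt_max eta0 orbT.
have cm : Num.max (h x) eta @[x --> a] --> Num.max (h a) eta.
  apply/cvg_plane => e e0; have [d d0 hd] := (cvg_plane _ _ _).1 ch _ e0.
  exists d => // x /hd; apply: le_lt_trans.
  have := ler_norm (h x - h a); have := ler_norm (- (h x - h a)); rewrite normrN.
  by case: (leP (h x) eta) => ?; case: (leP (h a) eta) => ?; rewrite ler_norml; lra.
apply: (@cvg_comp _ _ _ (fun x => Num.max (h x) eta) (fun y => y `^ q) _ _ _ cm).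
have c : {for Num.max (h a) eta, continuous (fun y : R => y `^ q)}.
  apply: differentiable_continuous; apply/derivable1_diffP.
  by apply: derivable_powR; rewrite in_itv /= m0.
exact: c.
Qed.

End LogHarmonicModulus.

(** * Division by Blaschke factors *)

Section DividingOutZeros.
Variable R : realType.
Local Notation C := (cplx R).
Implicit Types (a c x : C) (g : C -> C) (s : seq C).

(** The modulus of the denominator of the Blaschke factor
    [r * (x - c) / (r ^+ 2 - c^* * x)] of the disc of radius [r]. *)
Definition reflected (r : R) c x : R :=
  cabs ((r ^+ 2)%:C%C - (complex.Re c -i* complex.Im c)%C * x : C).

(** The Blaschke factor of the disc of radius r has modulus one on its boundary
    circle and at least one outside it. *)
Lemma reflected_le (r : R) c x : 0 < r -> cabs c <= r -> r <= cabs x ->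
  reflected r c x <= r * cabs (x - c).
Proof.
move=> r0 cr rx.
have l0 : 0 <= reflected r c x by exact: cabs_ge0.
have m0 : 0 <= r * cabs (x - c) by rewrite mulr_ge0 ?cabs_ge0// ltW.
rewrite -(@ler_pXn2r _ 2)// exprMn /reflected !sqr_cabs -subr_ge0.
have h1 : 0 <= cabs x ^+ 2 - r ^+ 2.
  by rewrite subr_ge0 lerXn2r// nnegrE ?cabs_ge0// ltW.
have h2 : 0 <= r ^+ 2 - cabs c ^+ 2.
  by rewrite subr_ge0 lerXn2r// nnegrE ?cabs_ge0// ltW.
have := mulr_ge0 h1 h2; rewrite !sqr_cabs.
case: (c) (x) => c1 c2 [x1 x2] /=.
by move=> h; apply: (le_trans h); rewrite le_eqVlt; apply/orP; left; apply/eqP; ring.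
Qed.

Lemma reflected0 (r : R) c : reflected r c 0 = r ^+ 2.
Proof. by rewrite /reflected mulr0 subr0 cabsR ger0_norm ?sqr_ge0. Qed.

Lemma log_harmonic_reflected (r : R) c a : log_harmonic (reflected r c) a.
Proof.
have := log_harmonic_analytic (analytic_at_linear (- (complex.Re c -i* complex.Im c)%C) (r ^+ 2)%:C%C a).
by congr log_harmonic; apply/funext => x; rewrite /reflected addrC mulNr.
Qed.

Lemma log_harmonic_dist c a : log_harmonic (fun x => cabs (x - c)) a.
Proof.
have := log_harmonic_analytic (analytic_at_linear 1 (- c) a).
by congr log_harmonic; apply/funext => x; rewrite mul1r.
Qed.

Lemma log_harmonicX (h : C -> R) n a : log_harmonic h a -> log_harmonic (fun x => h x ^+ n) a.
Proof.
move=> hh; elim: n => [|n ih].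
  rewrite (_ : (fun x => _) = fun=> 1); first exact: log_harmonic_cst.
  by apply/funext => x; rewrite expr0.
rewrite (_ : (fun x => _) = fun x => h x * h x ^+ n); first exact: log_harmonicM.
by apply/funext => x; rewrite exprS.
Qed.

Lemma prod_dist_split s a x :
  \prod_(c <- s) cabs (x - c) =
  cabs (x - a) ^+ count_mem a s * \prod_(c <- s | c != a) cabs (x - c).
Proof.
rewrite (bigID (pred1 a)) /=; congr (_ * _).
rewrite (eq_bigr (fun=> cabs (x - a))) => [|c /eqP -> //].
by rewrite big_const_seq iter_mulr_1.
Qed.

(** Dividing g by the Blaschke factors of some of its zeros in the disc of radius
    r gives a function whose modulus is log-harmonic; compared with that of g it is
    at least as large at the origin and no larger outside the disc of radius r. *)
Lemma divide_out_zeros g (r : R) s : 0 < r -> r < 1 ->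
  (forall c, c \in s -> c != 0 /\ cabs c < r) ->
  (forall a, disc a -> exists2 m, zero_order g a m & (count_mem a s <= m)%N) ->
  exists H : C -> R, [/\ forall a, disc a -> log_harmonic H a,
    H 0 = cabs (g 0) * \prod_(c <- s) (r / cabs c) &
    forall x, r <= cabs x -> H x <= cabs (g x)].
Proof.
move=> r0 r1 hs hg.
have /choice[md hmd] : forall a, exists md : nat * (C -> C), disc a ->
    [/\ analytic_at md.2 a, md.2 a != 0, (count_mem a s <= md.1)%N &
        exists2 d : R, 0 < d & forall x, cabs (x - a) < d -> g x = (x - a) ^+ md.1 * md.2 x].
  move=> a; have [Da|nDa] := pselect (disc a); last by exists (0%N, fun=> 0).
  have [m [g1 [ag1 g1n /nbhs_cplx[d d0 hd]]] cm] := hg _ Da.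
  by exists (m, g1) => _; split => //; exists d.
pose N x := \prod_(c <- s) (reflected r c x / r).
pose P a x := \prod_(c <- s | c != a) cabs (x - c).
pose H x := if x \in s then cabs (x - x) ^+ ((md x).1 - count_mem x s) * cabs ((md x).2 x) * N x / P x x
  else cabs (g x) * N x / \prod_(c <- s) cabs (x - c).
have N0 x : 0 <= N x by apply: prodr_ge0 => c _; rewrite divr_ge0 ?cabs_ge0// ltW.
have P0 a x : 0 <= P a x by apply: prodr_ge0 => c _; exact: cabs_ge0.
have H0 x : 0 <= H x.
  rewrite /H; case: ifP => _; rewrite !mulr_ge0 ?invr_ge0 ?cabs_ge0 ?exprn_ge0 ?cabs_ge0 ?P0//.
  by apply: prodr_ge0 => c _; exact: cabs_ge0.
have notin x : r <= cabs x -> x \notin s.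
  by move=> rx; apply/negP => /hs[_]; rewrite ltNge rx.
have zn : 0 \notin s by apply/negP => /hs[]; rewrite eqxx.
exists H; split; last first.
- move=> x rx; rewrite /H (negbTE (notin _ rx)) -mulrA ler_piMr ?cabs_ge0//.
  rewrite /N -prodf_div; rewrite big_seq; apply: prodr_ile1 => c /hs[_ cr].
  have xc : 0 < cabs (x - c).
    by rewrite cabs_gt0 subr_eq0; apply/eqP => xc; move: rx; rewrite xc leNgt cr.
  rewrite !mulr_ge0 ?invr_ge0 ?cabs_ge0 ?(ltW r0)//=.
  rewrite -mulrA -invfM ler_pdivrMr ?mulr_gt0// mul1r.
  by apply: reflected_le => //; exact: ltW.
- rewrite /H (negbTE zn) -mulrA; congr (_ * _).
  rewrite /N -prodf_div; apply: eq_big_seq => c /hs[c0 _].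
  by rewrite reflected0 sub0r cabsN; field; rewrite !lt0r_neq0// cabs_gt0.
move=> a Da; have [an an0 cm [d d0 hd]] := hmd _ Da.
set k := ((md a).1 - count_mem a s)%N.
pose phi x := cabs (x - a) ^+ k * cabs ((md a).2 x) * N x / P a x.
have Paa : 0 < P a a.
  by apply: prodr_gt0 => c ca; rewrite cabs_gt0 subr_eq0 eq_sym.
have lP : log_harmonic (P a) a by apply: log_harmonic_prod => c _; exact: log_harmonic_dist.
have lphi : log_harmonic phi a.
  apply: log_harmonicM; last exact: log_harmonicV.
  apply: log_harmonicM; first apply: log_harmonicM.
  - by apply: log_harmonicX; exact: log_harmonic_dist.
  - exact: log_harmonic_analytic.
  - apply: log_harmonic_prod => c _; apply: log_harmonicM; first exact: log_harmonic_reflected.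
    by apply: log_harmonic_cst; rewrite invr_ge0 ltW.
apply: log_harmonic_near lphi => //.
have [cP _ _] := lP; have [e e0 he] := cvg_near_gt cP Paa.
exists (Num.min d e); first by rewrite lt_min d0.
move=> x; rewrite lt_min => /andP[/hd gx /he Px]; rewrite /H /phi.
have [xs|xs] := boolP (x \in s).
  have -> : x = a.
    apply/eqP; rewrite -[_ == _]negbK; apply/negP => xa.
    move: Px; rewrite /P (big_rem x)//= xa subrr cabs0 mul0r ltxx//.
  by [].
rewrite (prod_dist_split s a) -/(P a x) gx cabsM cabsX.
have [xa|xa] := eqVneq x a.
  have -> : count_mem a s = 0%N by apply/count_memPn; rewrite -xa.
  by rewrite /k (_ : count_mem a s = 0%N) ?subn0 ?expr0 ?mul1r//; apply/count_memPn; rewrite -xa.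
have dx : cabs (x - a) != 0 by rewrite cabs_eq0 subr_eq0.
rewrite -(subnK cm) -/k exprD; field.
by rewrite (lt0r_neq0 Px) expf_neq0.
Qed.

End DividingOutZeros.

(** * Products of zeros and integral means *)

Section ZerosOfBergmanFunctions.
Variable R : realType.
Local Notation C := (cplx R).
Local Notation leb2 := (@lebesgue_measure R \x @lebesgue_measure R)%E.
Variables (w : C -> R) (q : R).
Hypotheses (hw : continuous_radial_weight w) (q0 : 0 < q).
Implicit Types (g : C -> C).

Lemma analytic_cont_powR g : analytic_in_disc g ->
  cont_plane (@disc R) (fun x => cabs (g x) `^ q).
Proof.
move=> ag a Da e e0.
have ca := (cvg_plane _ _ _).1 (analytic_cvg (ag _ Da)).
have [g0|g0] := eqVneq (cabs (g a)) 0.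
  have d0 : 0 < e `^ q^-1 by exact: powR_gt0.
  have [d d1 hd] := ca _ d0; exists d => // x /hd.
  rewrite g0 subr0 ger0_norm ?cabs_ge0// powR0 ?lt0r_neq0// subr0 => h.
  rewrite ger0_norm ?powR_ge0//.
  have -> : e = (e `^ q^-1) `^ q by rewrite -powRrM mulVf ?lt0r_neq0// powRr1// ltW.
  by apply: gt0_ltr_powR => //; rewrite nnegrE ?cabs_ge0// powR_ge0.
have gp : 0 < cabs (g a) by rewrite lt_def g0 cabs_ge0.
have g2 : 0 < cabs (g a) / 2 by rewrite divr_gt0.
have := @cont_powR _ _ _ q _ g2 (analytic_cvg (ag _ Da)).
move=> /cvg_plane/(_ e e0)[d d0 hd].
have [d' d'0 hd'] := ca _ g2.
exists (Num.min d d'); first by rewrite lt_min d0.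
move=> x; rewrite lt_min => /andP[/hd h1 /hd'].
by rewrite ltr_norml => /andP[h _]; move: h1; rewrite !max_l//; lra.
Qed.

Lemma bergman_integrable g : bergman q w g ->
  leb2.-integrable (@of_xy R @^-1` (@disc R) : set (measurableTypeR R * measurableTypeR R))
    (fun p => (cabs (g (of_xy p)) `^ q * w (of_xy p))%:E).
Proof.
move=> [ag fin]; apply/integrableP; split.
  apply/measurable_EFinP; apply: measurable_funM.
    exact: measurable_cont_plane (@open_disc R) (analytic_cont_powR ag).
  exact: measurable_cont_plane (@open_disc R) (weight_cont hw).
have pos p : (@of_xy R @^-1` (@disc R)) p -> (0 <= (cabs (g (of_xy p)) `^ q * w (of_xy p))%:E)%E.
  by move=> Dp; rewrite lee_fin mulr_ge0 ?powR_ge0// ltW// (weight_gt0 hw).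
under eq_integral => p /[!inE] /pos pp do rewrite gee0_abs//.
rewrite ltey; apply/eqP => Iy; move: fin; rewrite /disc_integral Iy.
by rewrite gt0_muley ?lte_fin ?invr_gt0 ?pi_gt0.
Qed.

(** A substitute for Jensen's formula: the quotient of [g] by the Blaschke factors at
    [s] has a submean power, and its integral over the ring is at most that of [g].  Raising
    the quotient to a positive level [eta] costs half of the value at the origin. *)
Lemma zeros_mean_bound : exists2 k : R, 0 < k &
  forall g (r t : R) (s : seq C), bergman q w g -> g 0 != 0 ->
  0 < r -> r < t -> t < 1 ->
  (forall c, c \in s -> c != 0 /\ cabs c < r) ->
  (forall a, disc a -> exists2 m, zero_order g a m & (count_mem a s <= m)%N) ->
  (((cabs (g 0) * \prod_(c <- s) (r / cabs c)) `^ q * (k * r * (tail w r - tail w t)))%:E <=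
   \int[leb2]_(p in annulus r 1) (cabs (g (of_xy p)) `^ q * w (of_xy p))%:E)%E.
Proof.
have [k k0 hk] := mass_bounds hw; exists (k / 2); first by rewrite divr_gt0.
move=> g r t s bg g0 r0 rt t1 hs hz.
have r1 : r < 1 by exact: lt_trans t1.
have [ag _] := bg; have ig := bergman_integrable bg.
have [H [lH H0 Hg]] := divide_out_zeros r0 r1 hs hz.
set A := cabs (g 0) * _ in H0 *.
have A0 : 0 < A.
  rewrite mulr_gt0 ?cabs_gt0// big_seq; apply: prodr_gt0 => c /hs[c0 _].
  by rewrite divr_gt0// cabs_gt0.
have half0 : 0 < 2^-1 `^ q^-1 :> R by exact: powR_gt0.
have half1 : 2^-1 `^ q^-1 <= 1 :> R.
  have e1 : 1 `^ q^-1 = 1 :> R by rewrite powR1.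
  by rewrite -[leRHS]e1; apply: le_powR; [rewrite invr_ge0 ltW|lra|lra].
pose eta := A * 2^-1 `^ q^-1.
have eta0 : 0 < eta by rewrite mulr_gt0.
have etaq : eta `^ q = A `^ q / 2.
  by rewrite powRM ?(ltW A0) ?(ltW half0)// -powRrM mulVf ?lt0r_neq0// powRr1.
pose F x := (Num.max (H x) eta) `^ q.
have cF : cont_plane (@disc R) F.
  move=> a Da e e0; have [cH _ _] := lH _ Da.
  exact: (cvg_plane _ _ _).1 (@cont_powR _ _ _ q _ eta0 cH) _ e0.
have F0 a : disc a -> 0 <= F a by move=> _; exact: powR_ge0.
have sF a : disc a -> almost_submean F a by move=> Da; exact: submean_powR (lH _ Da).
have D1 p : annulus r t p -> disc (of_xy p) by move=> /andP[_ /lt_trans]; apply.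
have mD := measurable_annulus r t.
have mdisc := @measurable_disc R.
have wp p : annulus r t p -> 0 < w (of_xy p) by move=> /D1/(weight_gt0 hw).
have := submean_annulus hw r t1 cF F0 sF.
have -> : F 0 = A `^ q.
  by rewrite /F H0 max_l// ger_pMr.
have iw : leb2.-integrable (annulus r t) (fun p => (w (of_xy p))%:E).
  by have [[_ wi] _ _] := hw; apply: integrableS wi.
have igD : leb2.-integrable (annulus r t) (fun p => (cabs (g (of_xy p)) `^ q * w (of_xy p))%:E).
  exact: integrableS ig.
have ie := integrableZl mD (eta `^ q) iw.
have isum := integrableD mD igD ie.
set W := (\int[leb2]_(p in annulus r t) w (of_xy p)) => sub.
have FG p : annulus r t p ->
    F (of_xy p) * w (of_xy p) <= cabs (g (of_xy p)) `^ q * w (of_xy p) + eta `^ q * w (of_xy p).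
  move=> Dp; rewrite -mulrDl ler_wpM2r ?(ltW (wp _ Dp))//.
  have rp : r <= cabs (of_xy p) by case/andP: Dp.
  rewrite /F; case: (leP (H (of_xy p)) eta) => h.
    by rewrite lerDr powR_ge0.
  apply: (@le_trans _ _ (cabs (g (of_xy p)) `^ q)); last by rewrite lerDl powR_ge0.
  by apply: le_powR; rewrite ?(ltW q0)// ?Hg// ltW// (lt_trans eta0).
have iF : leb2.-integrable (annulus r t) (fun p => (F (of_xy p) * w (of_xy p))%:E).
  apply: le_integrable isum => //.
    apply/measurable_EFinP; apply: measurable_funM.
      apply: measurable_funS (measurable_cont_plane (@open_disc R) cF) => //.
    exact: measurable_weight_annulus hw _ _ (ltW t1).
  move=> p Dp; rewrite lee_fin ger0_norm; last first.
    by rewrite mulr_ge0 ?F0 ?(ltW (wp _ Dp))//; exact: D1.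
  by apply: le_trans (FG _ Dp) _; rewrite ler_norm.
have le1 : \int[leb2]_(p in annulus r t) (F (of_xy p) * w (of_xy p)) <=
    \int[leb2]_(p in annulus r t) (cabs (g (of_xy p)) `^ q * w (of_xy p)) + eta `^ q * W.
  rewrite -RintegralZl// -(RintegralD mD igD ie).
  exact: le_Rintegral.
have W1 : k * r * (tail w r - tail w t) <= W.
  have /andP[h _] := hk _ _ (ltW r0) (ltW t1).
  rewrite (tail_split hw r0 (ltW rt) t1) addrK.
  rewrite -lee_fin EFinM (tail_intE hw r0 (ltW t1)); apply: le_trans h _.
  by rewrite /W /Rintegral fineK//; exact: integrable_fin_num iw.
have : A `^ q / 2 * W <= \int[leb2]_(p in annulus r t) (cabs (g (of_xy p)) `^ q * w (of_xy p)).
  by move: (le_trans sub le1); rewrite etaq; clear; move: (A `^ q) => B; lra.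
set I := Rintegral _ _ _ => h.
apply: (@le_trans _ _ I%:E).
  rewrite lee_fin; apply: le_trans h; rewrite [leRHS](_ : _ = A `^ q * (W / 2)); last by ring.
  by apply: ler_wpM2l; [exact: powR_ge0|move: W1; clear; lra].
rewrite /I /Rintegral fineK; last exact: integrable_fin_num igD.
apply: ge0_subset_integral => //.
- exact: measurable_annulus.
- apply: measurable_funS (measurable_int _ ig) => //.
  by move=> p /andP[_].
- move=> p /andP[_ p1]; rewrite lee_fin mulr_ge0 ?powR_ge0// ltW//.
  exact: (weight_gt0 hw).
- by move=> p /andP[h1 h2]; rewrite /annulus /mkset h1 (lt_trans h2).
Qed.

End ZerosOfBergmanFunctions.

(** * A necessary condition on the zeros *)

Section NecessaryCondition.
Variable R : realType.
Local Notation C := (cplx R).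
Local Notation leb2 := (@lebesgue_measure R \x @lebesgue_measure R)%E.

Lemma size_le_card (A : set nat) m (l : seq nat) : (A #= `I_m)%card -> uniq l ->
  (forall k, k \in l -> A k) -> (size l <= m)%N.
Proof.
rewrite card_eq_le => /andP[/pcard_leP/unsquash f _] ul lA.
rewrite -(size_map f) -[leqRHS](size_iota 0); apply: uniq_leq_size.
  rewrite map_inj_in_uniq// => i j /lA Ai /lA Aj; apply: inj; exact: mem_set.
move=> _ /mapP[i /lA Ai ->]; rewrite mem_iota add0n /=.
by have : `I_m (f i) by apply: funS.
Qed.

Lemma zero_sequence_neq0 (g : C -> C) (z : nat -> C) k : zero_sequence g z -> g 0 != 0 -> z k != 0.
Proof.
move=> [_ hz] g0; apply/eqP => zk0.
have D0 : disc (0 : C) by rewrite /disc /mkset cabs0 ltr01.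
have [m [h [_ _ /nbhs_singleton gE]] hc] := hz _ D0.
have m0 : (0 < m)%N.
  by apply: (size_le_card (l := [:: k]) hc) => // i; rewrite inE => /eqP ->.
by move: g0; rewrite gE subrr expr0n eqn0Ngt m0 mul0r eqxx.
Qed.

Lemma expR_le_pow (n : nat) : (2 <= n)%N -> expR (- 2) <= (1 - n%:R^-1) ^+ n :> R.
Proof.
move=> n2; have n0 : (0 : R) < n%:R by rewrite ltr0n; lia.
set x : R := n%:R^-1.
have x0 : 0 <= x by rewrite invr_ge0 ltW.
have x2 : x <= 2^-1 by rewrite lef_pV2 ?posrE// ler_nat.
have h : expR (- (2 * x)) <= 1 - x.
  rewrite expRN -[leRHS]invrK lef_pV2 ?posrE ?expR_gt0 ?invr_gt0; [|lra..].
  apply: le_trans (expR_ge1Dx _); rewrite -[leLHS]mul1r ler_pdivrMr; last lra.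
  by nra.
have -> : - 2 = n%:R * - (2 * x) :> R.
  by rewrite /x mulrN; congr (- _); field; rewrite lt0r_neq0.
by rewrite expRM_natl lerXn2r// nnegrE ?expR_ge0//; lra.
Qed.

Variables (w : C -> R) (q k1 r1 : R).
Hypotheses (hw : continuous_radial_weight w) (q0 : 0 < q) (k10 : 0 < k1).
Hypotheses (r10 : 0 < r1 < 1) (hd : tail_dominates w k1 r1).

(** Take [r = 1 - 1 / n] in the mean value bound.  Zeros beyond the radius [r] only
    contribute factors [r / |z k| <= 1], the powers [r ^+ n] are bounded below, and the
    integral over the shrinking ring tends to 0. *)
Lemma bergman_zeros_small (g : C -> C) (z : nat -> C) :
  bergman q w g -> g 0 != 0 -> zero_sequence g z ->
  forall e : R, 0 < e -> exists N, forall n, (N <= n)%N ->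
    \prod_(k < n) (1 / cabs (z k)) <= e * tail w (1 - n%:R^-1) `^ (- q^-1).
Proof.
move=> bg g0 hz e e0.
have [k k0 mean] := zeros_mean_bound hw q0.
have G0 : 0 < cabs (g 0) by rewrite cabs_gt0.
have E2 : 0 < expR (- 2) :> R by rewrite expR_gt0.
pose B := cabs (g 0) * expR (- 2) * e.
have B0 : 0 < B by rewrite !mulr_gt0.
pose e1 := k / 4 * B `^ q.
have e10 : 0 < e1 by rewrite mulr_gt0 ?powR_gt0// divr_gt0.
have ig := bergman_integrable hw q0 bg.
have : (fun n : nat => \int[leb2]_(p in annulus (1 - n%:R^-1) 1)
    (cabs (g (of_xy p)) `^ q * w (of_xy p))%:E)%E @ \oo --> 0%E.
  apply: (integral_shrink _ ig).
  - exact: measurable_disc.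
  - move=> p Dp; rewrite lee_fin ltry mulr_ge0 ?powR_ge0// ltW//.
    exact: (weight_gt0 hw).
  - by move=> n; exact: measurable_annulus.
  - by move=> n p /andP[_].
  - move=> p Dp; have p1 : 0 < 1 - cabs (of_xy p) by rewrite subr_gt0.
    exists (Num.bound (1 - cabs (of_xy p))^-1) => n hn /andP[+ _]; apply/negP; rewrite -ltNge.
    have := archi_boundP (ltW (_ : 0 < (1 - cabs (of_xy p))^-1)).
    rewrite invr_gt0 => /(_ p1) h.
    have hn' : (1 - cabs (of_xy p))^-1 < n%:R by apply: lt_le_trans h _; rewrite ler_nat.
    rewrite ltrBrDr -ltrBrDl -[ltRHS]invrK ltf_pV2 ?posrE ?invr_gt0//.
    by apply: lt_trans hn'; rewrite invr_gt0.
move=> /fine_cvgP[fin /cvg_real/(_ _ e10)[N1 hN1]].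
have [N2 _ hN2] := fin.
have /andP[r1p r1l] := r10.
pose N3 := Num.bound (1 - r1)^-1.
exists (maxn (maxn N1 N2) (maxn N3 2)) => n.
rewrite !geq_max => /andP[/andP[n1 n2] /andP[n3 n4]].
have nR : (0 : R) < n%:R by rewrite ltr0n (leq_trans _ n4).
set r := 1 - n%:R^-1.
have rl : r < 1 by rewrite /r ltrBlDr ltrDl invr_gt0.
have r2 : 1 / 2 <= r.
  have : n%:R^-1 <= 2^-1 :> R by rewrite lef_pV2 ?posrE// ler_nat.
  by rewrite /r; move: (n%:R^-1) => u; lra.
have r0 : 0 < r by lra.
have r1r : r1 <= r.
  rewrite /r lerBrDr -lerBrDl -[leRHS]invrK lef_pV2 ?posrE ?invr_gt0 ?subr_gt0//.
  have h : (1 - r1)^-1 < N3%:R by apply: archi_boundP; rewrite invr_ge0 subr_ge0 ltW.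
  by apply: le_trans (ltW h) _; rewrite ler_nat.
have Tr : 0 < tail w r by apply: (tail_gt0 hw k10 r1p hd); rewrite r1r.
have T2 : 0 < tail w r / 2 by rewrite divr_gt0.
have [t0 /andP[_ t01] ht0] := tail_cvg0 hw T2.
pose t := Num.max t0 ((1 + r) / 2).
have t1 : t < 1 by rewrite gt_max t01; lra.
have rt : r < t by rewrite lt_max; apply/orP; right; lra.
have Tt : tail w t < tail w r / 2 by apply: ht0 => //; rewrite le_max lexx.
pose l := [seq k <- iota 0 n | cabs (z k) < r].
pose s := [seq z k | k <- l].
have ul : uniq l by rewrite filter_uniq// iota_uniq.
have zn k' : z k' != 0 by exact: zero_sequence_neq0 hz g0.
have hs c : c \in s -> c != 0 /\ cabs c < r.
  by move=> /mapP[k' + ->]; rewrite mem_filter => /andP[].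
have hc a : disc a -> exists2 m, zero_order g a m & (count_mem a s <= m)%N.
  move=> Da; have [_ /(_ _ Da)[m om cm]] := hz; exists m => //.
  rewrite count_map -size_filter; apply: (size_le_card cm); first exact: filter_uniq.
  by move=> k'; rewrite mem_filter /= => /andP[/eqP].
have := mean g r t s bg g0 r0 rt t1 hs hc.
set A := cabs (g 0) * _ => main.
set P := \prod_(k0 < n) _.
have P0 : 0 <= P by apply: prodr_ge0 => i _; rewrite divr_ge0// cabs_ge0.
have PA : cabs (g 0) * expR (- 2) * P <= A.
  rewrite -mulrA ler_wpM2l ?cabs_ge0//; apply: (@le_trans _ _ (r ^+ n * P)).
    by rewrite ler_wpM2r// expR_le_pow.
  have -> : r ^+ n * P = \prod_(i <- iota 0 n) (r / cabs (z i)).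
    rewrite /P -[in LHS](big_mkord xpredT (fun i => 1 / cabs (z i))) /index_iota subn0.
    rewrite -[X in r ^+ X](size_iota 0 n) -iter_mulr_1 -(@count_predT _ (iota 0 n)).
    rewrite -(big_const_seq _ _ (iota 0 n) xpredT r) -big_split /=.
    by apply: eq_bigr => i _; rewrite mul1r.
  rewrite big_map big_filter (bigID (fun i => cabs (z i) < r)) /=.
  rewrite ler_piMr//; first by apply: prodr_ge0 => i _; rewrite divr_ge0 ?cabs_ge0// ltW.
  apply: prodr_ile1 => i zi; rewrite divr_ge0 ?cabs_ge0 ?(ltW r0)//=.
  by rewrite ler_pdivrMr ?cabs_gt0// mul1r leNgt.
set I := (\int[leb2]_(p in annulus r 1) _)%E in main.
have If : I \is a fin_num by exact: hN2.
have Ie : fine I < e1.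
  by apply: le_lt_trans (hN1 _ n1); rewrite subr0 ler_norm.
rewrite -[I]fineK// lee_fin in main.
have le1 : (cabs (g 0) * expR (- 2) * P) `^ q * (k * tail w r / 4) <= fine I.
  apply: le_trans main; apply: ler_pM; rewrite ?powR_ge0//.
  - by rewrite divr_ge0// mulr_ge0// ltW.
  - by apply: le_powR => //; rewrite ?(ltW q0)// !mulr_ge0// ltW.
  - have h : tail w r / 2 <= tail w r - tail w t by lra.
    rewrite [leLHS](_ : _ = k * (1 / 2) * (tail w r / 2)); last by field.
    apply: ler_pM => //; [by rewrite mulr_ge0 ?(ltW k0)//; lra|lra|].
    by rewrite ler_wpM2l// ltW.
have Tq : (tail w r `^ (- q^-1)) `^ q = (tail w r)^-1.
  by rewrite -powRrM mulNr mulVf ?lt0r_neq0// powR_inv1// ltW.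
rewrite leNgt; apply/negP => bad.
have lt1 : (B * tail w r `^ (- q^-1)) `^ q < (cabs (g 0) * expR (- 2) * P) `^ q.
  apply: gt0_ltr_powR => //.
  - by rewrite nnegrE mulr_ge0 ?powR_ge0// ltW.
  - by rewrite nnegrE !mulr_ge0// ltW.
  - by rewrite /B -mulrA ltr_pM2l// mulr_gt0.
rewrite powRM ?powR_ge0 ?(ltW B0)// Tq in lt1.
have kT : 0 < k * tail w r / 4 by rewrite divr_gt0// mulr_gt0.
have : B `^ q / tail w r * (k * tail w r / 4) < e1.
  by apply: lt_trans Ie; apply: lt_le_trans le1; rewrite ltr_pM2r.
rewrite [ltLHS](_ : _ = e1) ?ltxx//.
by rewrite /e1; field; rewrite lt0r_neq0.
Qed.

End NecessaryCondition.

(** * Lacunary products and their zeros *)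

Section SimpleZero.
Variable R : realType.
Local Notation C := (cplx R).

Lemma psumS (d : nat -> C) (x : C) n :
  psum d x n.+1 = d 0%N + x * psum (fun k => d k.+1) x n.
Proof.
rewrite /psum big_ord_recl expr0 mulr1 mulr_sumr; congr (_ + _).
by apply: eq_bigr => k _; rewrite lift0 exprS mulrCA.
Qed.

(** Division by [x - x0] shifts the coefficients. *)
Lemma expands_divX (f : C -> C) (x0 : C) d (s M : R) : expands f x0 d s M -> f x0 = 0 ->
  d 0%N = 0 /\
  expands (fun x => if x == x0 then d 1%N else f x / (x - x0)) x0 (fun k => d k.+1) s (M / s).
Proof.
move=> [s0 dM df] f0.
have d0 : d 0%N = 0.
  have := df 0; rewrite addr0 f0 cabs0 => /(_ s0) h; apply: cplx_cvg_unique h.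
  apply/cvg_cplx => e e0; exists 1%N => -[//|n] _.
  by rewrite psumS mul0r addr0 subrr cabs0.
split; [exact: d0|split; [exact: s0| |]].
  by move=> k; rewrite ler_pdivlMr// -mulrA -exprSr; exact: dM.
move=> x xs; have [e|ne] := eqVneq (x0 + x) x0.
  have -> : x = 0 by apply: (addrI x0); rewrite e addr0.
  apply/cvg_cplx => e' e'0; exists 1%N => -[//|n] _.
  by rewrite psumS mul0r addr0 subrr cabs0.
have xn0 : x != 0 by apply: contraNneq ne => ->; rewrite addr0.
have -> : x0 + x - x0 = x by rewrite addrC addKr.
rewrite mulrC; have /cvg_cplx h := @cvg_mulC _ _ x^-1 _ (df _ xs).
apply/cvg_cplx => e /h[n hn]; exists n => k nk.
have := hn k.+1 (leqW nk); rewrite psumS d0 add0r.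
by rewrite (mulKf xn0).
Qed.
End SimpleZero.

Section LacunaryProduct.
Variable R : realType.
Local Notation C := (cplx R).
Variables (a : nat -> R) (N : nat -> nat).
Hypothesis a1 : forall j, 1 < a j.
Hypothesis aa : forall j, a j.+1 < a j ^+ 2.
Hypothesis N0 : (0 < N 0)%N.
Hypothesis NN : forall j, (2 * N j <= N j.+1)%N.
Hypothesis bnd : forall r : R, 0 <= r < 1 ->
  exists M : R, forall K, \prod_(j < K) (1 + a j * r ^+ N j) <= M.

Lemma lacunary_gt j : (j < N j)%N.
Proof. by elim: j => // j ih; apply: leq_trans (NN j); lia. Qed.

Definition partial_real K : {poly R} := \prod_(j < K) (1 + a j *: 'X^(N j)).
Definition partial K : {poly C} := map_poly (real_complex R) (partial_real K).
(** Factor [K] only changes coefficients of index at least [N K > K], so the coefficient of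
    index [i] is final from the partial product of rank [i] on. *)
Definition coeff i : R := (partial_real i)`_i.

Lemma partial_realS K :
  partial_real K.+1 = partial_real K + a K *: ('X^(N K) * partial_real K).
Proof. by rewrite /partial_real big_ord_recr /= mulrDr mulr1 mulrC scalerAl. Qed.

Lemma partial_coef_ge0 K i : 0 <= (partial_real K)`_i.
Proof.
elim: K i => [|K ih] i; first by rewrite /partial_real big_ord0 coef1; case: eqP.
rewrite partial_realS coefD coefZ coefXnM addr_ge0//; case: ifP => _.
  by rewrite mulr0.
by rewrite mulr_ge0//; have := a1 K; lra.
Qed.

Lemma partial_coef_stable K i : (i <= K)%N -> (partial_real K)`_i = coeff i.
Proof.
move=> /subnKC <-; elim: (K - i)%N => [|d ih]; first by rewrite addn0.
rewrite addnS partial_realS coefD coefZ coefXnM ih ifT ?mulr0 ?addr0//.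
by apply: leq_trans (lacunary_gt _); rewrite ltnS leq_addr.
Qed.

Lemma horner_partial_real K (r : R) :
  (partial_real K).[r] = \prod_(j < K) (1 + a j * r ^+ N j).
Proof. by rewrite horner_prod; apply: eq_bigr => j _; rewrite !hornerE. Qed.

Lemma horner_partial K (x : C) :
  (partial K).[x] = \prod_(j < K) (1 + (a j)%:C%C * x ^+ N j).
Proof.
rewrite /partial /partial_real rmorph_prod horner_prod; apply: eq_bigr => j _.
by rewrite rmorphD /= rmorph1 map_polyZ map_polyXn !hornerE.
Qed.

Lemma partial_coef_bound (r M : R) K i : 0 <= r ->
  \prod_(j < K) (1 + a j * r ^+ N j) <= M -> (partial_real K)`_i * r ^+ i <= M.
Proof.
move=> r0; rewrite -horner_partial_real; apply: le_trans.
rewrite (@horner_coef_wide _ (maxn (size (partial_real K)) i.+1)) ?leq_maxl//.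
have im : (i < maxn (size (partial_real K)) i.+1)%N by rewrite leq_max leqnn orbT.
rewrite (bigD1 (Ordinal im))//= lerDl sumr_ge0// => k _.
by rewrite mulr_ge0 ?partial_coef_ge0// exprn_ge0.
Qed.

Definition ccoeff i : C := (coeff i)%:C%C.

Lemma partial_psum (x : C) (r M : R) K : 0 < r -> cabs x < r ->
  (forall K, \prod_(j < K) (1 + a j * r ^+ N j) <= M) ->
  cabs ((partial K).[x] - psum ccoeff x K) <= M * (cabs x / r) ^+ K / (1 - cabs x / r).
Proof.
move=> r0 xr hM; have x0 := cabs_ge0 x.
have t01 : 0 <= cabs x / r < 1.
  by rewrite divr_ge0 ?(ltW r0)//= ltr_pdivrMr// mul1r.
have ge0 i : 0 <= (partial_real K)`_i by exact: partial_coef_ge0.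
pose n := maxn (size (partial K)) K.
pose v k : C := if (k < K)%N then 0 else (partial K)`_k * x ^+ k.
have -> : (partial K).[x] - psum ccoeff x K = \sum_(k < n) v k.
  rewrite (@horner_coef_wide _ n) ?leq_maxl//.
  rewrite (sum_ord_split (fun k => (partial K)`_k * x ^+ k) (leq_maxr _ _ : (K <= n)%N)).
  rewrite (sum_ord_split v (leq_maxr _ _ : (K <= n)%N)) [X in _ = X + _]big1 ?add0r; last first.
    by move=> k _; rewrite /v ltn_ord.
  rewrite addrAC (_ : \sum_(k < K) _ = psum ccoeff x K) ?subrr ?add0r.
    by apply: eq_bigr => k _; rewrite /v ltnNge leq_addr.
  by apply: eq_bigr => k _; rewrite coef_map /= partial_coef_stable// ltnW.
apply: le_trans (cabs_sum _ _ _) _.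
apply: (@geom_tail _ (fun k => cabs (v k)) M _ K n t01).
  move=> k; rewrite cabs_ge0 /= /v; case: ifP => _.
    rewrite cabs0 mulr_ge0//; last by case/andP: t01 => *; rewrite exprn_ge0.
    apply: le_trans (hM 0%N); rewrite big_ord0//.
  have -> : (partial K)`_k = ((partial_real K)`_k)%:C%C by rewrite coef_map.
  rewrite cabsM cabsX cabsR ger0_norm// expr_div_n mulrA ler_pdivlMr ?exprn_gt0//.
  rewrite mulrAC ler_wpM2r ?exprn_ge0//.
  by apply: partial_coef_bound => //; exact: ltW.
by move=> k kK; rewrite /v kK cabs0.
Qed.

Lemma partial_cvg : exists f : C -> C,
  (forall x, disc x -> (fun K => (partial K).[x]) @ \oo --> f x) /\
  (forall r M : R, 0 < r < 1 -> (forall K, \prod_(j < K) (1 + a j * r ^+ N j) <= M) ->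
     expands f 0 ccoeff r M).
Proof.
have cb (r M : R) k : 0 < r -> (forall K, \prod_(j < K) (1 + a j * r ^+ N j) <= M) ->
    cabs (ccoeff k) * r ^+ k <= M.
  move=> r0 hM; rewrite /ccoeff cabsR ger0_norm; last exact: partial_coef_ge0.
  by apply: partial_coef_bound => //; exact: ltW.
have mid (x : C) : disc x -> exists r M, [/\ cabs x < r, 0 < r < 1 &
    forall K, \prod_(j < K) (1 + a j * r ^+ N j) <= M].
  move=> Dx; pose r := (cabs x + 1) / 2.
  have x0 := cabs_ge0 x; have r01 : 0 < r < 1 by move: Dx; rewrite /disc /mkset /r; lra.
  have [|M hM] := bnd (r := r); first by lra.
  by exists r, M; split => //; move: Dx; rewrite /disc /mkset /r; lra.
have hs (x : C) : exists l : C, disc x -> psum ccoeff x @ \oo --> l.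
  have [Dx|nDx] := pselect (disc x); last by exists 0.
  have [r [M [xr /andP[r0 r1] hM]]] := mid _ Dx.
  have t01 : 0 <= cabs x / r < 1.
    by rewrite divr_ge0 ?cabs_ge0 ?(ltW r0)//= ltr_pdivrMr// mul1r.
  have [|l hl _] := @abs_series_cvg _ (fun k => ccoeff k * x ^+ k) (M / (1 - cabs x / r)).
    move=> n; have := @geom_tail _ (fun k => cabs (ccoeff k * x ^+ k)) M _ 0 n t01.
    rewrite expr0 mulr1; apply => // k.
    rewrite cabs_ge0 /= cabsM cabsX expr_div_n mulrA ler_pdivlMr ?exprn_gt0//.
    by rewrite mulrAC ler_wpM2r ?exprn_ge0 ?cabs_ge0// cb.
  by exists l.
have [f hf] := choice hs; exists f; split.
  move=> x Dx; have [r [M [xr /andP[r0 r1] hM]]] := mid _ Dx.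
  have t0 : 0 <= cabs x / r by rewrite divr_ge0 ?cabs_ge0 ?(ltW r0).
  have t1 : cabs x / r < 1 by rewrite ltr_pdivrMr// mul1r.
  apply/cvg_cplx => e e0; have e20 : 0 < e / 2 by rewrite divr_gt0.
  have /cvg_cplx/(_ _ e20)[n1 h1] := hf _ Dx.
  have : geometric (M / (1 - cabs x / r)) (cabs x / r) @ \oo --> (0 : R).
    by apply: cvg_geometric; rewrite ger0_norm.
  move=> /cvg_real/(_ _ e20)[n2 h2].
  exists (maxn n1 n2) => n; rewrite geq_max => /andP[/h1 h3 /h2]; rewrite subr0 => h4.
  have h5 := partial_psum n r0 xr hM.
  have h6 := ler_norm (geometric (M / (1 - cabs x / r)) (cabs x / r) n).
  rewrite -[_ - _](subrKA (psum ccoeff x n)).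
  apply: le_lt_trans (cabsD _ _) _; rewrite [e]splitr ltrD//.
  by apply: le_lt_trans h5 (le_lt_trans _ h4); rewrite mulrAC.
move=> r M /andP[r0 r1] hM; split => //; first by move=> k; exact: cb.
by move=> x xr; rewrite add0r; apply: hf; exact: lt_trans xr r1.
Qed.

Section Limit.
Variable f : C -> C.
Hypothesis fP : forall x, disc x -> (fun K => (partial K).[x]) @ \oo --> f x.
Hypothesis fE : forall r M : R, 0 < r < 1 ->
  (forall K, \prod_(j < K) (1 + a j * r ^+ N j) <= M) -> expands f 0 ccoeff r M.

Lemma lacunary_analytic : analytic_in_disc f.
Proof.
move=> x; rewrite /disc /mkset => x1; have x0 := cabs_ge0 x.
have r01 : 0 < (1 + cabs x) / 2 < 1 by lra.
have [|M hM] := bnd (r := (1 + cabs x) / 2); first by lra.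
have [||d hd] := @reexpand _ f ccoeff _ M ((1 - cabs x) / 4) x (fE r01 hM); [lra..|].
by apply/analytic_atP; exists d, ((1 - cabs x) / 4); eexists; exact: hd.
Qed.

Lemma lacunary_at0 : f 0 = 1.
Proof.
apply: (@cplx_cvg_unique _ (fun K => (partial K).[0])).
  by apply: fP; rewrite /disc /mkset cabs0.
rewrite (_ : (fun K => _) = fun=> 1); first exact: cvg_cstC.
apply/funext => K; rewrite horner_partial big1// => j _.
by rewrite expr0n eqn0Ngt (leq_ltn_trans _ (lacunary_gt j))// mulr0 addr0.
Qed.

Lemma lacunary_le_prod (x : C) (M : R) : disc x ->
  (forall K, \prod_(j < K) (1 + a j * cabs x ^+ N j) <= M) -> cabs (f x) <= M.
Proof.
move=> Dx hM; apply: cvg_cabs_le (fP Dx) _; exists 0%N => K _.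
rewrite horner_partial cabs_prod; apply: le_trans (hM K).
apply: ler_prod => j _; rewrite cabs_ge0 /=.
apply: le_trans (cabsD _ _) _; rewrite cabs1 cabsM cabsX cabsR ger0_norm//.
by have := a1 j; lra.
Qed.

Lemma prod_cabs_ge (c : nat -> C) n : \sum_(j < n) cabs (c j) <= 1 ->
  1 - \sum_(j < n) cabs (c j) <= \prod_(j < n) cabs (1 + c j).
Proof.
elim: n => [|n ih]; first by rewrite !big_ord0 subr0.
rewrite !big_ord_recr /= => h; have cn := cabs_ge0 (c n).
have s0 : 0 <= \sum_(j < n) cabs (c j) by apply: sumr_ge0 => j _; exact: cabs_ge0.
have {}ih := ih (le_trans _ h); have {ih} := ih ltac:(by rewrite lerDl).
move: (\sum_(_ < _) _) s0 h => s s0 h; set P := \prod_(_ < _) _ => hP.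
have h1 : 1 - cabs (c n) <= cabs (1 + c n).
  by have := cabs_triB 1 (- c n); rewrite cabsN opprK cabs1.
apply: le_trans (_ : (1 - s) * (1 - cabs (c n)) <= _); first by nra.
by apply: ler_pM => //; lra.
Qed.

Lemma partial_split K d (x : C) : (partial (K + d)).[x] =
  (partial K).[x] * \prod_(j < d) (1 + (a (K + j))%:C%C * x ^+ N (K + j)).
Proof. by rewrite !horner_partial big_split_ord. Qed.

(** Locally uniformly, the factors far out in the product tend to 1 so fast
    that the limit is zero-free apart from the zeros of a partial product. *)
Lemma lacunary_ge_partial (rho : R) : 0 <= rho < 1 -> exists K0, forall K,
  (K0 <= K)%N -> forall x, cabs x <= rho -> cabs (partial K).[x] / 2 <= cabs (f x).
Proof.
move=> /andP[r0 r1]; pose u j : R := a j * rho ^+ N j.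
have u0 j : 0 <= u j by rewrite mulr_ge0 ?exprn_ge0//; have := a1 j; lra.
have [|M hM] := bnd (r := rho); first by rewrite r0.
have sM K : \sum_(j < K) u j <= M.
  apply: le_trans (hM K); elim: K => [|K ih]; first by rewrite !big_ord0.
  rewrite !big_ord_recr /= mulrDr mulr1 lerD// ler_peMl ?(u0 K)//.
  elim: (K) => [|k ih']; first by rewrite big_ord0.
  by rewrite big_ord_recr /= mulr_ege1// lerDl; exact: (u0 k).
have ndS : {homo (fun K => \sum_(j < K) u j) : m n / (m <= n)%N >-> m <= n}.
  move=> m n mn; rewrite (sum_ord_split u mn) lerDl sumr_ge0// => j _; exact: u0.
have cS := nondecreasing_cvgn ndS.
have /cS : has_ubound (range (fun K => \sum_(j < K) u j)).
  by exists M => _ [K _ <-].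
set l := sup _ => /cvg_real/(_ 4^-1)[|K0 hK0]; first by rewrite invr_gt0.
exists K0 => K K0K x xr.
have tl d : \sum_(j < d) u (K + j)%N <= 2^-1.
  have h1 := hK0 _ K0K; have h2 := hK0 _ (leq_trans K0K (leq_addr d K)).
  move: h1 h2; rewrite /= (sum_ord_split u (leq_addr d K)) addKn.
  move: (\sum_(_ < K) _) (\sum_(_ < d) _) => s t.
  by move=> /ltr_normlP[h1 h2] /ltr_normlP[h3 h4]; lra.
apply/ler_addgt0Pr => e e0.
have Dx : disc x by exact: le_lt_trans r1.
have /cvg_cplx/(_ _ e0)[n hn] := fP Dx.
have {hn} := hn (K + n)%N (leq_addl _ _); rewrite partial_split.
set P := (partial K).[x]; set Q := \prod_(_ < _) _ => hn.
suff h : 2^-1 <= cabs Q.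
  have := cabs_triB (P * Q) (f x); rewrite cabsM.
  have : cabs P * 2^-1 <= cabs P * cabs Q by rewrite ler_wpM2l ?cabs_ge0.
  lra.
rewrite /Q cabs_prod.
have cu j : cabs ((a (K + j))%:C%C * x ^+ N (K + j)) <= u (K + j)%N.
  have aj : 0 <= a (K + j)%N by have := a1 (K + j)%N; lra.
  rewrite cabsM cabsX cabsR ger0_norm// ler_wpM2l//.
  by apply: lerXn2r => //; rewrite nnegrE ?cabs_ge0.
have su : \sum_(j < n) cabs ((a (K + j))%:C%C * x ^+ N (K + j)) <= 2^-1.
  by apply: le_trans (tl n); apply: ler_sum => j _.
by have := @prod_cabs_ge (fun j => (a (K + j))%:C%C * x ^+ N (K + j)) n; lra.
Qed.

Section Zeros.
Variable rts : nat -> seq C.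
Hypothesis rtsE : forall j x,
  1 + (a j)%:C%C * x ^+ N j = (a j)%:C%C * \prod_(y <- rts j) (x - y).
Hypothesis rts_size : forall j, size (rts j) = N j.
Hypothesis rts_uniq : forall j, uniq (rts j).

Lemma rts_abs j x : x \in rts j -> a j * cabs x ^+ N j = 1.
Proof.
move=> xj; have := rtsE j x; rewrite (big_rem x)//= subrr mul0r mulr0 => /eqP.
rewrite addrC addr_eq0 => /eqP/(congr1 (@cabs R)).
by rewrite cabsM cabsX cabsR cabsN cabs1 ger0_norm//; have := a1 j; lra.
Qed.

Lemma rts_neq0 j : (0 < N j)%N.
Proof. exact: leq_ltn_trans (lacunary_gt j). Qed.

Definition radius j : R := cabs (head 0 (rts j)).

Lemma radiusE j : a j * radius j ^+ N j = 1.
Proof.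
apply: rts_abs; have := rts_neq0 j; rewrite -rts_size.
by case: (rts j) => // y s _; rewrite mem_head.
Qed.

Lemma rts_radius j x : x \in rts j -> cabs x = radius j.
Proof.
move=> xj; have a0 : a j != 0 by rewrite gt_eqF//; have := a1 j; lra.
apply: (@pexpIrn _ (N j)); rewrite ?rts_neq0 ?nnegrE ?cabs_ge0//.
by apply: (mulfI a0); rewrite radiusE; apply: rts_abs.
Qed.

Lemma radius_gt0 j : 0 < radius j.
Proof.
rewrite lt_def cabs_ge0 andbT; apply: contra_eqN (radiusE j) => /eqP ->.
by rewrite expr0n eqn0Ngt rts_neq0 mulr0 eq_sym oner_neq0.
Qed.

Lemma radius_lt1 j : radius j < 1.
Proof.
rewrite ltNge; apply/negP => /(exprn_ege1 (N j)) h.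
by have := radiusE j; have := a1 j; nra.
Qed.

Lemma radius_lt i j : (i < j)%N -> radius i < radius j.
Proof.
apply: (homo_ltn (r := fun x y : R => x < y)) => [y x z|{}i]; first exact: lt_trans.
have [e1 e2] := (radiusE i, radiusE i.+1).
rewrite ltNge; apply/negP => h.
have h1 : radius i.+1 ^+ N i.+1 <= radius i ^+ N i ^+ 2.
  rewrite -exprM mulnC; apply: le_trans (_ : radius i ^+ N i.+1 <= _).
    by apply: lerXn2r => //; rewrite nnegrE ?(ltW (radius_gt0 _)).
  by apply: ler_wiXn2l (NN i); rewrite ltW ?radius_gt0 ?radius_lt1.
have h2 : a i ^+ 2 * radius i ^+ N i ^+ 2 = 1 by rewrite -exprMn e1 expr1n.
have h3 : 0 < radius i ^+ N i by rewrite exprn_gt0 ?radius_gt0.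
have h4 : 0 < radius i.+1 ^+ N i.+1 by rewrite exprn_gt0 ?radius_gt0.
move: (aa i) (a1 i) (a1 i.+1) => h5 h6 h7.
have : a i.+1 * radius i.+1 ^+ N i.+1 < a i ^+ 2 * radius i ^+ N i ^+ 2.
  by apply: lt_le_trans (_ : a i ^+ 2 * radius i.+1 ^+ N i.+1 <= _);
    rewrite ?ltr_pM2r ?ler_pM2l//; apply: lt_trans h5; lra.
by rewrite h2 e2 ltxx.
Qed.

Definition zlist K : seq C := flatten [seq rts j | j <- iota 0 K].

Lemma zlistS K : zlist K.+1 = zlist K ++ rts K.
Proof. by rewrite /zlist -addn1 iotaD map_cat flatten_cat /= cats0. Qed.

Lemma mem_zlist K x : reflect (exists2 j, (j < K)%N & x \in rts j) (x \in zlist K).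
Proof.
apply: (iffP flatten_mapP) => -[j]; rewrite ?mem_iota ?add0n => jK xj; exists j => //.
by rewrite mem_iota.
Qed.

Lemma size_zlist K : size (zlist K) = (\sum_(j < K) N j)%N.
Proof.
elim: K => [|K ih]; first by rewrite big_ord0.
by rewrite zlistS size_cat ih rts_size big_ord_recr.
Qed.

Lemma size_zlist_ge K : (K <= size (zlist K))%N.
Proof.
elim: K => // K ih; rewrite zlistS size_cat rts_size.
by have := rts_neq0 K; lia.
Qed.

Lemma zlist_sorted K : sorted (fun x y => cabs x <= cabs y) (zlist K).
Proof.
rewrite sorted_pairwise; last by move=> y x z; exact: le_trans.
elim: K => // K ih; rewrite zlistS pairwise_cat ih; apply/and3P; split=> //.
  apply/allrelP => x y /mem_zlist[j jK /rts_radius ->] /rts_radius ->.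
  exact/ltW/radius_lt.
apply: (@sub_in_pairwise _ (mem (rts K)) (fun _ _ => true)); first last.
- by elim: (rts K) => //= y s ->; rewrite andbT; apply/allP.
- exact/allP.
- by move=> x y /rts_radius -> /rts_radius ->.
Qed.

Lemma zlist_uniq K : uniq (zlist K).
Proof.
elim: K => // K ih; rewrite zlistS cat_uniq ih rts_uniq andbT /=.
apply/hasPn => x /rts_radius xK; apply/mem_zlist => -[j /radius_lt jK /rts_radius].
by rewrite xK => e; rewrite e ltxx in jK.
Qed.

Lemma nth_zlist K L k : (K <= L)%N -> (k < size (zlist K))%N ->
  nth 0 (zlist L) k = nth 0 (zlist K) k.
Proof.
move=> /subnKC <- kK; elim: (L - K)%N => [|d ih]; first by rewrite addn0.
by rewrite addnS zlistS nth_cat ifT ?ih//; apply: leq_trans kK _; rewrite !size_zlist big_split_ord leq_addr.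
Qed.

Definition lacunary_zero k : C := nth 0 (zlist k.+1) k.

Lemma lacunary_zeroE K k : (k < size (zlist K))%N ->
  lacunary_zero k = nth 0 (zlist K) k.
Proof.
move=> kK; rewrite /lacunary_zero; have [h|h] := leqP k.+1 K.
  by rewrite -(nth_zlist h)// size_zlist_ge.
by rewrite (nth_zlist (ltnW h)).
Qed.

Lemma lacunary_zero_mem k : lacunary_zero k \in zlist k.+1.
Proof. by rewrite /lacunary_zero mem_nth ?size_zlist_ge. Qed.

Lemma lacunary_zero_disc k : disc (lacunary_zero k).
Proof.
have /mem_zlist[j _ /rts_radius] := lacunary_zero_mem k.
by rewrite /disc /mkset => ->; exact: radius_lt1.
Qed.

Lemma lacunary_zero_homo :
  {homo (fun k => cabs (lacunary_zero k)) : m n / (m <= n)%N >-> m <= n}.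
Proof.
move=> m n mn; have hn := size_zlist_ge n.+1.
rewrite (@lacunary_zeroE n.+1 m) ?(leq_ltn_trans mn)// (@lacunary_zeroE n.+1 n)//.
have tr : transitive (fun x y : C => cabs x <= cabs y) by move=> y x z; exact: le_trans.
apply: (sorted_leq_nth tr _ 0 (zlist_sorted n.+1)) => //; rewrite inE//.
exact: leq_ltn_trans hn.
Qed.

Lemma lacunary_zero_prod K :
  \prod_(k < \sum_(j < K) N j) (1 / cabs (lacunary_zero k)) = \prod_(j < K) a j.
Proof.
rewrite -size_zlist.
transitivity (\prod_(x <- zlist K) (1 / cabs x)).
  rewrite (big_nth 0) big_mkord; apply: eq_bigr => k _.
  by rewrite (lacunary_zeroE (ltn_ord k)).
elim: K => [|K ih]; first by rewrite big_nil big_ord0.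
rewrite zlistS big_cat /= ih big_ord_recr /=; congr (_ * _).
rewrite (eq_big_seq (fun=> (radius K)^-1)) => [|x /rts_radius ->]; last by rewrite div1r.
rewrite big_const_seq count_predT rts_size iter_mulr mulr1 exprVn.
have h := radiusE K; have h0 : radius K ^+ N K != 0 by rewrite expf_neq0 ?gt_eqF ?radius_gt0.
by apply: (mulIf h0); rewrite h mulVf.
Qed.

Lemma horner_partial_zlist K x :
  (partial K).[x] = (\prod_(j < K) (a j)%:C%C) * \prod_(y <- zlist K) (x - y).
Proof.
rewrite horner_partial; elim: K => [|K ih]; first by rewrite !big_ord0 big_nil mulr1.
by rewrite !big_ord_recr ih zlistS big_cat /= rtsE mulrACA.
Qed.

Lemma prod_distance_gt0 (s : seq C) (x0 : C) : x0 \notin s ->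
  exists c d : R, [/\ 0 < c, 0 < d & forall x, cabs (x - x0) < d ->
    c <= \prod_(y <- s) cabs (x - y)].
Proof.
elim: s => [_|y s ih]; first by exists 1, 1; split => // x _; rewrite big_nil.
rewrite inE negb_or => /andP[x0y /ih[c [d [c0 d0 h]]]].
have e0 : 0 < cabs (x0 - y) by rewrite cabs_gt0 subr_eq0.
exists (cabs (x0 - y) / 2 * c), (Num.min d (cabs (x0 - y) / 2)).
split; [by rewrite mulr_gt0// divr_gt0|by rewrite lt_min d0 divr_gt0|].
move=> x; rewrite lt_min => /andP[/h h1 h2]; rewrite big_cons.
apply: ler_pM => //; [by rewrite divr_ge0// ltW|exact: ltW|].
have := cabsD (x0 - x) (x - y); rewrite addrA subrK (cabs_distC x0); lra.
Qed.

Lemma partial_prod_neq0 K : 0 < cabs (\prod_(j < K) (a j)%:C%C : C).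
Proof.
rewrite cabs_prod prodr_gt0// => j _; rewrite cabsR.
by apply: lt_le_trans (ler_norm _); have := a1 j; lra.
Qed.

(** By the lower bound a zero of the limit is a zero of a partial product. *)
Lemma lacunary_order0 (x0 : C) : disc x0 -> (forall j, x0 \notin rts j) ->
  zero_order f x0 0.
Proof.
move=> Dx hx; exists f; split; [exact: lacunary_analytic| |].
  have c01 : 0 <= cabs x0 < 1 by rewrite cabs_ge0.
  have [K0 /(_ _ (leqnn _) _ (lexx _)) h] := lacunary_ge_partial c01.
  rewrite -cabs_gt0; apply: lt_le_trans h; rewrite divr_gt0//.
  rewrite horner_partial_zlist cabsM mulr_gt0 ?partial_prod_neq0//.
  rewrite cabs_gt0 prodf_seq_neq0; apply/allP => y /mem_zlist[j _ yj] /=.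
  by rewrite subr_eq0; apply: contraNneq (hx j) => ->.
by apply/nbhs_cplx; exists 1 => // x _; rewrite expr0 mul1r.
Qed.

(** The first Taylor coefficient at a zero of one of the factors does not
    vanish: [f] is bounded below there by a multiple of the distance to the zero. *)
Lemma lacunary_order1 (x0 : C) j : x0 \in rts j -> zero_order f x0 1.
Proof.
move=> xj; have x1 : cabs x0 < 1 by rewrite (rts_radius xj) radius_lt1.
have x00 := cabs_ge0 x0.
have /analytic_atP[d [s [M fd]]] : analytic_at f x0 by exact: lacunary_analytic.
have [s0 dM df] := fd.
have f0 : f x0 = 0.
  apply: (@cplx_cvg_unique _ (fun K => (partial K).[x0])); first exact: fP.
  apply/cvg_cplx => e e0; exists j.+1 => n jn.
  rewrite horner_partial_zlist (big_rem x0) /=; last by apply/mem_zlist; exists j.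
  by rewrite !(subrr, mul0r, mulr0) cabs0.
have [d0 ge] := expands_divX fd f0; set g := (fun x => _) in ge.
exists g; split.
- by apply/analytic_atP; exists (fun k => d k.+1), s, (M / s).
- rewrite /g eqxx; apply/negP => /eqP d1.
  have r01 : 0 <= (1 + cabs x0) / 2 < 1 by lra.
  have [K0 hK0] := lacunary_ge_partial r01.
  pose K := maxn K0 j.+1; have {hK0} := hK0 _ (leq_maxl K0 j.+1); rewrite -/K => hK.
  have xK : x0 \in zlist K by apply/mem_zlist; exists j => //; exact: leq_maxr.
  have [|c [e [c0 e0 hc]]] := @prod_distance_gt0 (rem x0 (zlist K)) x0.
    by rewrite mem_rem_uniqF ?zlist_uniq.
  have A0 := partial_prod_neq0 K; set A := cabs _ in A0.
  have low x : cabs (x - x0) < e -> cabs x <= (1 + cabs x0) / 2 ->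
      A * c / 2 * cabs (x - x0) <= cabs (f x).
    move=> /hc h /hK; apply: le_trans.
    rewrite horner_partial_zlist (big_rem x0 xK) /= !cabsM -/A (cabs_prod (rem _ _)).
    have := cabs_ge0 (x - x0); move: (cabs (x - x0)) (\prod_(_ <- _) _) h => t P h t0.
    have : A * t * c <= A * t * P by rewrite ler_wpM2l// mulr_ge0// ltW.
    rewrite mulrA; lra.
  (* at a double zero [f] would be at most quadratic *)
  have up x : cabs x <= s / 2 -> cabs (f (x0 + x)) <= 2 * M * (cabs x / s) ^+ 2.
    move=> xs; have := expands_taylor 2 fd xs.
    by rewrite psumS d0 add0r /psum big_ord1 d1 mul0r mulr0 subr0.
  have M0 : 0 <= M by apply: le_trans (dM 0%N); rewrite mulr_ge0 ?cabs_ge0 ?exprn_ge0// ltW.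
  pose k := A * c / 2.
  have k0 : 0 < k by rewrite /k divr_gt0// mulr_gt0.
  pose B := 2 * M / s ^+ 2; have B0 : 0 <= B by rewrite /B divr_ge0 ?exprn_ge0 ?mulr_ge0// ltW.
  pose t := Num.min (Num.min (e / 2) (s / 2)) (Num.min ((1 - cabs x0) / 2) (k / (2 * (B + 1)))).
  have x1' : 0 < 1 - cabs x0 by lra.
  have B1 : 0 < 2 * (B + 1) by lra.
  have t0 : 0 < t.
    have h2 : 0 < 2 :> R by [].
    by rewrite /t !lt_min (divr_gt0 e0 h2) (divr_gt0 s0 h2) (divr_gt0 x1' h2) (divr_gt0 k0 B1).
  have : t <= t by [].
  rewrite {2}/t !le_min => /andP[/andP[te ts] /andP[tx tk]].
  have ct : cabs (t%:C%C : C) = t by rewrite cabsR ger0_norm// ltW.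
  have := low (x0 + t%:C%C); rewrite [_ - x0]addrC addKr ct.
  have e2 : t < e by lra.
  move=> /(_ e2); have := cabsD x0 t%:C%C; rewrite ct => h1 h2.
  have {}h2 := h2 ltac:(lra); have := up t%:C%C; rewrite ct => /(_ ts).
  move=> /(le_trans h2); rewrite -/k expr_div_n.
  have -> : 2 * M * (t ^+ 2 / s ^+ 2) = B * t * t by rewrite /B; field; rewrite gt_eqF.
  rewrite ler_pM2r//.
  have : t * (2 * (B + 1)) <= k by rewrite -ler_pdivlMr//; lra.
  nra.
- apply/nbhs_cplx; exists 1 => // x _; rewrite expr1 /g.
  have [->|ne] := eqVneq x x0; first by rewrite subrr mul0r.
  by rewrite mulrC divfK// subr_eq0.
Qed.

Lemma lacunary_zero_sequence : zero_sequence f lacunary_zero.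
Proof.
split=> [k|x Dx]; first exact: lacunary_zero_disc.
have [[j xj]|nx] := pselect (exists j, x \in rts j).
  exists 1%N; first exact: lacunary_order1 xj.
  have xz : x \in zlist j.+1 by apply/mem_zlist; exists j.
  suff -> : [set k | lacunary_zero k = x] = [set index x (zlist j.+1)] by exact: card_set1.
  apply/seteqP; split => [k /= kx|_ /= ->]; last first.
    by rewrite (@lacunary_zeroE j.+1) ?index_mem// nth_index.
  pose L := maxn j.+1 k.+1.
  have hk : (k < size (zlist L))%N by apply: leq_trans (size_zlist_ge L); exact: leq_maxr.
  have hi : nth 0 (zlist L) (index x (zlist j.+1)) = x.
    by rewrite (nth_zlist (leq_maxl _ _)) ?index_mem// nth_index.
  have hi2 : (index x (zlist j.+1) < size (zlist L))%N.
    apply: leq_trans (_ : size (zlist j.+1) <= _)%N; first by rewrite index_mem.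
    by rewrite !size_zlist /L -(subnKC (leq_maxl j.+1 k.+1)) big_split_ord leq_addr.
  apply/eqP; rewrite -(nth_uniq 0 hk hi2 (zlist_uniq L)) hi.
  by rewrite -(lacunary_zeroE hk) kx.
exists 0%N; first by apply: lacunary_order0 => // j; apply/negP => xj; apply: nx; exists j.
suff -> : [set k | lacunary_zero k = x] = set0 by rewrite II0.
apply/seteqP; split => // k /= kx; apply: nx.
by have := lacunary_zero_mem k; rewrite kx => /mem_zlist[j _ xj]; exists j.
Qed.

End Zeros.

End Limit.

Lemma factor_roots j : exists s : seq C,
  [/\ forall x, 1 + (a j)%:C%C * x ^+ N j = (a j)%:C%C * \prod_(y <- s) (x - y),
      size s = N j & uniq s].
Proof.
pose c : C := (a j)%:C%C.
have Nj : (0 < N j)%N by exact: leq_ltn_trans (lacunary_gt j).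
have c0 : c != 0 by rewrite -cabs_eq0 cabsR normr_eq0 gt_eqF//; have := a1 j; lra.
pose p : {poly C} := 1 + c *: 'X^(N j).
have sX : size (c *: 'X^(N j)) = (N j).+1 by rewrite size_scale// size_polyXn.
have s1 : (size (1%R : {poly C}) < size (c *: 'X^(N j))%R)%N by rewrite sX size_poly1 ltnS.
have sp : size p = (N j).+1 by rewrite /p addrC size_polyDl.
have lp : lead_coef p = c by rewrite /p addrC lead_coefDl// lead_coefZ lead_coefXn mulr1.
have [s ps] := closed_field_poly_normal p; rewrite lp in ps.
exists s; split.
- move=> x; have := congr1 (horner^~ x) ps; rewrite /p !hornerE horner_prod => ->.
  by congr (_ * _); apply: eq_bigr => y _; rewrite !hornerE.
- by move: sp; rewrite ps size_scale// size_prod_XsubC => -[].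
- (* a double zero would also be a zero of the derivative, which vanishes only at 0 *)
  have p'x (x : C) : root p x -> (p^`()).[x] != 0.
    rewrite /p derivD derivC add0r derivZ derivXn !hornerE => /rootP; rewrite !hornerE => px.
    have x0 : x != 0.
      by apply: contra_eq_neq px => ->; rewrite expr0n eqn0Ngt Nj mulr0 addr0 oner_neq0.
    rewrite hornerMn hornerXn mulf_neq0// -mulr_natr mulf_neq0 ?expf_neq0//.
    by rewrite pnatr_eq0 -lt0n.
  have := Pdiv.ClosedField.root_coprimep p'x.
  by rewrite ps derivZ coprimepZl// coprimepZr// -separable_prod_XsubC separable_poly.unlock.
Qed.

(** The product converges as soon as its positive majorant does.  The growth of the
    exponents separates the circles that carry the zeros of the factors: listing the
    zeros factor after factor is listing them by increasing modulus, and all are simple. *)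
Lemma lacunary_product : exists f z,
  [/\ analytic_in_disc f /\ f 0 != 0,
      forall (x : C) (M : R), disc x ->
        (forall K, \prod_(j < K) (1 + a j * cabs x ^+ N j) <= M) -> cabs (f x) <= M,
      zero_sequence f z,
      {homo (fun k => cabs (z k)) : m n / (m <= n)%N >-> m <= n}
    & forall K, \prod_(k < \sum_(j < K) N j) (1 / cabs (z k)) = \prod_(j < K) a j].
Proof.
have [f [fP fE]] := partial_cvg.
have [rts rtsP] := choice factor_roots.
have rE j : forall x, 1 + (a j)%:C%C * x ^+ N j = (a j)%:C%C * \prod_(y <- rts j) (x - y).
  by case: (rtsP j).
have rs j : size (rts j) = N j by case: (rtsP j).
have ru j : uniq (rts j) by case: (rtsP j).
exists f, (lacunary_zero rts); split.
- by split; [exact: lacunary_analytic fE|rewrite (lacunary_at0 fP) oner_neq0].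
- exact: lacunary_le_prod fP.
- by apply: lacunary_zero_sequence.
- by apply: lacunary_zero_homo.
- by apply: lacunary_zero_prod.
Qed.

End LacunaryProduct.

(** * Membership in Bergman spaces from growth *)

Section GrowthCriterion.
Variable R : realType.
Local Notation C := (cplx R).
Local Notation leb2 := (@lebesgue_measure R \x @lebesgue_measure R)%E.
Variables (w : C -> R) (p : R) (f : C -> C).
Hypothesis hw : continuous_radial_weight w.
Hypothesis p0 : 0 < p.
Hypothesis af : analytic_in_disc f.
Let h (x : measurableTypeR R * measurableTypeR R) : R := cabs (f (of_xy x)) `^ p * w (of_xy x).

Let mh : measurable_fun (@of_xy R @^-1` (@disc R)) h.
Proof.
apply: measurable_funM.
  exact: measurable_cont_plane (@open_disc R) (analytic_cont_powR p0 af).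
exact: measurable_cont_plane (@open_disc R) (weight_cont hw).
Qed.

Lemma integral_growth_le (A : set (measurableTypeR R * measurableTypeR R)) (r G : R) :
  measurable A -> A `<=` annulus r 1 -> 0 <= G ->
  (forall x, A x -> cabs (f (of_xy x)) <= G) ->
  (\int[leb2]_(x in A) (h x)%:E <= (G `^ p)%:E * mass w r 1)%E.
Proof.
move=> mA sA G0 hG.
have AD : A `<=` @of_xy R @^-1` (@disc R) by move=> x /sA/andP[_].
have w0 x : annulus r 1 x -> 0 <= w (of_xy x).
  by move=> /andP[_ x1]; exact/ltW/(weight_gt0 hw).
have mw : measurable_fun (annulus r 1) (fun x => (w (of_xy x))%:E).
  by apply/measurable_EFinP; exact: measurable_weight_annulus.
rewrite /mass -ge0_integralZl ?lee_fin ?powR_ge0//; last exact: measurable_annulus.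
have mGw : measurable_fun (annulus r 1) (fun x => (G `^ p)%:E * (w (of_xy x))%:E)%E.
  exact: measurable_funeM.
apply: (@le_trans _ _ (\int[leb2]_(x in A) ((G `^ p)%:E * (w (of_xy x))%:E))%E).
  apply: ge0_le_integral => //.
  - by move=> x /sA/w0 ?; rewrite lee_fin mulr_ge0 ?powR_ge0.
  - by apply/measurable_EFinP; apply: measurable_funS mh => //; exact: measurable_disc.
  - by apply: measurable_funS mGw => //; exact: measurable_annulus.
  - move=> x Ax; rewrite -EFinM lee_fin ler_wpM2r//; first exact/w0/sA.
    by apply: le_powR; rewrite ?cabs_ge0 ?hG ?(ltW p0).
apply: ge0_subset_integral => //; first exact: measurable_annulus.
by move=> x /w0 ?; rewrite -EFinM lee_fin mulr_ge0 ?powR_ge0.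
Qed.

(** Cut the disc along an exhausting sequence of circles and use on each piece
    the bound valid up to its outer circle. *)
Lemma bergman_of_growth (rho G : nat -> R) (M : R) :
  (forall k, 0 < rho k < 1) -> (forall r : R, r < 1 -> exists k, r < rho k) ->
  (forall k, 0 <= G k) -> (forall k x, cabs x < rho k -> cabs (f x) <= G k) ->
  (forall n, \sum_(k < n) G k.+1 `^ p * tail w (rho k) <= M) ->
  bergman p w f.
Proof.
move=> rho01 rho1 G0 hG hM; split => //.
pose E k : set (measurableTypeR R * measurableTypeR R) := annulus 0 (rho k).
have mE k : measurable (E k) by exact: measurable_annulus.
have DE : @of_xy R @^-1` (@disc R) = \bigcup_k seqDU E k.
  rewrite -seqDU_bigcup_eq; apply/seteqP; split => x; rewrite /disc /preimage /mkset.
    by move=> /rho1[k xk]; exists k => //; rewrite /E /annulus /mkset cabs_ge0.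
  by move=> [k _] /andP[_ h1]; apply: lt_trans h1 _; case/andP: (rho01 k).
have [kappa k0 hk] := mass_bounds hw.
have mass_le r : 0 < r -> (mass w r 1 <= (kappa * tail w r)%:E)%E.
  move=> r0; have /andP[_] := hk r 1 (ltW r0) (lexx _).
  by rewrite -(tail_intE hw r0 (lexx _)) -EFinM.
have mass0 : (mass w 0 1 = (fine (mass w 0 1))%:E)%E.
  rewrite fineK// ge0_fin_numE ?(mass_fin hw)//.
  by apply: integral_ge0 => x /andP[_ x1]; rewrite lee_fin; exact/ltW/(weight_gt0 hw).
have mS k : measurable (seqDU E k) by exact: seqDU_measurable.
have h0 x : (@of_xy R @^-1` (@disc R)) x -> (0 <= (h x)%:E)%E.
  by move=> Dx; rewrite lee_fin mulr_ge0 ?powR_ge0//; exact/ltW/(weight_gt0 hw).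
rewrite /disc_integral DE ge0_integral_bigcup//; last first.
- by rewrite -DE; exact: h0.
- by rewrite -DE; apply/measurable_EFinP.
suff fin : (\big[+%E/0%R]_(0 <= k <oo) \int[leb2]_(x in seqDU E k) (h x)%:E <=
    (G 0%N `^ p * fine (mass w 0 1) + kappa * M)%:E)%E.
  apply: le_lt_trans (_ : (pi^-1)%:E * _ < _)%E; first apply: lee_wpmul2l fin.
    by rewrite lee_fin invr_ge0 pi_ge0.
  by rewrite -EFinM ltey.
have I0 k : (0 <= \int[leb2]_(x in seqDU E k) (h x)%:E)%E.
  by apply: integral_ge0 => x Ex; apply: h0; rewrite DE; exists k.
apply: lime_le; first by apply: is_cvg_nneseries => n _ _.
exists 1%N => // -[//|n] _; rewrite big_mkord big_ord_recl.
rewrite EFinD; apply: leeD.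
  rewrite EFinM -mass0; apply: integral_growth_le => //.
    by move=> x [/andP[h1 h2] _]; rewrite /annulus /mkset h1 (lt_trans h2)//; case/andP: (rho01 0%N).
  by move=> x [/andP[_ h2] _]; exact: hG.
apply: (@le_trans _ _ (\sum_(k < n) (kappa * (G k.+1 `^ p * tail w (rho k)))%:E)%E); last first.
  by rewrite sumEFin lee_fin -mulr_sumr ler_wpM2l// ltW.
apply: lee_sum => k _; rewrite lift0.
apply: le_trans (_ : (G k.+1 `^ p)%:E * mass w (rho k) 1 <= _)%E.
  apply: integral_growth_le => //.
    move=> x [/andP[_ h2] nx]; rewrite /annulus /mkset (lt_trans h2) ?andbT.
      rewrite leNgt; apply/negP => h3; apply: nx; rewrite -bigcup_mkord.
      by exists k => //=; rewrite /E /annulus /mkset cabs_ge0.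
    by case/andP: (rho01 k.+1).
  by move=> x [/andP[_ h2] _]; exact: hG.
rewrite mulrCA EFinM; apply: lee_wpmul2l; first by rewrite lee_fin powR_ge0.
by apply: mass_le; case/andP: (rho01 k).
Qed.

End GrowthCriterion.

(** * Amplitudes and exponents *)

Section Amplitudes.
Variable R : realType.
Variable b : nat.
Hypothesis b3 : (3 <= b)%N.

(** The amplitudes tend to infinity, slowly enough for consecutive ones to be
    comparable; squares, because [1 + y ^+ 2 <= expR (2 * y)] then controls late factors
    by an exponent linear in [y]. *)
Definition amplitude j : R := (b%:R * j.+1%:R) ^+ 2.

Definition amplitude_prod K : R := \prod_(j < K) amplitude j.

Lemma ler_b : 3 <= b%:R :> R.
Proof. by rewrite (ler_nat R 3). Qed.

Lemma amplitude_ge j : b%:R <= amplitude j.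
Proof.
rewrite /amplitude; have := ler_b.
have : 1 <= j.+1%:R :> R by rewrite (ler_nat R 1).
move: (j.+1%:R : R) (b%:R : R) => t u t1 u3.
have : u <= u * t by rewrite ler_peMr//; lra.
by move: (u * t) => v uv; nra.
Qed.

Lemma amplitude_gt1 j : 1 < amplitude j.
Proof. by have := amplitude_ge j; have := ler_b; lra. Qed.

Lemma amplitude_gt0 j : 0 < amplitude j.
Proof. exact: lt_trans (amplitude_gt1 j). Qed.

Lemma amplitude_lt_sqr j : amplitude j.+1 < amplitude j ^+ 2.
Proof.
have j1 : 1 <= j.+1%:R :> R by rewrite (ler_nat R 1).
have := ler_b; rewrite /amplitude -[j.+2%:R]natr1; move: (j.+1%:R : R) j1 (b%:R : R) => t t1 u u3.
have h : u * (t + 1) < (u * t) ^+ 2.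
  have -> : (u * t) ^+ 2 = u * (u * t ^+ 2) by ring.
  rewrite ltr_pM2l; last by lra.
  have : 3 * t ^+ 2 <= u * t ^+ 2 by rewrite ler_wpM2r// sqr_ge0.
  nra.
by rewrite ltr_pXn2r ?nnegrE// ?sqr_ge0// mulr_ge0//; lra.
Qed.

Lemma amplitude_le4 j : amplitude j.+1 <= 4 * amplitude j.
Proof.
have j1 : 1 <= j.+1%:R :> R by rewrite (ler_nat R 1).
have := ler_b; rewrite /amplitude -[j.+2%:R]natr1; move: (j.+1%:R : R) j1 (b%:R : R) => t t1 u u3.
have -> : 4 * (u * t) ^+ 2 = (u * (2 * t)) ^+ 2 by ring.
by apply: lerXn2r; rewrite ?nnegrE ?ler_wpM2l ?mulr_ge0//; lra.
Qed.

Lemma amplitude_prodS K : amplitude_prod K.+1 = amplitude_prod K * amplitude K.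
Proof. by rewrite /amplitude_prod big_ord_recr. Qed.

Lemma amplitude_prod_gt0 K : 0 < amplitude_prod K.
Proof. by apply: prodr_gt0 => j _; exact: amplitude_gt0. Qed.

Lemma amplitude_prod_ge K : b%:R <= amplitude_prod K.+1.
Proof.
elim: K => [|K ih]; first by rewrite /amplitude_prod big_ord1 amplitude_ge.
by rewrite amplitude_prodS (le_trans ih)// ler_peMr ?ltW ?amplitude_prod_gt0 ?amplitude_gt1.
Qed.

End Amplitudes.

Section ExponentChoice.
Variable R : realType.
Variables (q D : R) (n0 : nat) (tau : nat -> R).
Hypothesis q0 : 0 < q.
Hypothesis n02 : (2 <= n0)%N.
Hypothesis D1 : 1 <= D.
Hypothesis tau_gt0 : forall n, (n0 <= n)%N -> 0 < tau n.
Hypothesis tau_mono : forall m n, (n0 <= m)%N -> (m <= n)%N -> tau n <= tau m.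
Hypothesis tau_small : forall e : R, 0 < e -> exists2 n, (n0 <= n)%N & tau n < e.
Hypothesis tau_doubling : forall n, (n0 <= n)%N -> tau n <= D * tau (2 * n)%N.

(** Each exponent is the first index at which the tail falls below the power
    [- q] of the product of the amplitudes up to that factor.  Doubling prevents the
    tail from falling much lower, and amplitudes that beat the doubling constant
    make the exponents lacunary. *)
Lemma exponents_exist : exists (b : nat) (N : nat -> nat),
  [/\ (3 <= b)%N, forall j, (n0 <= N j)%N, forall j, (2 * N j <= N j.+1)%N,
      forall j, tau (N j) * amplitude_prod R b j.+1 `^ q <= 1
    & forall j, 1 <= D ^+ 2 * tau (2 * N j)%N * amplitude_prod R b j.+1 `^ q].
Proof.
(* the first summand makes the exponents double, the second makes them exceed [n0] *)
pose B : R := D ^+ 2 + (tau n0)^-1.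
have t0 := tau_gt0 (leqnn n0).
have ti0 : 0 < (tau n0)^-1 by rewrite invr_gt0.
have D0 : 0 < D := lt_le_trans ltr01 D1.
have D20 : 0 < D ^+ 2 by rewrite exprn_gt0.
have B0 : 0 < B by rewrite addr_gt0.
pose b := maxn 3 (Num.bound (B `^ q^-1)).
have b3 : (3 <= b)%N by exact: leq_maxl.
have bB y : b%:R <= y -> B < y `^ q.
  move=> hy; have h : B `^ q^-1 < y.
    apply: lt_le_trans hy; apply: lt_le_trans (archi_boundP (powR_ge0 _ _)) _.
    by rewrite ler_nat leq_maxr.
  have -> : B = (B `^ q^-1) `^ q by rewrite -powRrM mulVf ?gt_eqF// powRr1// ltW.
  by apply: gt0_ltr_powR => //; rewrite nnegrE ?powR_ge0// (le_trans _ (ltW h))// powR_ge0.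
pose X j : R := amplitude_prod R b j.+1 `^ q.
have X0 j : 0 < X j by exact/powR_gt0/amplitude_prod_gt0.
have XB j : B < X j by apply/bB/amplitude_prod_ge.
have XS j : X j.+1 = X j * amplitude R b j.+1 `^ q.
  by rewrite /X [in LHS]amplitude_prodS powRM// ltW// ?amplitude_prod_gt0// amplitude_gt0.
have ex j : exists n, (n0 <= n)%N && (tau n * X j <= 1).
  have [n nn h] := tau_small (divr_gt0 ltr01 (X0 j)).
  by exists n; rewrite nn/= -ler_pdivlMr// ltW.
pose N j := ex_minn (ex j).
have NP j : (n0 <= N j)%N /\ tau (N j) * X j <= 1.
  by rewrite /N; case: ex_minnP => n /andP[].
have up j : 1 <= D ^+ 2 * tau (2 * N j)%N * X j.
  have [Nn0 NX] := NP j.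
  have ltN : (n0 < N j)%N.
    rewrite ltn_neqAle Nn0 andbT; apply/eqP => e; move: NX; rewrite -e => h.
    have : (tau n0)^-1 * 1 < X j by rewrite mulr1; apply: lt_trans (XB j); rewrite ltrDr.
    by rewrite ltr_pdivrMl// ltNge h.
  have n1 : (n0 <= (N j).-1)%N by rewrite -ltnS prednK// (leq_ltn_trans _ ltN).
  have h1 : 1 < tau (N j).-1 * X j.
    rewrite ltNge; apply/negP => h; move: ltN n1 h; rewrite /N; case: ex_minnP => n _ hmin lt n1 h.
    by have := hmin n.-1; rewrite n1 h => /(_ isT); move: lt; clear; lia.
  have h2 := tau_doubling n1; have h3 : tau (2 * (N j).-1)%N <= tau (N j).
    by apply: tau_mono => //; move: ltN n02; clear; lia.
  have h4 := tau_doubling Nn0.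
  apply: ltW; apply: lt_le_trans h1 _; rewrite ler_pM2r// expr2 -mulrA.
  apply: le_trans h2 _; rewrite ler_wpM2l ?(ltW D0)//.
  exact: le_trans h3 h4.
exists b, N; split => // [j|j|j]; [by case: (NP j)| |by case: (NP j)].
rewrite leqNgt; apply/negP => lt.
have [n1 h1] := NP j.+1; have h2 := tau_mono n1 (ltnW lt); have h3 := up j.
have h4 : D ^+ 2 < amplitude R b j.+1 `^ q.
  by apply: le_lt_trans (bB _ (amplitude_ge R b3 j.+1)); rewrite lerDl ltW.
have t2 : 0 < tau (2 * N j)%N by apply/tau_gt0/(leq_trans (NP j).1); rewrite leq_pmull.
have h5 : tau (2 * N j)%N * X j.+1 <= 1.
  by apply: le_trans h1; rewrite ler_wpM2r// ltW.
move: h5; rewrite XS mulrA leNgt => /negP; apply.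
apply: le_lt_trans h3 _; rewrite -mulrA mulrC.
by rewrite ltr_pM2l// mulr_gt0.
Qed.

End ExponentChoice.

(** * Growth of the product *)

Section ProductGrowth.
Variable R : realType.
Variables (b : nat) (N : nat -> nat).
Hypothesis b3 : (3 <= b)%N.
Hypothesis N2 : forall j, (2 <= N j)%N.
Hypothesis NN : forall j, (2 * N j <= N j.+1)%N.
Local Notation a := (amplitude R b).

Lemma pow_le_half n (r : R) : (0 < n)%N -> 0 <= r -> r <= 1 - n%:R^-1 -> r ^+ n <= 2^-1.
Proof.
move=> n0 r0 rn; have n0' : n%:R != 0 :> R by rewrite pnatr_eq0 -lt0n.
have h : r ^+ n <= expR (- n%:R^-1) ^+ n.
  apply: lerXn2r; rewrite ?nnegrE ?expR_ge0//.
  by apply: le_trans rn _; have := expR_ge1Dx (- n%:R^-1 : R).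
apply: le_trans h _; rewrite -expRM_natr mulNr mulVf// expRN lef_pV2 ?posrE ?expR_gt0//.
by have := expR_ge1Dx (1 : R); rewrite -(natrD _ 1 1).
Qed.

Lemma exponent_growth k i : (2 ^ i * N k <= N (k + i))%N.
Proof.
elim: i => [|i ih]; first by rewrite mul1n addn0.
by rewrite addnS expnS -mulnA; apply: leq_trans (NN _); rewrite leq_mul2l ih.
Qed.

Lemma sum_geometric_weights n :
  \sum_(i < n) i.+2%:R * 2^-1 ^+ i.+1 = 3 - n.+3%:R * 2^-1 ^+ n :> R.
Proof.
elim: n => [|n ih]; first by rewrite big_ord0 expr0 mulr1 subrr.
rewrite big_ord_recr /= ih exprS -[n.+4%:R]natr1 -[n.+3%:R]natr1 -[n.+2%:R]natr1 -[n.+1%:R]natr1.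
by field.
Qed.

(** Since [r ^+ N k <= 1 / 2], the power in the factor of index [k.+1 + i] is at most
    [2^-1 ^+ (2 ^ i.+1)], hence at most the square of [2^-1 ^+ i.+1]. *)
Lemma late_factor k i (r : R) : 0 <= r -> r <= 1 - (N k)%:R^-1 ->
  1 + a (k.+1 + i) * r ^+ N (k.+1 + i) <=
  expR (2 * (b%:R * k.+1%:R) * (i.+2%:R * 2^-1 ^+ i.+1)).
Proof.
move=> r0 rk; have r1 : r <= 1 by apply: le_trans rk _; rewrite gerBl invr_ge0.
(* [i.+1 <= 2 ^ i] turns the doubly exponential bound into a square *)
pose s : R := 2^-1 ^+ i.+1; have s0 : 0 <= s by rewrite exprn_ge0.
have rs : r ^+ N (k.+1 + i) <= s ^+ 2.
  apply: le_trans (_ : r ^+ (2 ^ i.+1 * N k) <= _).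
    by apply: ler_wiXn2l => //; rewrite addSnnS exponent_growth.
  rewrite mulnC exprM; apply: le_trans (_ : 2^-1 ^+ (2 ^ i.+1) <= _).
    by apply: lerXn2r; rewrite ?nnegrE ?exprn_ge0// pow_le_half// (leq_trans _ (N2 k)).
  by rewrite /s -exprM; apply: ler_wiXn2l; [lra|lra|rewrite expnSr leq_mul2r ltn_expl].
pose y : R := b%:R * k.+1%:R * (i.+2%:R * s).
have y0 : 0 <= y by rewrite /y !mulr_ge0.
have h1 : 1 + a (k.+1 + i) * r ^+ N (k.+1 + i) <= (1 + y) ^+ 2.
  apply: le_trans (_ : 1 + y ^+ 2 <= _); last by nra.
  rewrite lerD2l /a; apply: le_trans (_ : (b%:R * (k.+1 + i).+1%:R) ^+ 2 * s ^+ 2 <= _).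
    by rewrite ler_wpM2l// sqr_ge0.
  rewrite -exprMn; apply: lerXn2r; rewrite ?nnegrE ?mulr_ge0//.
  rewrite /y mulrA ler_wpM2r// -mulrA ler_wpM2l// -natrM ler_nat; nia.
apply: le_trans h1 _; rewrite -mulrA -/s -/y expRM_natl.
apply: lerXn2r; rewrite ?nnegrE ?expR_ge0 ?expR_ge1Dx//; lra.
Qed.

Definition growth_base : R := 2 * expR (6 * b%:R).

(** Up to the radius [1 - 1 / N k] the factors with index at most [k] are bounded by
    twice their amplitudes.  In the later ones the doubly exponential decay of the
    powers beats the amplitudes; squares as amplitudes turn their product into an
    exponential that is only linear in [k]. *)
Lemma product_growth k (r : R) : 0 <= r -> r <= 1 - (N k)%:R^-1 -> forall K,
  \prod_(j < K) (1 + a j * r ^+ N j) <= growth_base ^+ k.+1 * amplitude_prod R b k.+1.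
Proof.
move=> r0 rk K; have r1 : r <= 1 by apply: le_trans rk _; rewrite gerBl invr_ge0.
have a0 j : 0 < a j by exact: amplitude_gt0.
have f1 j : 1 <= 1 + a j * r ^+ N j by rewrite lerDl mulr_ge0 ?exprn_ge0// ltW.
have p1 (g : nat -> nat) m : 1 <= \prod_(j < m) (1 + a (g j) * r ^+ N (g j)).
  elim: m => [|m ih]; first by rewrite big_ord0.
  by rewrite big_ord_recr /= mulr_ege1.
(* all factors are at least 1, so the range may be enlarged to contain the first [k.+1] *)
apply: le_trans (_ : \prod_(j < K + k.+1) (1 + a j * r ^+ N j) <= _).
  rewrite big_split_ord /= ler_peMr ?(p1 (addn K))//.
  by apply: le_trans (p1 id K).
rewrite addnC big_split_ord /= /growth_base exprMn -expRM_natl.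
rewrite -mulrA mulrCA [leRHS]mulrC; apply: ler_pM.
- by apply: le_trans (p1 id k.+1).
- by apply: le_trans (p1 (addn k.+1) K).
- rewrite -[X in 2 ^+ X](card_ord k.+1) -prodr_const /amplitude_prod -big_split /=.
  apply: ler_prod => j _; rewrite (le_trans _ (f1 j))//=.
  have : a j * r ^+ N j <= a j by rewrite ler_piMr ?(ltW (a0 _))// exprn_ile1.
  by have := amplitude_gt1 R b3 j; lra.
apply: le_trans (_ : \prod_(i < K) expR (2 * (b%:R * k.+1%:R) * (i.+2%:R * 2^-1 ^+ i.+1)) <= _).
  by apply: ler_prod => i _; rewrite (le_trans _ (f1 _))//= late_factor.
rewrite -expR_sum ler_expR -mulr_sumr sum_geometric_weights.
have -> : k.+1%:R * (6 * b%:R) = 2 * (b%:R * k.+1%:R) * 3 :> R by ring.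
by rewrite ler_wpM2l ?mulr_ge0// gerBl mulr_ge0 ?exprn_ge0.
Qed.

Lemma exponent_ge k : (k < N k)%N.
Proof. by elim: k => [|k ih]; [exact: leq_trans (N2 0)|apply: leq_trans (NN _); clear -ih; lia]. Qed.

Lemma radii_exhaust (r : R) : r < 1 -> exists k, r < 1 - (N k)%:R^-1.
Proof.
move=> r1; have e0 : 0 < 1 - r by rewrite subr_gt0.
pose k := Num.bound (1 - r)^-1; exists k.
have h : (1 - r)^-1 < (N k)%:R.
  apply: lt_trans (archi_boundP _) _; first by rewrite invr_ge0 ltW.
  by rewrite ltr_nat exponent_ge.
have : (N k)%:R^-1 < 1 - r.
  by rewrite -[1 - r]invrK ltf_pV2 ?posrE ?invr_gt0// (lt_trans _ h)// invr_gt0.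
lra.
Qed.

Lemma bounded_sums_of_ratio (t : nat -> R) k0 : (forall k, 0 <= t k) ->
  (forall k, (k0 <= k)%N -> t k.+1 <= t k / 2) ->
  exists M : R, forall n, \sum_(k < n) t k <= M.
Proof.
move=> t0 ht; exists (\sum_(k < k0) t k + 2 * t k0) => n.
have h m : \sum_(k < k0 + m) t k + 2 * t (k0 + m)%N <= \sum_(k < k0) t k + 2 * t k0.
  elim: m => [|m ih]; first by rewrite addn0.
  apply: le_trans ih; rewrite addnS big_ord_recr /= -addrA lerD2l.
  by have := ht _ (leq_addr m k0); lra.
apply: le_trans (h n); rewrite addnC big_split_ord /= -addrA lerDl.
by rewrite addr_ge0 ?mulr_ge0// sumr_ge0.
Qed.

(** The ratio of consecutive terms tends to 0 like [a k `^ (p - q)]. *)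
Lemma growth_summable (p q : R) : 0 < p -> p < q -> exists M : R, forall n,
  \sum_(k < n) (growth_base ^+ k.+2 * amplitude_prod R b k.+2) `^ p /
    amplitude_prod R b k.+1 `^ q <= M.
Proof.
move=> p0 pq; set F := growth_base; set A := amplitude_prod R b.
have F0 : 0 < F by rewrite mulr_gt0// expR_gt0.
have A0 k : 0 < A k by exact: amplitude_prod_gt0.
have a0 j : 0 < a j by exact: amplitude_gt0.
have q0 : 0 < q - p by rewrite subr_gt0.
pose L : R := 2 * (4 * F) `^ p; have L0 : 0 < L by rewrite mulr_gt0// powR_gt0// mulr_gt0.
have hL k : (Num.bound (L `^ (q - p)^-1) <= k)%N -> L <= a k.+1 `^ (q - p).
  move=> hk; have -> : L = (L `^ (q - p)^-1) `^ (q - p).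
    by rewrite -powRrM mulVf ?gt_eqF// powRr1// ltW.
  apply: le_powR; rewrite ?powR_ge0// ?ltW//.
  apply: lt_le_trans (archi_boundP (powR_ge0 _ _)) _.
  apply: le_trans (_ : k.+2%:R <= _); first by rewrite ler_nat (leq_trans hk)// leqW.
  have k1 : 1 <= k.+2%:R :> R by rewrite (ler_nat R 1).
  have := ler_b R b3; rewrite /a; move: (k.+2%:R : R) k1 (b%:R : R) => u u1 v v3.
  have h1 : u <= v * u by rewrite ler_peMl//; lra.
  by move: (v * u) h1 => x h1; nra.
have AS k : A k.+1 = A k * a k by exact: amplitude_prodS.
pose T k : R := (F ^+ k.+2 * A k.+2) `^ p / A k.+1 `^ q.
apply: (@bounded_sums_of_ratio T (Num.bound (L `^ (q - p)^-1))) => [k|k /hL hk].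
  by rewrite /T divr_ge0 ?powR_ge0.
rewrite {1}/T exprS [A k.+3]AS [in A k.+2 `^ q]AS.
have FA : 0 < F ^+ k.+2 * A k.+2 by rewrite mulr_gt0 ?exprn_gt0.
have -> : F * F ^+ k.+2 * (A k.+2 * a k.+2) = (F ^+ k.+2 * A k.+2) * (F * a k.+2) by ring.
have Fa : 0 <= F * a k.+2 by rewrite mulr_ge0// ltW.
rewrite (powRM p (ltW FA) Fa) (powRM q (ltW (A0 _)) (ltW (a0 _))) invfM mulrACA -/(T k).
have t0 : 0 <= T k by rewrite /T divr_ge0 ?powR_ge0.
rewrite ler_wpM2l// ler_pdivrMr; last exact/powR_gt0.
apply: le_trans (_ : (4 * F) `^ p * a k.+1 `^ p <= _).
  rewrite -(powRM p _ (ltW (a0 _))); last by rewrite mulr_ge0// ltW.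
  apply: le_powR => //; first exact: ltW.
  by rewrite -[4 * F * _]mulrA [4 * (F * _)]mulrCA ler_wpM2l ?(ltW F0)// amplitude_le4.
have -> : a k.+1 `^ q = a k.+1 `^ p * a k.+1 `^ (q - p).
  by rewrite -powRD ?(gt_eqF (a0 _)) ?implybT// [p + _]addrC subrK.
rewrite [leRHS]mulrCA [leLHS]mulrC; apply: ler_wpM2l; first exact: powR_ge0.
by rewrite -ler_pdivrMl ?invr_gt0// invrK.
Qed.

End ProductGrowth.

(** * The extremal function *)

Section SharpExample.
Variable R : realType.
Local Notation C := (cplx R).
Variables (w : C -> R) (q : R).
Hypothesis hw : continuous_radial_weight w.
Hypothesis q0 : 0 < q.
Variables (kappa r1 : R).
Hypothesis kappa0 : 0 < kappa.
Hypothesis r101 : 0 < r1 < 1.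
Hypothesis hdom : tail_dominates w kappa r1.

Definition tail_at (n : nat) : R := tail w (1 - n%:R^-1).

Lemma inv_nat_lt (r : R) : r < 1 -> exists2 n : nat, (2 <= n)%N & forall m, (n <= m)%N ->
  r <= 1 - m%:R^-1 < (1 : R).
Proof.
move=> r1'; have e0 : 0 < (1 - r)^-1 by rewrite invr_gt0 subr_gt0.
exists (maxn 2 (Num.bound (1 - r)^-1)); first exact: leq_maxl.
move=> m; rewrite geq_max => /andP[m2 hm].
have m0 : 0 < m%:R :> R by rewrite ltr0n; lia.
have mi : 0 < m%:R^-1 :> R by rewrite invr_gt0.
have : m%:R^-1 <= 1 - r.
  rewrite -[1 - r]invrK lef_pV2 ?posrE// (le_trans (ltW (archi_boundP (ltW e0))))//.
  by rewrite ler_nat.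
by move=> h; apply/andP; split; lra.
Qed.

(** At [n = N 0 + ... + N k] the product of the inverse moduli of the zeros is
    [amplitude_prod R b k.+1], and [n <= 2 * N k], so by doubling the tail at [n] is still
    comparable to the power [- q] of that product. *)
Lemma sharp_example : exists f z,
  [/\ forall p, 0 < p < q -> bergman p w f, f 0 != 0, zero_sequence f z,
      {homo (fun k => cabs (z k)) : m n / (m <= n)%N >-> m <= n}
    & exists2 e : R, 0 < e & forall n1, exists2 n, (n1 <= n)%N &
        e * tail_at n `^ (- q^-1) < \prod_(k < n) (1 / cabs (z k))].
Proof.
have [r10 r11] := andP r101.
have [D D1 hD] := tail_doubling hw kappa0 r10 hdom.
have [n0 n02 hn0] := inv_nat_lt r11.
have tau_gt0 n : (n0 <= n)%N -> 0 < tail_at n.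
  by move=> /hn0 h; exact: tail_gt0 hw _ _ _ kappa0 r10 hdom h.
have radius_mono m n : (n0 <= m)%N -> (m <= n)%N -> 1 - m%:R^-1 <= 1 - n%:R^-1 :> R.
  move=> m0 mn; rewrite lerD2l lerN2 lef_pV2 ?posrE ?ltr0n ?ler_nat//; lia.
have tau_mono m n : (n0 <= m)%N -> (m <= n)%N -> tail_at n <= tail_at m.
  move=> m0 mn; have /andP[h1 h2] := hn0 _ m0; have /andP[_ h3] := hn0 _ (leq_trans m0 mn).
  by apply: tail_mono => //; [exact: lt_le_trans r10 h1|exact: radius_mono].
have tau_small (e : R) : 0 < e -> exists2 n, (n0 <= n)%N & tail_at n < e.
  move=> /(tail_cvg0 hw)[r /andP[_ r1'] hr]; have [n _ hn] := inv_nat_lt r1'.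
  exists (maxn n0 n); first exact: leq_maxl.
  by have /andP[h1 h2] := hn _ (leq_maxr n0 n); exact: hr.
have tau_doubling n : (n0 <= n)%N -> tail_at n <= D * tail_at (2 * n)%N.
  move=> nn; have := hD _ (hn0 _ nn).
  have -> // : (1 + (1 - n%:R^-1)) / 2 = 1 - (2 * n)%:R^-1 :> R.
  rewrite natrM; have : n%:R != 0 :> R by rewrite pnatr_eq0; lia.
  by move=> h; field.
have [b [N [b3 Nn0 NN hlow hup]]] := exponents_exist q0 n02 D1 tau_gt0 tau_mono tau_small tau_doubling.
have N2 j : (2 <= N j)%N by exact: leq_trans (Nn0 j).
have bnd (r : R) : 0 <= r < 1 ->
    exists M : R, forall K, \prod_(j < K) (1 + amplitude R b j * r ^+ N j) <= M.
  move=> /andP[r0 rlt1]; have [k /ltW rk] := radii_exhaust N2 NN rlt1.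
  by eexists; exact: product_growth b3 N2 NN _ _ r0 rk.
have N0 : (0 < N 0)%N by exact: leq_trans (N2 0%N).
have [f [z [[af f0] fle fz zhomo zprod]]] :=
  lacunary_product (amplitude_gt1 R b3) (amplitude_lt_sqr R b3) N0 NN bnd.
exists f, z; split => //.
- move=> p /andP[p0 pq]; have [M hM] := growth_summable b3 p0 pq.
  have A0 k : 0 < amplitude_prod R b k.+1 `^ q by exact/powR_gt0/amplitude_prod_gt0.
  have F0 : 0 < growth_base R b by rewrite mulr_gt0// expR_gt0.
  pose G k := growth_base R b ^+ k.+1 * amplitude_prod R b k.+1.
  have G0 k : 0 <= G k by rewrite mulr_ge0 ?exprn_ge0 ?ltW// amplitude_prod_gt0.
  apply: (@bergman_of_growth _ w p f hw p0 af (fun k => 1 - (N k)%:R^-1) G M) => //.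
  + move=> k; have /andP[h1 ->] := hn0 _ (Nn0 k); rewrite andbT; exact: lt_le_trans h1.
  + exact: radii_exhaust.
  + move=> k x xk; have x0 := cabs_ge0 x.
    apply: fle; last exact: product_growth b3 N2 NN k _ x0 (ltW xk).
    by apply: lt_trans xk _; have /andP[_] := hn0 _ (Nn0 k).
  + move=> n; apply: le_trans (hM n); apply: ler_sum => k _.
    by rewrite -/(G k.+1) ler_wpM2l ?powR_ge0// -[leRHS]mul1r ler_pdivlMr//; exact: hlow.
- have D0 : 0 < D by lra.
  pose s := q^-1; have s0 : 0 < s by rewrite invr_gt0.
  pose c := (D ^+ 2) `^ s; have c0 : 0 < c by apply/powR_gt0; rewrite exprn_gt0.
  exists (c^-1 / 2); first by rewrite divr_gt0// invr_gt0.
  move=> n1; pose cnt k := (\sum_(j < k) N j)%N; exists (cnt n1.+1).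
    rewrite /cnt; elim: (n1) => // m ih; rewrite big_ord_recr /=.
    by apply: leq_ltn_trans ih _; rewrite -addn1 leq_add2l; exact: ltnW (N2 _).
  have cntN k : (cnt k.+1 <= 2 * N k)%N.
    elim: k => [|k ih]; first by rewrite /cnt big_ord1 leq_pmull.
    rewrite /cnt big_ord_recr /=; apply: leq_trans (leq_add ih (leqnn _)) _.
    by rewrite [leqRHS]mul2n -addnn leq_add2r.
  have Ncnt : (n0 <= cnt n1.+1)%N.
    by rewrite /cnt big_ord_recr /=; apply: leq_trans (Nn0 n1) (leq_addl _ _).
  rewrite zprod -/(amplitude_prod R b n1.+1); set A := amplitude_prod R b n1.+1.
  have A0 : 0 < A by exact: amplitude_prod_gt0.
  have t0 := tau_gt0 _ Ncnt; set t := tail_at _ in t0 *.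
  have h : 1 <= D ^+ 2 * t * A `^ q.
    apply: le_trans (hup n1) _; rewrite ler_wpM2r ?powR_ge0// ler_wpM2l ?sqr_ge0//.
    exact: tau_mono (cntN n1).
  have {}h : 1 <= c * t `^ s * A.
    have D2 : 0 <= D ^+ 2 by exact: sqr_ge0.
    have := le_powR (ltW s0) ler01 h.
    rewrite powR1 (powRM s (mulr_ge0 D2 (ltW t0)) (powR_ge0 _ _)) (powRM s D2 (ltW t0)) -/c.
    by rewrite -powRrM mulfV ?gt_eqF// powRr1// ltW.
  have ts0 : 0 < t `^ s by exact: powR_gt0.
  rewrite powRN -/s -(ltr_pM2r ts0) divfK ?gt_eqF// ltr_pdivrMl//.
  by rewrite [A * _]mulrC mulrA; lra.
Qed.

End SharpExample.

Theorem theorem3p10 (R : realType) (q : R) (w : cplx R -> R)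
    (hq : 0 < q)
    (hw : rapidly_increasing_weight w \/ regular_weight w) :
  (exists f : cplx R -> cplx R,
     [/\ (\bigcap_(p in [set p : R | 0 < p < q]) bergman p w) f,
         f 0 != 0
       & exists z : nat -> cplx R,
           [/\ zero_sequence f z,
               {homo (fun k => cabs (z k)) : m n / (m <= n)%N >-> m <= n}
             & ~ ((fun n : nat => \prod_(k < n) (1 / cabs (z k)) : R) =o_\oo
                  (fun n : nat => tail w (1 - n%:R^-1) `^ (- q^-1)))]])
  /\
  (exists z : nat -> cplx R,
     zero_set (\bigcap_(p in [set p : R | 0 < p < q]) bergman p w) z /\
     ~ zero_set (bergman q w) z).
Proof.
have [cw [kappa [r1 [k0 r101 hdom]]]] := tail_dominatesP hw.
have [f [z [fb f0 fz zhomo [e e0 he]]]] := sharp_example cw hq k0 r101 hdom.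
split.
  exists f; split => //; exists z; split => //.
  move=> /eqoP/(_ e e0)[n1 _ h]; have [n /h hn] := he n1.
  rewrite ltNge => /negP; apply; apply: le_trans (ler_norm _) (le_trans hn _).
  by rewrite ger0_norm ?powR_ge0.
exists z; split; first by exists f.
move=> [g gb gz].
have z0 k : z k != 0 by exact: zero_sequence_neq0 fz f0.
have g0 : g 0 != 0.
  have D0 : disc (0 : cplx R) by rewrite /disc /mkset cabs0.
  have [m [h [_ h0 /nbhs_singleton gE]] hc] := gz.2 _ D0.
  have m0 : m = 0%N.
    move: hc; have -> : [set k | z k = 0] = set0.
      by apply/seteqP; split => // k /= zk; move: (z0 k); rewrite zk eqxx.
    rewrite card_eq_sym card_eq0 => /eqP e0'; apply/eqP; rewrite eqn0Ngt.
    by apply/negP => m0; have : `I_m 0%N by []; rewrite e0'.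
  by rewrite gE m0 expr0 mul1r.
have [n1 h] := bergman_zeros_small cw hq k0 r101 hdom gb g0 gz e0.
have [n /h hn] := he n1; rewrite ltNge => /negP; exact.
Qed.
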